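(* Let $X$ be a complex Banach space and let $-A$ be the generator of a bounded $C_0$-semigroup $(T(t))_{t\ge 0}$ on $X$ such that $\overline{\mathrm{ran}}(A)=X$. Let $g$ be a Stieltjes function with representation $(0,0,\mu)$ and $g(0+)=\infty$. If $x\in X$ is such that $$\int_1^\infty \frac{g(1/t)\,\|C_t(A)x\|}{t}\,dt<\infty,$$ then $x\in \mathrm{dom}(g(A))$.
   Context: Cesàro means: $C_t(A)x:=\frac1t\int_0^t T(s)x\,ds$ for $t>0$, $x\in X$. Stieltjes functions: a Stieltjes function with representation $(0,0,\mu)$ is a function $g(z)=\int_{(0,\infty)}\frac{\mu(ds)}{z+s}$, $z>0$, where $\mu$ is a positive Radon measure on $(0,\infty)$ with $\int_{(0,\infty)}\frac{\mu(ds)}{1+s}<\infty$; the same formula extends $g$ holomorphically to $\mathbb C_+=\{z:\mathrm{Re}\, z>0\}$. Here $g(0+)=\lim_{s\to0+}g(s)$. Extended Hille–Phillips calculus: let $\mathcal A$ be the set of Laplace transforms $e(z)=\int_{[0,\infty)}e^{-sz}\,\nu(ds)$ of bounded Radon measures $\nu$ on $[0,\infty)$, and for such $e$ put $e(A)=\int_{[0,\infty)}T(s)\,\nu(ds)$ (strongly convergent integral). A holomorphic $h:\mathbb C_+\to\mathbb C$ is regularizable if there is $e\in\mathcal A$ with $eh\in\mathcal A$ and $e(A)$ injective; then $h(A):=e(A)^{-1}(eh)(A)$ with domain $\mathrm{dom}(h(A))=\{x\in X:(eh)(A)x\in\mathrm{ran}(e(A))\}$, and this does not depend on the choice of $e$.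 When $\overline{\mathrm{ran}}(A)=X$ (so that $\ker A=\{0\}$), every Stieltjes function is regularizable by $e(z)=z/(z+1)$, and $g(A)$ is the closed operator so obtained. *)

(* Defs.v *)
From HB Require Import structures.
From mathcomp Require Import all_boot all_order all_algebra.
From mathcomp Require Import complex.
From mathcomp Require Import all_classical all_reals all_analysis.

Set Implicit Arguments.
Unset Strict Implicit.
Unset Printing Implicit Defensive.
Import Order.TTheory GRing.Theory Num.Theory.
Import numFieldNormedType.Exports.
Local Open Scope classical_set_scope.
Local Open Scope complex_scope.
Local Open Scope ring_scope.

(* A complex Banach space is a completeNormedModType R[i]; its norm takes
   values in R[i], so its real part is the usual real-valued norm. *)
Definition rnorm (R : realType) (X : normedModType R[i]) (x : X) : R :=
  complex.Re `|x|.

(* Bochner integral of f over D: the limit of the integrals of step functions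
   s_n with \int_D ||f - s_n|| dmu --> 0. A step function
   \sum_k 1_(E_k) v_k is encoded by the list of the pairs (E_k, v_k); the E_k
   need not be disjoint. *)
Section Bochner.
Context (R : realType) (X : completeNormedModType R[i]).
Context (d : measure_display) (T : measurableType d).
Implicit Types (mu : {measure set T -> \bar R}) (D : set T) (f : T -> X).
Implicit Types s : seq (set T * X).

Definition step_fun s (t : T) : X :=
  \sum_(p <- s) (\1_(p.1) t : R)%:C *: p.2.

Definition step_integrable mu D s : Prop :=
  {in s, forall p, measurable p.1 /\ (mu (p.1 `&` D) < +oo)%E}.

Definition step_integral mu D s : X :=
  \sum_(p <- s) (fine (mu (p.1 `&` D)))%:C *: p.2.

Definition is_bochner mu D f (y : X) : Prop :=
  exists s : nat -> seq (set T * X),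
    [/\ forall n, step_integrable mu D (s n),
        forall n, measurable_fun D (fun t => rnorm (f t - step_fun (s n) t)),
        (\int[mu]_(t in D) (rnorm (f t - step_fun (s n) t))%:E)%E
          @[n --> \oo] --> 0%E
      & step_integral mu D (s n) @[n --> \oo] --> y].

(* 0 by convention when f is not integrable *)
Definition bochner mu D f : X := xget 0 [set y | is_bochner mu D f y].

End Bochner.

Section ComplexScalars.
Context (R : realType).

Definition cexp (z : R[i]) : R[i] :=
  (expR (complex.Re z) * cos (complex.Im z))
  +i* (expR (complex.Re z) * sin (complex.Im z)).

Definition cintegral (mu : {measure set (measurableTypeR R) -> \bar R})
    (D : set R) (f : R -> R[i]) : R[i] :=
  (\int[mu]_(s in D) complex.Re (f s)) +i* (\int[mu]_(s in D) complex.Im (f s)).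

Definition holomorphic_Cplus (h : R[i] -> R[i]) : Prop :=
  forall z : R[i], 0 < complex.Re z -> derivable (h : R[i]^o -> R[i]^o) z 1.

(* A bounded complex Borel measure in the form (p - q) + i (r - s) with p, q,
   r, s finite positive measures, which exists by the Jordan decomposition.
   Only the restriction to [0, +oo[ is ever used. On R, every finite Borel
   measure is Radon. *)
Record cmeasure := CMeasure {
  re_pos : {finite_measure set (measurableTypeR R) -> \bar R} ;
  re_neg : {finite_measure set (measurableTypeR R) -> \bar R} ;
  im_pos : {finite_measure set (measurableTypeR R) -> \bar R} ;
  im_neg : {finite_measure set (measurableTypeR R) -> \bar R} }.

Definition laplace (nu : cmeasure) (z : R[i]) : R[i] :=
  let I mu := cintegral mu `[0, +oo[ (fun s => cexp (- s%:C * z)) in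
  I (re_pos nu) - I (re_neg nu) + 'i%C * (I (im_pos nu) - I (im_neg nu)).

End ComplexScalars.

Section Semigroup.
Context (R : realType) (X : completeNormedModType R[i]).
(* only the values of T at nonnegative times matter *)
Implicit Types (T : R -> {linear X -> X}).

Record bounded_C0_semigroup T : Prop := BoundedC0Semigroup {
  semigroup0 : forall x, T 0 x = x ;
  semigroupD : forall s t, 0 <= s -> 0 <= t -> forall x,
    T (s + t) x = T s (T t x) ;
  semigroup_cvg : forall x, T t x @[t --> 0^'+] --> x ;
  semigroup_bounded : exists M : R, forall t, 0 <= t -> forall x,
    rnorm (T t x) <= M * rnorm x }.

(* The (possibly unbounded) operator G, with domain dom, generates T; the
   values of G outside dom are irrelevant. *)
Definition is_generator T (dom : set X) (G : X -> X) : Prop :=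
  let q x (h : R) := (h^-1)%:C *: (T h x - x) in
  dom = [set x | cvg (q x h @[h --> 0^'+])] /\
  forall x, dom x -> q x h @[h --> 0^'+] --> G x.

Definition cesaro_mean T (t : R) (x : X) : X :=
  (t^-1)%:C *: bochner (@lebesgue_measure R) `[0, t] (fun s => T s x).

(* e(A) x, for e the Laplace transform of nu *)
Definition hp_op T (nu : cmeasure R) (x : X) : X :=
  let I (mu : {finite_measure set (measurableTypeR R) -> \bar R}) :=
    bochner mu `[0, +oo[ (fun s => T s x) in
  I (re_pos nu) - I (re_neg nu) + 'i%C *: (I (im_pos nu) - I (im_neg nu)).

(* nu represents a regularizer e of h, and nuh represents e h *)
Definition regularizes T (h : R[i] -> R[i]) (nu nuh : cmeasure R) : Prop :=
  (forall z, 0 < complex.Re z -> laplace nu z * h z = laplace nuh z) /\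
  injective (hp_op T nu).

(* the graph of h(A) = e(A)^-1 (e h)(A) *)
Definition hp_calculus T (h : R[i] -> R[i]) (x y : X) : Prop :=
  holomorphic_Cplus h /\
  exists nu nuh, regularizes T h nu nuh /\ hp_op T nu y = hp_op T nuh x.

Definition hp_dom T (h : R[i] -> R[i]) : set X :=
  [set x | exists y, hp_calculus T h x y].

End Semigroup.

Section Stieltjes.
Context (R : realType).
Implicit Types mu : {measure set (measurableTypeR R) -> \bar R}.

(* mu is a measure on R of which only the restriction to ]0, +oo[ is used;
   a Borel measure on ]0, +oo[ is Radon iff it is finite on compact sets *)
Definition stieltjes_measure mu : Prop :=
  (forall K : set R, compact K -> K `<=` `]0, +oo[ -> (mu K < +oo)%E) /\
  (\int[mu]_(s in `]0%R, +oo[) ((1 + s)^-1)%:E < +oo)%E.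

Definition stieltjes mu (t : R) : R := \int[mu]_(s in `]0, +oo[) (t + s)^-1.

Definition stieltjesC mu (z : R[i]) : R[i] :=
  cintegral mu `]0, +oo[ (fun s => (z + s%:C)^-1).

Lemma stieltjesC_real mu (t : R) : stieltjesC mu t%:C = (stieltjes mu t)%:C.
Proof.
rewrite /stieltjesC /cintegral /stieltjes.
under eq_Rintegral do rewrite -rmorphD -fmorphV /=.
congr Complex.
under eq_Rintegral do rewrite -rmorphD -fmorphV /=.
by rewrite Rintegral_cst// mul0r.
Qed.

End Stieltjes.

(* Main.v *)
Require Import Defs.
From HB Require Import structures.
From mathcomp Require Import all_boot all_order all_algebra.
From mathcomp Require Import complex.
From mathcomp Require Import all_classical all_reals all_analysis.
From mathcomp Require Import measurable_realfun.
From mathcomp Require Import ring lra.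

Set Implicit Arguments.
Unset Strict Implicit.
Unset Printing Implicit Defensive.
Import Order.TTheory GRing.Theory Num.Theory.
Import numFieldNormedType.Exports.
Local Open Scope classical_set_scope.
Local Open Scope ring_scope.

(** Write R_r = (r + A)^-1 for the resolvents. The regularizer is
    e(z) = z / (z + 1), for which e(A) = 1 - R_1; the value of g(A) at x is
    y = int_(0,oo) R_r x mu(dr). This integral converges absolutely: with
    S_t = int_0^t T(s) x ds, integration by parts gives
    R_r x = r int_0^oo e^(-rt) S_t dt, and u e^(-u) <= 4 / (1 + u) bounds the
    mu-integral of r e^(-rt) |S_t| by 4 g(1/t) |C_t(A) x| / t.

    The identity e(A) y = (e g)(A) x follows by Fubini's theorem from
    R_r - R_1 R_r = R_(max r 1) - (min r 1) R_1 R_r for r > 0, whose right-hand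
    side exhibits e g as the Laplace transform of the difference of two finite
    positive measures; all vector identities are reduced to real ones by a
    Hahn-Banach theorem. That e g is this Laplace transform as a function of z is
    the same identity for the semigroup T(t) = e^(-tz) on the Banach space of
    complex numbers.

    If R_1 x = x then r R_r x = x for all r > 0, whereas
    r R_r x tends to 0 as r -> 0+ when ran A is dense; hence e(A) is injective. *)

(** Integrability near [r = 0] shapes the identity. With [g(0+)] infinite, [1 / r] is not
    [mu]-integrable, whereas the kernels of [R_r] and of [R_1 R_r] both have total mass [1 / r];
    taken separately they do not give finite measures. After the rearrangement both kernels have
    mass [1 / max(r, 1)], at most [2 / (1 + r)], which is integrable for every Stieltjes measure. As
    [mu] may have infinite mass, Fubini's theorem is applied to the finite measure [mu / (1 + r)],
    with the factor [1 + r] moved into the kernel.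

    The integral condition on the Cesàro means concerns [t >= 1] only. On [0 <= t < 1] the estimate
    [|S_t| <= M |x| t] is enough: that part of [R_r x] costs at most a multiple of [1 / (1 + r)].

    Functionals are taken real-linear, so that measurability, dominated convergence and Fubini's
    theorem only concern real-valued functions; a norming functional chosen for each vector recovers
    norm estimates. *)

Lemma normcR (R : realType) (a : R) : `|a%:C%C| = `|a|%:C%C.
Proof. by rewrite normc_def /= expr0n addr0 sqrtr_sqr. Qed.

(** * The real-valued norm of a complex normed space *)

Section RealNorm.
Context (R : realType) (X : normedModType R[i]).
Implicit Types u v w : X.

Lemma normCE v : `|v| = (rnorm v)%:C%C.
Proof. by rewrite /rnorm RRe_real// normr_real. Qed.

Lemma rnorm_ge0 v : 0 <= rnorm v.
Proof. by rewrite -(@lecR R) -normCE normr_ge0. Qed.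

Lemma rnorm0 : rnorm (0 : X) = 0.
Proof. by rewrite /rnorm normr0. Qed.

Lemma rnorm_eq0 v : rnorm v = 0 -> v = 0.
Proof. by move=> v0; apply/normr0_eq0; rewrite normCE v0. Qed.

Lemma rnormN v : rnorm (- v) = rnorm v.
Proof. by rewrite /rnorm normrN. Qed.

Lemma rnormD u v : rnorm (u + v) <= rnorm u + rnorm v.
Proof. by have := ler_normD u v; rewrite !normCE -rmorphD lecR. Qed.

Lemma rnormB u v : rnorm (u - v) <= rnorm u + rnorm v.
Proof. by rewrite -(rnormN v) rnormD. Qed.

Lemma rnorm_distC u v : rnorm (u - v) = rnorm (v - u).
Proof. by rewrite -rnormN opprB. Qed.

Lemma rnorm_distD w u v : rnorm (u - v) <= rnorm (u - w) + rnorm (w - v).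
Proof. by rewrite (le_trans _ (rnormD _ _))// addrA subrK. Qed.

Lemma rnormZ (a : R) v : rnorm (a%:C%C *: v) = `|a| * rnorm v.
Proof. by rewrite /rnorm normrZ normcR normCE -rmorphM. Qed.

(** Balls of [X] have radii in [R[i]]; every positive element of [R[i]] is the image of a positive
    real, so convergence can be tested by the real norm. *)
Lemma cvg_rnorm {I : Type} (F : set_system I) {FF : Filter F} (f : I -> X) v :
  (f t @[t --> F] --> v) <-> (rnorm (f t - v) @[t --> F] --> (0 : R)).
Proof.
split=> [fv|fv].
  apply/cvgrPdist_lt => e e0.
  have /cvgrPdist_lt/(_ e%:C%C) := fv; rewrite ltcR => /(_ e0).
  apply: filterS => t; rewrite normCE ltcR sub0r normrN ger0_norm ?rnorm_ge0//.
  by rewrite rnorm_distC.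
apply/cvgrPdist_lt => e e0.
have eE : e = (complex.Re e)%:C%C by rewrite RRe_real// gtr0_real.
have := e0; rewrite eE ltcR => e0'.
have /cvgrPdist_lt/(_ (complex.Re e) e0') := fv.
apply: filterS => t; rewrite sub0r normrN ger0_norm ?rnorm_ge0// => h.
by rewrite normCE ltcR rnorm_distC.
Qed.

Lemma rnorm_dist_le u v : `|rnorm u - rnorm v| <= rnorm (u - v).
Proof.
have := rnormD (u - v) v; have := rnormD (v - u) u.
by rewrite !subrK rnorm_distC ler_norml; lra.
Qed.

End RealNorm.

Lemma cvg_real_complex (R : realType) {I : Type} (F : set_system I) {FF : Filter F}
    (f : I -> R) (l : R) :
  f t @[t --> F] --> l -> ((f t)%:C%C : R[i]^o) @[t --> F] --> (l%:C%C : R[i]^o).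
Proof.
move=> fl; apply/cvg_rnorm/cvgrPdist_le => e e0.
have /cvgrPdist_le/(_ _ e0) := fl.
apply: filterS => t H; rewrite sub0r normrN ger0_norm ?rnorm_ge0//.
by rewrite rnorm_distC /rnorm -rmorphB normcR.
Qed.

Lemma dist_maxr0_le (R : realDomainType) (s t : R) :
  `|Num.max s 0 - Num.max t 0| <= `|t - s|.
Proof.
have h1 := ler_norm (t - s).
have h2 : s - t <= `|t - s| by rewrite distrC ler_norm.
rewrite ler_norml !maxEle; case: (leP t 0) => ?; case: (leP s 0) => ?; lra.
Qed.

Lemma rnorm_cauchy_cvg (R : realType) (X : completeNormedModType R[i])
    (u : nat -> X) :
  (forall e : R, 0 < e -> exists N : nat, forall m n, (N <= m)%N -> (N <= n)%N ->
     rnorm (u m - u n) < e) ->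
  exists y : X, u n @[n --> \oo] --> y.
Proof.
move=> H; suff uy : cvg (u n @[n --> \oo]) by exists (lim (u n @[n --> \oo])).
apply: cauchy_cvg; apply/cauchy_ballP => e e0.
have eE : e = (complex.Re e)%:C%C by rewrite RRe_real// gtr0_real.
have := e0; rewrite eE ltcR => e0'.
have [N HN] := H _ e0'.
exists ([set x | exists2 m, (N <= m)%N & x = u m],
        [set x | exists2 m, (N <= m)%N & x = u m]) => /=.
  by split; exists N => // m /= Nm; exists m.
move=> [_ _] /= [[m Nm ->] [n Nn ->]].
rewrite -ball_normE /ball_/= normCE ltcR; exact: HN.
Qed.

(** * Real-linear functionals *)

Section HahnBanach.
Context (R : realType) (X : normedModType R[i]).
Implicit Types (q : X -> R) (u v w : X).

Definition real_functional (phi : X -> R) : Prop :=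
  [/\ forall u v, phi (u + v) = phi u + phi v,
      forall (a : R) u, phi (a%:C%C *: u) = a * phi u
    & exists C : R, forall u, `|phi u| <= C * rnorm u].

Definition sublinear q : Prop :=
  (forall u v, q (u + v) <= q u + q v) /\
  (forall (a : R) u, 0 <= a -> q (a%:C%C *: u) = a * q u).

Lemma sublinear0 q : sublinear q -> q 0 = 0.
Proof. by move=> [_ qZ]; rewrite -(scale0r 0) (qZ 0)// mul0r. Qed.

Lemma sublinear_lower q u : sublinear q -> - q (- u) <= q u.
Proof.
move=> sq; have := sq.1 u (- u); rewrite subrr sublinear0//; lra.
Qed.

(** For [a > 0] the reverse inequality follows from the assumed one with [a^-1] at the vector
    [a u]. *)
Lemma sublinearI q : (forall u v, q (u + v) <= q u + q v) -> q 0 = 0 ->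
  (forall (a : R) u, 0 < a -> a * q u <= q (a%:C%C *: u)) -> sublinear q.
Proof.
move=> qD q0 qZ; split=> // a u; rewrite le_eqVlt => /predU1P[<-|a0].
  by rewrite scale0r q0 mul0r.
apply/eqP; rewrite eq_le qZ// andbT.
have := qZ a^-1 (a%:C%C *: u); rewrite invr_gt0 => /(_ a0).
by rewrite scalerA -rmorphM mulVf ?gt_eqF// scale1r ler_pdivrMl.
Qed.

(* A minimal sublinear functional is fixed by this operation, hence additive. *)
Definition tilt q v u : R :=
  inf [set q (u + t%:C%C *: v) - t * q v | t in [set t : R | 0 <= t]].

Lemma tilt_le q v u t : sublinear q -> 0 <= t ->
  tilt q v u <= q (u + t%:C%C *: v) - t * q v.
Proof.
move=> sq t0; apply: ge_inf; last by exists t.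
(* Bounded below: [s q v = q (s v) <= q (u + s v) + q (- u)]. *)
exists (- q (- u)) => _ [s /= s0 <-].
rewrite -sq.2//; have := sq.1 (u + s%:C%C *: v) (- u); rewrite addrAC subrr add0r; lra.
Qed.

Lemma le_tilt q v u b :
  (forall t, 0 <= t -> b <= q (u + t%:C%C *: v) - t * q v) -> b <= tilt q v u.
Proof.
move=> H; apply: lb_le_inf; first by exists (q (u + 0%:C%C *: v) - 0 * q v), 0 => /=.
by move=> _ [t /= t0 <-]; exact: H.
Qed.

Lemma tilt_sublinear q v : sublinear q -> sublinear (tilt q v).
Proof.
move=> sq; apply: sublinearI => [u w||a u a0].
- rewrite -lerBlDr; apply: le_tilt => t t0; rewrite lerBlDr -lerBlDl.
  apply: le_tilt => s s0; rewrite lerBlDl.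
  apply: le_trans (tilt_le v (u + w) sq (addr_ge0 t0 s0)) _.
  have := sq.1 (u + t%:C%C *: v) (w + s%:C%C *: v).
  by rewrite addrACA -scalerDl -rmorphD; lra.
- apply/eqP; rewrite eq_le; apply/andP; split.
    have := tilt_le v 0 sq (lexx 0).
    by rewrite scale0r addr0 mul0r subr0 (sublinear0 sq).
  apply: le_tilt => t t0; by rewrite add0r sq.2// subrr.
- apply: le_tilt => t t0.
  have ta0 : 0 <= t / a by rewrite divr_ge0// ltW.
  have -> : a%:C%C *: u + t%:C%C *: v = a%:C%C *: (u + (t / a)%:C%C *: v).
    by rewrite scalerDr scalerA -rmorphM mulrCA divff ?gt_eqF// mulr1.
  rewrite sq.2 ?(ltW a0)//.
  have -> : t * q v = a * (t / a * q v).
    by rewrite mulrA mulrCA divff ?gt_eqF// mulr1.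
  by rewrite -mulrBr ler_pM2l// tilt_le.
Qed.

Lemma tilt_le_self q v u : sublinear q -> tilt q v u <= q u.
Proof.
by move=> sq; have := tilt_le v u sq (lexx 0); rewrite scale0r addr0 mul0r subr0.
Qed.

(** Zorn's lemma for the reversed pointwise order on the sublinear functionals below [q0]. The bound
    of a chain is its pointwise infimum, which is finite because every member is at least
    [- q0 (- u)] at [u]. *)
Lemma minimal_sublinear q0 : sublinear q0 -> exists2 q,
  sublinear q /\ (forall u, q u <= q0 u) &
  forall p, sublinear p -> (forall u, p u <= q u) -> p = q.
Proof.
move=> sq0.
pose P (q : X -> R) := sublinear q /\ forall u, q u <= q0 u.
pose rel (p q : {q : X -> R | P q}) := `[< forall u, sval q u <= sval p u >].
have [|||A totA|[q [sq qq0]] qmin] := @Zorn {q : X -> R | P q} rel.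
- by move=> t; apply/asboolP.
- move=> r s t /asboolP rs /asboolP st; apply/asboolP => u.
  by rewrite (le_trans (st u)).
- move=> [p Pp] [q Pq] /asboolP/= pq /asboolP/= qp; apply/eq_exist/funext => u.
  by apply/eqP; rewrite eq_le pq qp.
- have [->|/set0P[p0 Ap0]] := eqVneq A set0.
    by exists (exist _ q0 (conj sq0 (fun u => lexx (q0 u)))).
  pose m u : R := inf [set sval p u | p in A].
  have m_le p u : A p -> m u <= sval p u.
    move=> Ap; apply: ge_inf; last by exists p.
    exists (- q0 (- u)) => _ [[r [sr rq0]] /= Ar <-].
    by rewrite (le_trans _ (sublinear_lower u sr))// lerN2.
  have le_m b u : (forall p, A p -> b <= sval p u) -> b <= m u.
    move=> H; apply: lb_le_inf; first by exists (sval p0 u), p0.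
    by move=> _ [p Ap <-]; exact: H.
  have Pm : P m.
    split=> [|u]; last by rewrite (le_trans (m_le _ _ Ap0))// (svalP p0).2.
    apply: sublinearI => [u v||a u a0].
    + rewrite -lerBlDr; apply: (le_m) => p Ap; rewrite lerBlDr -lerBlDl.
      apply: (le_m) => r Ar; rewrite lerBlDl.
      (* Of the two comparable members, the smaller one is applied to [u + v]. *)
      have [/asboolP pr|/asboolP rp] := totA p r Ap Ar.
        rewrite (le_trans (m_le _ _ Ar))// (le_trans ((svalP r).1.1 u v))//.
        by rewrite lerD2r.
      rewrite (le_trans (m_le _ _ Ap))// (le_trans ((svalP p).1.1 u v))//.
      by rewrite lerD2l.
    + apply/eqP; rewrite eq_le; apply/andP; split.
        by rewrite (le_trans (m_le _ _ Ap0))// sublinear0//; exact: (svalP p0).1.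
      by apply: (le_m) => p Ap; rewrite sublinear0//; exact: (svalP p).1.
    + apply: (le_m) => p Ap; rewrite (svalP p).1.2 ?(ltW a0)//.
      by rewrite ler_pM2l// m_le.
  by exists (exist _ m Pm) => p Ap; apply/asboolP => u; exact: m_le.
exists q => // p sp pq.
have Pp : P p by split=> // u; rewrite (le_trans (pq u)).
have qp : rel (exist _ q (conj sq qq0)) (exist _ p Pp) by apply/asboolP.
by case: (qmin _ qp).
Qed.

Lemma minimal_sublinear_functional q C : sublinear q -> (forall u, q u <= C * rnorm u) ->
  (forall p, sublinear p -> (forall u, p u <= q u) -> p = q) ->
  real_functional q.
Proof.
move=> sq qC qmin.
have qD u v : q (u + v) = q u + q v.
  apply/eqP; rewrite eq_le sq.1/=.
  (* By minimality [tilt q v = q], and the parameter 1 gives [tilt q v u <= q (u + v) - q v]. *)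
  have <- := qmin (tilt q v) (tilt_sublinear v sq) (fun u => tilt_le_self v u sq).
  have := tilt_le v u sq ler01; rewrite scale1r mul1r.
  have -> := qmin (tilt q v) (tilt_sublinear v sq) (fun u => tilt_le_self v u sq).
  lra.
have qN u : q (- u) = - q u.
  by apply/eqP; rewrite -addr_eq0 -qD addNr sublinear0.
split=> // [a u|].
  have [a0|a0] := leP 0 a; first exact: sq.2.
  rewrite -[a]opprK rmorphN scaleNr qN sq.2 ?oppr_ge0 ?ltW//; lra.
exists C => u; rewrite ler_norml qC andbT -lerNl -qN.
by rewrite -(rnormN u) qC.
Qed.

(** A minimal functional is taken below [tilt rnorm v] rather than below [rnorm]: at [- v] the
    tilted norm is at most [rnorm (- v + v) - rnorm v], which forces the value at [v]. *)
Lemma norming_functional v : exists phi : X -> R,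
  [/\ real_functional phi, forall u, `|phi u| <= rnorm u & phi v = rnorm v].
Proof.
have sn : sublinear (@rnorm R X).
  by split=> [|a u a0]; [exact: rnormD|rewrite rnormZ ger0_norm].
have [q [sq qn] qmin] := minimal_sublinear (tilt_sublinear v sn).
have q_le u : q u <= rnorm u by rewrite (le_trans (qn u))// tilt_le_self.
have rq : real_functional q.
  by apply: (@minimal_sublinear_functional q 1) => // u; rewrite mul1r.
have [qD qZ _] := rq.
have qN u : q (- u) = - q u.
  by apply/eqP; rewrite -addr_eq0 -qD addNr sublinear0.
have qnorm u : `|q u| <= rnorm u.
  by rewrite ler_norml q_le andbT -lerNl -qN -(rnormN u) q_le.
exists q; split=> //; apply/eqP; rewrite eq_le q_le/=.
have := qn (- v); rewrite qN => h.
have := le_trans h (tilt_le v (- v) sn ler01).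
by rewrite scale1r addNr rnorm0 mul1r; lra.
Qed.

Lemma functional_ext u v :
  (forall phi : X -> R, real_functional phi -> phi u = phi v) -> u = v.
Proof.
move=> H; apply/eqP; rewrite -subr_eq0; apply/eqP/rnorm_eq0.
have [phi [rphi _ <-]] := norming_functional (u - v).
have [phiD phiZ _] := rphi; rewrite phiD (H _ rphi) -scaleN1r.
by have := phiZ (-1) v; rewrite rmorphN rmorph1 => ->; rewrite mulN1r subrr.
Qed.

End HahnBanach.

Section Functionals.
Context (R : realType) (X : normedModType R[i]).
Implicit Types (phi : X -> R) (u v : X).

Lemma functional0 phi : real_functional phi -> phi 0 = 0.
Proof. by move=> [_ phiZ _]; rewrite -(scale0r 0) (phiZ 0)// mul0r. Qed.

Lemma functionalN phi u : real_functional phi -> phi (- u) = - phi u.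
Proof.
move=> rphi; have [phiD _ _] := rphi.
by apply/eqP; rewrite -addr_eq0 -phiD addNr functional0.
Qed.

Lemma functionalB phi u v : real_functional phi -> phi (u - v) = phi u - phi v.
Proof. by move=> rphi; have [-> _ _] := rphi; rewrite functionalN. Qed.

Lemma functional_bound phi : real_functional phi ->
  exists2 C : R, 0 < C & forall u, `|phi u| <= C * rnorm u.
Proof.
move=> [_ _ [C phiC]]; exists (`|C| + 1); first by rewrite ltr_wpDl.
move=> u; rewrite (le_trans (phiC u))// ler_wpM2r ?rnorm_ge0//.
by rewrite (le_trans (ler_norm C))// lerDl.
Qed.

Lemma functional_cvg phi {I : Type} (F : set_system I) {FF : Filter F}
    (f : I -> X) v : real_functional phi ->
  f t @[t --> F] --> v -> phi (f t) @[t --> F] --> phi v.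
Proof.
move=> rphi /cvg_rnorm fv; have [C C0 phiC] := functional_bound rphi.
apply/cvgrPdist_le => e e0.
have /cvgrPdist_le/(_ (e / C)) := fv; rewrite divr_gt0// => /(_ isT).
apply: filterS => t; rewrite sub0r normrN ger0_norm ?rnorm_ge0// ler_pdivlMr//.
move=> h; rewrite -functionalB// (le_trans (phiC _))// mulrC.
by rewrite rnorm_distC.
Qed.

End Functionals.

(** * Bochner integrals tested by functionals *)

Section BochnerFunctional.
Context (R : realType) (X : completeNormedModType R[i]).
Context (d : measure_display) (T : measurableType d).
Context (mu : {measure set T -> \bar R}) (D : set T) (mD : measurable D).
Implicit Types (f : T -> X) (s : seq (set T * X)).

Lemma step_functional phi s : real_functional phi -> step_integrable mu D s ->
  mu.-integrable D (EFin \o (phi \o step_fun s)) /\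
  \int[mu]_(t in D) phi (step_fun s t) = phi (step_integral mu D s).
Proof.
move=> rphi; have [phiD phiZ _] := rphi.
elim: s => [_|p s IHs ps].
  have E (t : T) : phi (step_fun [::] t) = 0.
    by rewrite /step_fun big_nil functional0.
  split.
    apply: (eq_integrable mD (cst 0%E)); last exact: integrable0.
    by move=> t _ /=; rewrite E.
  under eq_Rintegral do rewrite E.
  by rewrite Rintegral_cst// mul0r /step_integral big_nil functional0.
have [q|is_ Is] := IHs; first by move=> qs; apply: ps; rewrite inE qs orbT.
have [mp pfin] := ps p (mem_head _ _).
have ip : mu.-integrable D (EFin \o \1_(p.1)).
  apply/integrableP; split.
    by apply/measurable_EFinP; exact: measurable_indic.
  under eq_integral do rewrite /= ger0_norm//.
  by rewrite integral_indic.
have E t : phi (step_fun (p :: s) t) = \1_(p.1) t * phi p.2 + phi (step_fun s t).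
  by rewrite /step_fun big_cons phiD phiZ.
have i1 : mu.-integrable D (EFin \o (fun t => \1_(p.1) t * phi p.2)).
  have := integrableZr mD (phi p.2) ip.
  by apply: eq_integrable => // t _ /=; rewrite EFinM.
split.
  have := integrableD mD i1 is_.
  by apply: eq_integrable => // t _ /=; rewrite E EFinD.
under eq_Rintegral do rewrite E.
rewrite RintegralD// Is RintegralZr//.
by rewrite /Rintegral integral_indic// /step_integral big_cons phiD phiZ.
Qed.

(** One estimate with two uses: with a fixed [phi] it identifies the limit of the step integrals,
    and with norming functionals of their differences it shows that they form a Cauchy sequence. *)
Lemma step_integral_dist phi C f s : real_functional phi -> 0 <= C ->
  (forall u, `|phi u| <= C * rnorm u) -> step_integrable mu D s ->
  measurable_fun D (fun t => rnorm (f t - step_fun s t)) ->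
  mu.-integrable D (EFin \o (phi \o f)) ->
  (`|phi (step_integral mu D s) - \int[mu]_(t in D) phi (f t)|%:E <=
   C%:E * \int[mu]_(t in D) (rnorm (f t - step_fun s t))%:E)%E.
Proof.
move=> rphi C0 phiC sint ms iphi.
have [is_ <-] := step_functional rphi sint.
rewrite -RintegralB// EFin_normr_Rintegral//; last first.
  exact: (integrableB mD is_ iphi).
apply: le_trans (le_abse_integral _ mD _) _.
  exact: (measurable_int _ (integrableB mD is_ iphi)).
rewrite -ge0_integralZl//; last 2 first.
- exact/measurable_EFinP.
- by move=> t _; rewrite lee_fin rnorm_ge0.
apply: ge0_le_integral => //.
- apply: measurableT_comp => //.
  exact: (measurable_int _ (integrableB mD is_ iphi)).
- by apply/measurable_EFinP; exact: measurable_funM.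
- move=> t _ /=; rewrite lee_fin -functionalB// rnorm_distC; exact: phiC.
Qed.

Lemma bochner_functional phi f y : real_functional phi -> is_bochner mu D f y ->
  mu.-integrable D (EFin \o (phi \o f)) ->
  phi y = \int[mu]_(t in D) phi (f t).
Proof.
move=> rphi [s [si ms s0 sy]] iphi.
have [C C0 phiC] := functional_bound rphi.
have C1 : phi (step_integral mu D (s n)) @[n --> \oo] --> phi y.
  exact: functional_cvg.
suff C2 : phi (step_integral mu D (s n)) @[n --> \oo] -->
    \int[mu]_(t in D) phi (f t).
  by rewrite -(cvg_lim (@Rhausdorff R) C1) (cvg_lim (@Rhausdorff R) C2).
apply/cvgrPdist_lt => /= e e0.
have : (C%:E * \int[mu]_(t in D) (rnorm (f t - step_fun (s n) t))%:E)%E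
    @[n --> \oo] --> (C%:E * 0)%E by apply: cvgeZl.
rewrite mule0 => /fine_cvgP[H1 /cvgrPdist_lt/(_ e e0)].
apply: filterS2 H1 => n; rewrite /= sub0r normrN => fn h.
rewrite distrC -lte_fin.
apply: le_lt_trans (step_integral_dist rphi (ltW C0) phiC (si n) (ms n) iphi) _.
by rewrite -(fineK fn) lte_fin (le_lt_trans _ h)// ler_norm.
Qed.

End BochnerFunctional.

(** * Existence of the Bochner integral *)

Section BochnerExistence.
Context (R : realType) (X : completeNormedModType R[i]).
Context (d : measure_display) (T : measurableType d).
Context (mu : {measure set T -> \bar R}) (D : set T) (mD : measurable D).
Context (f : T -> X) (v : nat -> X).
(** Together with [dense_v] below, this stands for strong measurability: [f] is reached only through
    its distances to fixed vectors and through a sequence dense in its range. *)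
Hypothesis mf : forall u, measurable_fun D (fun t => rnorm (f t - u)).
Hypothesis fin : (\int[mu]_(t in D) (rnorm (f t))%:E < +oo)%E.
Hypothesis dense_v : forall t, D t -> forall e : R, 0 < e ->
  exists k, rnorm (f t - v k) < e.

(* The step functions switch to the value [v n] wherever it is closer to [f]
   than the current one; hence the error decreases from [rnorm f] to 0. *)
Definition closer (s : seq (set T * X)) (u : X) : set T :=
  D `&` [set t | rnorm (f t - u) < rnorm (f t - step_fun s t)].

Fixpoint approx n : seq (set T * X) :=
  if n is n'.+1 then
    let E := closer (approx n') (v n') in
    (E, v n') :: [seq (p.1 `\` E, p.2) | p <- approx n']
  else [::].

Let err n t := rnorm (f t - step_fun (approx n) t).

Lemma step_fun_nil t : step_fun ([::] : seq (set T * X)) t = 0.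
Proof. by rewrite /step_fun big_nil. Qed.

Lemma step_fun_setD (s : seq (set T * X)) E t :
  step_fun [seq (p.1 `\` E, p.2) | p <- s] t =
  if t \in E then 0 else step_fun s t.
Proof.
rewrite /step_fun big_map; case: ifPn => tE.
  rewrite big1// => p _ /=; rewrite indicE memNset ?scale0r//=.
  by move=> [_]; apply; exact/set_mem.
apply: eq_bigr => p _ /=; rewrite !indicE in_setD (negbTE tE) andbT//.
Qed.

Lemma approxS n t : step_fun (approx n.+1) t =
  if t \in closer (approx n) (v n) then v n else step_fun (approx n) t.
Proof.
rewrite {1}/step_fun /= big_cons -/(step_fun _ t) step_fun_setD /= indicE.
by case: ifPn => /= _; rewrite ?scale1r ?addr0// scale0r add0r.
Qed.

Lemma errS n t : D t -> err n.+1 t = Num.min (err n t) (rnorm (f t - v n)).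
Proof.
move=> Dt; rewrite /err approxS; case: ifPn => [|].
  by rewrite inE => -[_ /= h]; rewrite min_r// ltW.
move=> /negP h; rewrite min_l// leNgt; apply/negP => h'.
by apply: h; rewrite inE; split.
Qed.

Lemma measurable_err n : measurable_fun D (err n).
Proof.
elim: n => [|n IHn].
  by apply: eq_measurable_fun (mf 0) => t _; rewrite /err step_fun_nil.
apply: (eq_measurable_fun (fun t => Num.min (err n t) (rnorm (f t - v n)))).
  by move=> t /set_mem Dt; rewrite errS.
exact: measurable_minr.
Qed.

Lemma err_le_rnorm n t : D t -> err n t <= rnorm (f t).
Proof.
move=> Dt; elim: n => [|n IHn]; first by rewrite /err step_fun_nil subr0.
by rewrite errS// ge_min IHn.
Qed.

Lemma err_le n k t : D t -> (k < n)%N -> err n t <= rnorm (f t - v k).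
Proof.
move=> Dt; elim: n => // n IHn; rewrite ltnS leq_eqVlt errS// => /predU1P[->|kn].
  by rewrite ge_min lexx orbT.
by rewrite ge_min IHn.
Qed.

Lemma measurable_closer n : measurable (closer (approx n) (v n)).
Proof.
have := measurable_fun_ltr (mf (v n)) (measurable_err n).
by move=> /(_ mD [set true] I); congr measurable; rewrite /closer.
Qed.

(** Chebyshev's inequality. On this set [rnorm (f t - v n) < err n t <= rnorm (f t)], hence
    [rnorm (v n) / 2 <= rnorm (f t)]; if [v n = 0] the set is empty. *)
Lemma closer_finite n : (mu (closer (approx n) (v n) `&` D) < +oo)%E.
Proof.
set E := closer _ _.
have mE : measurable E by exact: measurable_closer.
have ED : E `&` D = E by apply/setIidPl => t [].
rewrite ED.
have mrf : measurable_fun D (fun t => (rnorm (f t))%:E).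
  apply/measurable_EFinP.
  by apply: eq_measurable_fun (mf 0) => t _; rewrite subr0.
have [v0|v0] := eqVneq (rnorm (v n)) 0.
  rewrite (_ : E = set0) ?measure0// -subset0 => t [Dt /=].
  rewrite (rnorm_eq0 v0) subr0 => /lt_le_trans /(_ (err_le_rnorm n Dt)).
  by rewrite ltxx.
have v1 : 0 < rnorm (v n) by rewrite lt_neqAle eq_sym v0 rnorm_ge0.
have h : ((rnorm (v n) / 2)%:E * mu E <= \int[mu]_(t in D) (rnorm (f t))%:E)%E.
  rewrite -integral_cst//.
  apply: (@le_trans _ _ (\int[mu]_(t in E) (rnorm (f t))%:E)%E).
    apply: ge0_le_integral => //.
    - by move=> t _; rewrite lee_fin divr_ge0// rnorm_ge0.
    - by apply: measurable_funS mrf => // t [].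
    - move=> t [Dt /= /lt_le_trans /(_ (err_le_rnorm n Dt))] h.
      rewrite lee_fin ler_pdivrMr//.
      have := rnormB (f t) (f t - v n); rewrite opprB addrC subrK; lra.
  apply: ge0_subset_integral => //.
  - by move=> t _; rewrite lee_fin rnorm_ge0.
  - by move=> t [].
rewrite ltNge; apply/negP; rewrite leye_eq => /eqP Ey.
move: h; rewrite Ey gt0_muley ?lte_fin ?divr_gt0// leye_eq => /eqP h.
by move: fin; rewrite h ltxx.
Qed.

Lemma approx_integrable n : step_integrable mu D (approx n).
Proof.
elim: n => [//|n IHn] p; rewrite inE => /predU1P[->|/mapP[q qs ->]] /=.
  by split; [exact: measurable_closer|exact: closer_finite].
have [mq muq] := IHn q qs; have mE := measurable_closer n.
split; first exact: measurableD.
apply: le_lt_trans muq; apply: le_measure; rewrite ?inE//.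
- by apply: measurableI => //; exact: measurableD.
- exact: measurableI.
- by move=> t [[]].
Qed.

Lemma err_cvg t : D t -> err n t @[n --> \oo] --> (0 : R).
Proof.
move=> Dt; apply/cvgrPdist_lt => e e0.
have [k fk] := dense_v Dt e0.
exists k.+1 => // n /= kn.
rewrite sub0r normrN ger0_norm ?rnorm_ge0// (le_lt_trans _ fk)//.
exact: err_le.
Qed.

Let integrable_rnorm : mu.-integrable D (fun t => (rnorm (f t))%:E).
Proof.
apply/integrableP; split.
  apply/measurable_EFinP.
  by apply: eq_measurable_fun (mf 0) => t _; rewrite subr0.
by under eq_integral do rewrite /= ger0_norm ?rnorm_ge0//.
Qed.

Lemma integral_err_cvg : (\int[mu]_(t in D) (err n t)%:E)%E @[n --> \oo] --> 0%E.
Proof.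
have [|||||_ _] := @dominated_convergence _ T R mu D mD
    (fun n t => (err n t)%:E) (cst 0%E) (fun t => (rnorm (f t))%:E).
- by move=> n; apply/measurable_EFinP; exact: measurable_err.
- exact: measurable_cst.
- by apply/aeW => t Dt; apply: cvg_EFin; [exact: nearW|exact: err_cvg].
- exact: integrable_rnorm.
- apply/aeW => t n Dt; rewrite /= lee_fin ger0_norm ?rnorm_ge0//.
  exact: err_le_rnorm.
- by rewrite integral_cst// mul0e.
Qed.

(** Measurability of [phi \o f] is inherited from the step functions of [approx n], which converge
    to [f] pointwise on [D]; a multiple of [rnorm (f t)] dominates. *)
Lemma integrable_functional phi : real_functional phi ->
  mu.-integrable D (EFin \o (phi \o f)).
Proof.
move=> rphi; have [C C0 phiC] := functional_bound rphi.
have h := integrableZl mD C integrable_rnorm.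
apply: le_integrable h => //.
  apply/measurable_EFinP.
  apply: (@measurable_fun_cvg _ _ _ D (fun n => phi \o step_fun (approx n))).
  - move=> n; apply/measurable_EFinP.
    exact: (measurable_int mu (step_functional mD rphi (@approx_integrable n)).1).
  - move=> t Dt; apply: functional_cvg => //; apply/cvg_rnorm.
    by under eq_fun do rewrite rnorm_distC; exact: err_cvg.
move=> t Dt; rewrite /= lee_fin (le_trans (phiC _))//.
by rewrite ler_norm.
Qed.

Lemma bochner_exists : exists y, is_bochner mu D f y.
Proof.
have [y Hy] : exists y : X, step_integral mu D (approx n) @[n --> \oo] --> y.
  apply: rnorm_cauchy_cvg => e e0.
  have /fine_cvgP[ff /cvgrPdist_lt/(_ (e / 2))] := integral_err_cvg.
  rewrite divr_gt0// => /(_ isT) h.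
  have [N _ HN] := filterI ff h; exists N => m n Nm Nn.
  (* The functional depends on [m] and [n], but it is always bounded by the norm, so that the same
     [N] serves for all of them. *)
  have [phi [rphi phi1 <-]] :=
    norming_functional (step_integral mu D (approx m) - step_integral mu D (approx n)).
  have phi1' u : `|phi u| <= 1 * rnorm u by rewrite mul1r.
  have H k : (N <= k)%N ->
      `|phi (step_integral mu D (approx k)) - \int[mu]_(t in D) phi (f t)| < e / 2.
    move=> /HN[/= fk]; rewrite sub0r normrN => hk.
    rewrite -lte_fin; apply: le_lt_trans.
      exact: (step_integral_dist mD rphi ler01 phi1' (@approx_integrable k)
        (measurable_err k) (integrable_functional rphi)).
    by rewrite mul1e -(fineK fk) lte_fin (le_lt_trans _ hk)// ler_norm.
  have := H m Nm; have := H n Nn; rewrite functionalB//.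
  by rewrite !ltr_norml => /andP[? ?] /andP[? ?]; lra.
exists y, approx; split=> //.
- exact: approx_integrable.
- exact: measurable_err.
- exact: integral_err_cvg.
Qed.

Lemma functional_bochner phi : real_functional phi ->
  phi (bochner mu D f) = \int[mu]_(t in D) phi (f t).
Proof.
move=> rphi; apply: (bochner_functional mD rphi); last exact: integrable_functional.
exact: (@xgetPex _ 0 [set y | is_bochner mu D f y] bochner_exists).
Qed.

End BochnerExistence.

(** * Densities, orbits and real integrals *)

Section Density.
Import HBNNSimple.
Context (R : realType) (d : measure_display) (T : measurableType d).
Context (mu : {measure set T -> \bar R}) (k : T -> \bar R).
Local Open Scope ereal_scope.

(** The proofs are arguments so that the measure structure can be attached to the term itself. *)
Definition mdensity (mk : measurable_fun setT k) (k0 : forall x, 0 <= k x)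
  (A : set T) : \bar R := \int[mu]_(x in A) k x.

Hypotheses (mk : measurable_fun setT k) (k0 : forall x, 0 <= k x).

Let dens0 : mdensity mk k0 set0 = 0.
Proof. exact: integral_set0. Qed.

Let dens_ge0 A : 0 <= mdensity mk k0 A.
Proof. exact: integral_ge0. Qed.

Let dens_sigma : semi_sigma_additive (mdensity mk k0).
Proof. exact: semi_sigma_additive_nng_induced. Qed.

HB.instance Definition _ := isMeasure.Build _ _ _ (mdensity mk k0)
  dens0 dens_ge0 dens_sigma.

Lemma ge0_integral_density E f : measurable E -> measurable_fun E f ->
  (forall x, 0 <= f x) ->
  \int[mdensity mk k0]_(x in E) f x = \int[mu]_(x in E) (f x * k x).
Proof.
move=> mE mf f0; pose h := nnsfun_approx mE mf.
have mkE : measurable_fun E k by exact: measurable_funTS.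
have hf x : E x -> (h n x)%:E @[n --> \oo] --> f x.
  by move=> Ex; exact: cvg_nnsfun_approx.
have nh x m n : (m <= n)%N -> (h m x <= h n x)%R.
  by move=> mn; exact/lefP/nd_nnsfun_approx.
have -> : \int[mdensity mk k0]_(x in E) f x =
    lim (\int[mdensity mk k0]_(x in E) (h n x)%:E @[n --> \oo]).
  under eq_integral => x /[!inE] Ex.
    rewrite -(cvg_lim (@ereal_hausdorff R) (hf x Ex)); over.
  apply: monotone_convergence => //.
  - move=> n; apply/measurable_EFinP.
    by apply: (measurable_funS measurableT) => //; exact/measurable_funP.
  - by move=> n x Ex //=; rewrite lee_fin.
  - by move=> x Ex a b ab; rewrite lee_fin nh.
have hkf x : E x -> (h n x)%:E * k x @[n --> \oo] --> f x * k x.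
  (* Where [k x] is infinite the products are eventually constant: infinite once some [h n x] is
     positive, and 0 if all of them vanish, in which case [f x = 0]. *)
  move=> Ex; have [kfin|] := boolP (k x \is a fin_num).
    by apply: cvgeZr => //; exact: hf.
  rewrite ge0_fin_numE// -leNgt leye_eq => /eqP ->.
  have hle n : (h n x)%:E <= f x.
    rewrite -(cvg_lim (@ereal_hausdorff R) (hf x Ex)).
    apply: lime_ge; first by apply/cvg_ex; exists (f x); exact: hf.
    by exists n => // m /= nm; rewrite lee_fin nh.
  have [[N hN]|hN] := pselect (exists N, 0 < (h N x)%:E).
    rewrite gt0_muley ?(lt_le_trans hN)//; apply: cvg_near_cst.
    exists N => // n /= Nn; rewrite gt0_muley// (lt_le_trans hN)//.
    by rewrite lee_fin nh.
  have hx0 n : h n x = 0%R.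
    apply/eqP; rewrite eq_le fun_ge0 andbT leNgt -lte_fin; apply/negP => hn.
    by apply: hN; exists n.
  have <- : 0 = f x.
    rewrite -(cvg_lim (@ereal_hausdorff R) (hf x Ex)).
    by under eq_fun do rewrite hx0; rewrite lim_cst.
  by rewrite mul0e; under eq_fun do rewrite hx0 mul0e; exact: cvg_cst.
have -> : \int[mu]_(x in E) (f x * k x) =
    lim (\int[mu]_(x in E) ((h n x)%:E * k x) @[n --> \oo]).
  under eq_integral => x /[!inE] Ex.
    rewrite -(cvg_lim (@ereal_hausdorff R) (hkf x Ex)); over.
  apply: monotone_convergence => [//| | |].
  - move=> n; apply/emeasurable_funM => //; apply/measurable_funTS.
    exact/measurable_EFinP.
  - by move=> n x Ex /=; rewrite mule_ge0 ?lee_fin.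
  - by move=> x Ex a b ab/=; rewrite lee_wpmul2r ?lee_fin ?nh.
suff suf n : \int[mu]_(x in E) ((h n x)%:E * k x) =
    \int[mdensity mk k0]_(x in E) (h n x)%:E.
  by under [in RHS]eq_fun do rewrite suf.
transitivity (\int[mdensity mk k0]_(x in E)
   (\sum_(y \in range (h n)) (y * \1_(h n @^-1` [set y]) x)%:E)); last first.
  by apply: eq_integral => t tE; rewrite /= fimfunE -fsumEFin.
have indich m r : measurable_fun E (fun x => (r * \1_(h m @^-1` [set r]) x)%:E).
  by apply: (measurable_comp measurableT) => //; exact: measurable_funM.
rewrite ge0_integral_fsum//; last by move=> m y Ey; exact: nnfun_muleindic_ge0.
transitivity (\int[mu]_(x in E) (\sum_(y \in range (h n))
    (y * \1_(h n @^-1` [set y]) x)%:E * k x)).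
  under [RHS]eq_integral => x xE.
    rewrite -ge0_mule_fsuml => [|y]; last exact: nnfun_muleindic_ge0.
    rewrite fsumEFin // -(fimfunE _ x); over.
  by [].
rewrite ge0_integral_fsum//; last 2 first.
  - by move=> y; apply: emeasurable_funM.
  - by move=> m y Ey; rewrite mule_ge0// nnfun_muleindic_ge0.
apply: eq_fsbigr => r rhn.
under [RHS]eq_integral do rewrite EFinM.
rewrite integralZl_indic_nnsfun => //.
under eq_integral do rewrite EFinM -muleA.
rewrite ge0_integralZl//.
- under eq_integral do rewrite muleC.
  rewrite (eq_integral (k \_ (h n @^-1` [set r]))); last first.
    by move=> x xE; rewrite epatch_indic.
  by rewrite -integral_mkcondr integral_indic// setIC.
- by apply: emeasurable_funM => //; exact/measurable_EFinP.
- by move=> t Et; rewrite mule_ge0 ?lee_fin.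
- by move: rhn; rewrite inE => -[t _ <-]; rewrite lee_fin.
Qed.

Lemma integral_density E (f : T -> R) : measurable E -> measurable_fun E f ->
  \int[mdensity mk k0]_(x in E) (f x)%:E = \int[mu]_(x in E) ((f x)%:E * k x).
Proof.
move=> mE mf; have mf' : measurable_fun E (EFin \o f) by exact/measurable_EFinP.
rewrite [LHS]integralE [RHS]integralE; congr (_ - _).
- rewrite ge0_integral_density//; last exact: measurable_funepos.
  apply: eq_integral => x _; rewrite !funeposE.
  have [fx|fx] := leP 0%R (f x).
    have fx0 : 0 <= (f x)%:E by rewrite lee_fin.
    by rewrite (max_idPl fx0) (max_idPl (mule_ge0 fx0 (k0 x))).
  have fx0 : (f x)%:E <= 0 by rewrite lee_fin ltW.
  by rewrite (max_idPr fx0) mul0e (max_idPr (mule_le0_ge0 fx0 (k0 x))).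
- rewrite ge0_integral_density//; last exact: measurable_funeneg.
  apply: eq_integral => x _; rewrite !funenegE -mulNe.
  have [fx|fx] := leP (f x) 0%R.
    have fx0 : 0 <= - (f x)%:E by rewrite leeNr oppe0 lee_fin.
    by rewrite (max_idPl fx0) (max_idPl (mule_ge0 fx0 (k0 x))).
  have fx0 : - (f x)%:E <= 0 by rewrite leeNl oppe0 lee_fin ltW.
  by rewrite (max_idPr fx0) mul0e (max_idPr (mule_le0_ge0 fx0 (k0 x))).
Qed.

End Density.

Section FiniteDensity.
Context (R : realType) (d : measure_display) (T : measurableType d).
Context (mu : {measure set T -> \bar R}) (k : T -> \bar R).
Local Open Scope ereal_scope.

(** A copy of [mdensity] whose extra argument lets the structure of finite measure be inferred. *)
Definition fin_mdensity (mk : measurable_fun setT k) (k0 : forall x, 0 <= k x)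
  (fk : \int[mu]_x k x < +oo) : set T -> \bar R := mdensity mu mk k0.

Hypotheses (mk : measurable_fun setT k) (k0 : forall x, 0 <= k x).
Hypothesis fk : \int[mu]_x k x < +oo.

HB.instance Definition _ := Measure.on (fin_mdensity mk k0 fk).

Let fin_dens_fin : fin_num_fun (fin_mdensity mk k0 fk).
Proof.
apply: lty_fin_num_fun; exact: fk.
Qed.

HB.instance Definition _ := Measure_isFinite.Build _ _ _ (fin_mdensity mk k0 fk)
  fin_dens_fin.

End FiniteDensity.

(** * Bochner integrals and orbits on the real line *)

Section LineBochner.
Context (R : realType) (X : completeNormedModType R[i]).
Context (mu : {measure set (measurableTypeR R) -> \bar R}) (D : set R).
Context (mD : measurable (D : set (measurableTypeR R))) (f f' : R -> X).
(** [f'] is a version of [f] continuous at the points of [D] as a function on the whole line. For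
    orbits on [[0, +oo[] it clamps negative times to 0, where [T] is arbitrary. *)
Hypothesis ff' : forall t, D t -> f t = f' t.
Hypothesis cf' : forall t, D t -> f' s @[s --> t] --> f' t.

Lemma measurable_rnorm_line u :
  measurable_fun (D : set (measurableTypeR R)) (fun t => rnorm (f t - u)).
Proof.
apply: (eq_measurable_fun (fun t => rnorm (f' t - u))).
  by move=> t /set_mem Dt; rewrite ff'.
apply: (@subspace_continuous_measurable_fun R D) => //.
apply/continuous_in_subspaceT => t /set_mem Dt.
apply/cvgrPdist_le => e e0.
have /cvg_rnorm/cvgrPdist_le/(_ e e0) := cf' Dt.
apply: filterS => s; rewrite sub0r normrN ger0_norm ?rnorm_ge0// => h.
rewrite (le_trans _ h)//.
have h1 := rnorm_distD (f' t) (f' s) u; have h2 := rnorm_distD (f' s) (f' t) u.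
rewrite (rnorm_distC (f' t) (f' s)) in h2.
by rewrite ler_norml; lra.
Qed.

Hypothesis fin : (\int[mu]_(t in D) (rnorm (f t))%:E < +oo)%E.

(** Values at the rationals. A rational close to [t] may lie outside [D], hence [f'] instead of
    [f]. *)
Let v k := f' (ratr (odflt (0 : rat) (unpickle k))).

Let dense_v t : D t -> forall e : R, 0 < e -> exists k, rnorm (f t - v k) < e.
Proof.
move=> Dt e e0; rewrite ff'//.
have /cvg_rnorm/cvgrPdist_lt/(_ e e0) := cf' Dt.
move=> /nbhs_ballP[/= r r0 rt].
have /rat_in_itvoo[q] : t < t + r by rewrite ltrDl.
rewrite in_itv/= => /andP[tq qt]; exists (pickle q); rewrite /v pickleK/=.
have := rt (ratr q); rewrite sub0r normrN ger0_norm ?rnorm_ge0// rnorm_distC.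
by apply; rewrite /ball/= distrC ger0_norm ?subr_ge0 ?ltW// ltrBlDl.
Qed.

Lemma integrable_functional_line phi : real_functional phi ->
  mu.-integrable D (EFin \o (phi \o f)).
Proof. exact: (integrable_functional mD measurable_rnorm_line fin dense_v). Qed.

Lemma functional_bochner_line phi : real_functional phi ->
  phi (bochner mu D f) = \int[mu]_(t in D) phi (f t).
Proof. exact: (functional_bochner mD measurable_rnorm_line fin dense_v). Qed.

End LineBochner.

Section Orbit.
Context (R : realType) (X : completeNormedModType R[i]).
Context (T : R -> {linear X -> X}) (hT : bounded_C0_semigroup T).
Implicit Types x : X.

Lemma semigroup_bound : exists2 M : R, 0 < M &
  forall t, 0 <= t -> forall x, rnorm (T t x) <= M * rnorm x.
Proof.
have [M TM] := semigroup_bounded hT; exists (`|M| + 1); first by rewrite ltr_wpDl.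
move=> t t0 x; rewrite (le_trans (TM t t0 x))// ler_wpM2r ?rnorm_ge0//.
by rewrite (le_trans (ler_norm M))// lerDl.
Qed.

(** For [a <= b] the difference is [T a] applied to [x - T (b - a) x]. *)
Lemma orbit_dist M a b x :
  (forall t, 0 <= t -> forall x, rnorm (T t x) <= M * rnorm x) ->
  0 <= a -> 0 <= b -> rnorm (T a x - T b x) <= M * rnorm (T `|a - b| x - x).
Proof.
move=> TM; wlog ab : a b / a <= b => [hw|a0 b0].
  move=> a0 b0; have [ab|/ltW ba] := leP a b; first exact: hw.
  by rewrite rnorm_distC distrC; exact: hw.
have ba : 0 <= b - a by rewrite subr_ge0.
rewrite distrC ger0_norm// rnorm_distC -{1}(subrKC a b) (semigroupD hT)//.
by rewrite -linearB; exact: TM.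
Qed.

(** Right continuity at 0 and uniform boundedness give two-sided continuity at every time. With
    negative times clamped to 0 the orbit is continuous on the whole line, so that its compositions
    with functionals are Borel functions there. *)
Lemma orbit_continuous x (t : R) :
  T (Num.max s 0) x @[s --> t] --> T (Num.max t 0) x.
Proof.
have [M M0 TM] := semigroup_bound.
apply/cvg_rnorm/cvgrPdist_le => e e0.
have /cvg_rnorm/cvgrPdist_le/(_ (e / M)) := semigroup_cvg hT (x := x).
rewrite divr_gt0// => /(_ isT)[/= r r0 H].
exists r => //= s /= ts.
rewrite sub0r normrN ger0_norm ?rnorm_ge0//.
rewrite (le_trans (orbit_dist x TM _ _)) ?le_max ?lexx ?orbT//.
rewrite mulrC -ler_pdivlMr//.
set h := `|_ - _|.
have hr : h < r.
  by apply: le_lt_trans ts; exact: dist_maxr0_le.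
(* The right limit at 0 gives no information at [h = 0] itself. *)
have := normr_ge0 (Num.max s 0 - Num.max t 0); rewrite -/h le_eqVlt.
move=> /predU1P[<-|h0].
  by rewrite (semigroup0 hT) subrr rnorm0 divr_ge0 ?ltW.
have := H h; rewrite /= sub0r normrN gtr0_norm// => /(_ hr h0).
by rewrite sub0r normrN ger0_norm ?rnorm_ge0.
Qed.

Section Weighted.
Context (mu : {measure set (measurableTypeR R) -> \bar R}) (D : set R).
Context (mD : measurable (D : set (measurableTypeR R))).
Hypothesis D0 : forall t, D t -> 0 <= t.
Context (w : R -> R) (cw : continuous w).
Hypothesis fw : (\int[mu]_(t in D) `|w t|%:E < +oo)%E.

Let f' x (t : R) := (w t)%:C%C *: T (Num.max t 0) x.

Let ff' x t : D t -> (w t)%:C%C *: T t x = f' x t.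
Proof. by move=> Dt; rewrite /f' max_l// D0. Qed.

Let cf' x t : f' x s @[s --> t] --> f' x t.
Proof.
apply: cvgZ; last exact: orbit_continuous.
by apply: cvg_real_complex; exact: cw.
Qed.

Let fin x : (\int[mu]_(t in D) (rnorm ((w t)%:C%C *: T t x))%:E < +oo)%E.
Proof.
have [M M0 TM] := semigroup_bound.
have mw : measurable_fun (D : set (measurableTypeR R)) (fun t => `|w t|).
  apply: measurableT_comp => //; apply: measurable_funTS.
  exact: continuous_measurable_fun.
apply: (@le_lt_trans _ _ (\int[mu]_(t in D) ((M * rnorm x)%:E * `|w t|%:E))%E).
  apply: ge0_le_integral => //.
  - by move=> t _; rewrite lee_fin rnorm_ge0.
  - apply/measurable_EFinP.
    have := measurable_rnorm_line mD (@ff' x) (fun t _ => @cf' x t) 0.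
    by under eq_fun do rewrite subr0.
  - by apply/measurable_EFinP; exact: measurable_funM.
  - move=> t Dt; rewrite lee_fin rnormZ mulrC ler_wpM2r// TM//; exact: D0.
rewrite ge0_integralZl//; last 2 first.
- exact/measurable_EFinP.
- by rewrite lee_fin mulr_ge0 ?rnorm_ge0 ?ltW.
by rewrite lte_mul_pinfty// lee_fin mulr_ge0 ?rnorm_ge0 ?ltW.
Qed.

Lemma integrable_orbit phi x : real_functional phi ->
  mu.-integrable D (fun t => (w t * phi (T t x))%:E).
Proof.
move=> rphi; have [_ phiZ _] := rphi.
have := integrable_functional_line mD (@ff' x) (fun t _ => @cf' x t) (fin x) rphi.
by apply: eq_integrable => // t _ /=; rewrite phiZ.
Qed.

Lemma functional_bochner_orbit phi x : real_functional phi ->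
  phi (bochner mu D (fun t => (w t)%:C%C *: T t x)) =
  \int[mu]_(t in D) (w t * phi (T t x)).
Proof.
move=> rphi; have [_ phiZ _] := rphi.
rewrite (functional_bochner_line mD (@ff' x) (fun t _ => @cf' x t) (fin x) rphi).
by apply: eq_Rintegral => t _; rewrite phiZ.
Qed.

End Weighted.

End Orbit.

(** * Exponential integrals and translations *)

Section RealIntegrals.
Context (R : realType).
Local Notation leb := (@lebesgue_measure R).
Implicit Types (r a h : R) (g : R -> R).

Lemma continuous_expRNM r : continuous (fun s : R => expR (- (r * s))).
Proof.
move=> s; apply: continuous_comp; last exact: continuous_expR.
by apply: continuousN; apply: cvgMr; exact: cvg_id.
Qed.

Lemma integral_expRNM r a : 0 < r ->
  (\int[leb]_(s in `[a, +oo[) (expR (- (r * s)))%:E = (r^-1 * expR (- (r * a)))%:E)%E.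
Proof.
move=> r0.
have d1 (x : R) : is_derive x (1 : R)
    (fun s : R => - (r^-1 * expR (- (r * s)))) (expR (- (r * x))).
  apply: is_derive_eq.
  rewrite !scaler1 /GRing.scale/=.
  by field; rewrite gt_eqF.
rewrite (@ge0_continuous_FTC2y _ _ (fun s => - (r^-1 * expR (- (r * s)))) _ 0).
- by rewrite sub0e -EFinN opprK.
- by move=> x _; rewrite expR_ge0.
- by apply: continuous_subspaceT; exact: continuous_expRNM.
- rewrite -oppr0 -(mulr0 r^-1); apply: cvgN; apply: cvgMr.
  apply: (@cvg_comp _ _ _ (fun s => r * s) (fun z => expR (- z)) _ +oo);
    last exact: cvgr_expR.
  exact: gt0_cvgMry.
- by move=> x _; exact: ex_derive.
- apply: cvg_at_right_filter; apply: cvgN; apply: cvgMr.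
  exact: continuous_expRNM.
- by move=> x _; rewrite derive1E derive_val.
Qed.

Lemma integrable_expRNM r a : 0 < r ->
  leb.-integrable `[a, +oo[ (fun s => (expR (- (r * s)))%:E).
Proof.
move=> r0; apply/integrableP; split.
  apply/measurable_EFinP; apply: measurable_funTS.
  by apply: continuous_measurable_fun; exact: continuous_expRNM.
under eq_integral do rewrite /= ger0_norm ?expR_ge0//.
by rewrite integral_expRNM// ltry.
Qed.

Lemma Rintegral_expRNM r a : 0 < r ->
  \int[leb]_(s in `[a, +oo[) expR (- (r * s)) = r^-1 * expR (- (r * a)).
Proof. by move=> r0; rewrite /Rintegral integral_expRNM. Qed.

Lemma ge0_integral_shift g h : continuous g -> (forall s, 0 <= g s) ->
  (\int[leb]_(s in `[0%R, +oo[) (g (s + h))%:E =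
   \int[leb]_(s in `[h, +oo[) (g s)%:E)%E.
Proof.
move=> cg g0.
have d1 (x : R) : is_derive x (1 : R) (fun s : R => s + h) 1.
  by apply: is_derive_eq; rewrite addr0.
have dE : (fun s : R => s + h)^`()%classic = cst 1.
  by apply/funext => x; rewrite derive1E derive_val.
have := @increasing_ge0_integration_by_substitutiony _ (fun s => s + h) g 0.
rewrite add0r dE => -> //.
- by apply: eq_integral => s _ /=; rewrite mulr1.
- by move=> x y _ _; rewrite ltrD2r.
- by move=> x _; exact: cvg_cst.
- exact: is_cvg_cst.
- exact: is_cvg_cst.
- split; first by move=> x _; exact: ex_derive.
  by apply: cvg_at_right_filter; apply: cvgD; [exact: cvg_id|exact: cvg_cst].
- apply/cvgryPge => A; exists (A - h); split; first exact: num_real.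
  by move=> x /ltW; rewrite lerBlDr.
- exact: continuous_subspaceT.
Qed.

Lemma integral_shift g h : continuous g ->
  (\int[leb]_(s in `[0%R, +oo[) (g (s + h))%:E =
   \int[leb]_(s in `[h, +oo[) (g s)%:E)%E.
Proof.
move=> cg; rewrite [LHS]integralE [RHS]integralE; congr (_ - _)%E.
- have := @ge0_integral_shift (fun s => Num.max (g s) 0) h.
  move=> H; transitivity (\int[leb]_(s in `[0%R, +oo[) (Num.max (g (s + h)) 0)%:E)%E.
    by apply: eq_integral => s _; rewrite funeposE -EFin_max.
  rewrite H; last by move=> s; rewrite le_max lexx orbT.
    by apply: eq_integral => s _; rewrite funeposE -EFin_max.
  by move=> s; apply: (@continuous_max _ _ g (cst 0)); [exact: cg|exact: cvg_cst].
- have := @ge0_integral_shift (fun s => Num.max (- g s) 0) h.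
  move=> H; transitivity (\int[leb]_(s in `[0%R, +oo[) (Num.max (- g (s + h)) 0)%:E)%E.
    by apply: eq_integral => s _; rewrite funenegE -EFinN -EFin_max.
  rewrite H; last by move=> s; rewrite le_max lexx orbT.
    by apply: eq_integral => s _; rewrite funenegE -EFinN -EFin_max.
  move=> s; apply: (@continuous_max _ _ (fun s => - g s) (cst 0)); last exact: cvg_cst.
  by apply: continuousN; exact: cg.
Qed.

End RealIntegrals.

(** * Resolvents *)

Section BoundedOperators.
Context (R : realType) (X : normedModType R[i]).
Implicit Types (B : X -> X) (x : X).

Definition bounded_real_linear B : Prop :=
  [/\ forall x y, B (x + y) = B x + B y,
      forall (a : R) x, B (a%:C%C *: x) = a%:C%C *: B x
    & exists C : R, forall x, rnorm (B x) <= C * rnorm x].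

Lemma functional_comp B phi : bounded_real_linear B -> real_functional phi ->
  real_functional (phi \o B).
Proof.
move=> [BD BZ [C BC]] rphi; have [phiD phiZ _] := rphi.
have [K K0 phiK] := functional_bound rphi.
split=> [u v|a u|] /=; rewrite ?BD ?BZ ?phiD ?phiZ//.
exists (K * C) => u; rewrite (le_trans (phiK _))// -mulrA.
by rewrite ler_pM2l.
Qed.

Lemma blinB B x y : bounded_real_linear B -> B (x - y) = B x - B y.
Proof.
move=> [BD BZ _]; rewrite BD; congr (_ + _).
by have := BZ (-1) y; rewrite rmorphN rmorph1 !scaleN1r.
Qed.

End BoundedOperators.

Section Resolvent.
Context (R : realType) (X : completeNormedModType R[i]).
Local Notation leb := (@lebesgue_measure R).

Definition resolvent (T : R -> {linear X -> X}) (r : R) (x : X) : X :=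
  bochner leb `[0, +oo[ (fun s => (expR (- (r * s)))%:C%C *: T s x).

Context (T : R -> {linear X -> X}) (hT : bounded_C0_semigroup T).
Implicit Types (r c h : R) (x w v : X) (phi : X -> R).
Local Notation Res := (resolvent T).

Let mD : measurable (`[0, +oo[%classic : set (measurableTypeR R)).
Proof. exact: measurable_itv. Qed.

Let D0 t : [set` `[(0 : R), +oo[] t -> 0 <= t.
Proof. by rewrite /= in_itv/= andbT. Qed.

Let fw r : 0 < r ->
  (\int[leb]_(t in `[0%R, +oo[) `|expR (- (r * t))|%:E < +oo)%E.
Proof.
move=> r0; under eq_integral do rewrite ger0_norm ?expR_ge0//.
by rewrite integral_expRNM// ltry.
Qed.

Lemma functional_resolvent phi r x : real_functional phi -> 0 < r ->
  phi (Res r x) = \int[leb]_(s in `[0, +oo[) (expR (- (r * s)) * phi (T s x)).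
Proof.
move=> rphi r0; apply: (functional_bochner_orbit hT mD D0) => //.
- exact: continuous_expRNM.
- exact: fw.
Qed.

Lemma integrable_resolvent phi r x : real_functional phi -> 0 < r ->
  leb.-integrable `[0, +oo[ (fun s => (expR (- (r * s)) * phi (T s x))%:E).
Proof.
move=> rphi r0; apply: (integrable_orbit hT mD D0) => //.
- exact: continuous_expRNM.
- exact: fw.
Qed.

(** [phi \o B] is again a real functional, so [B] passes under the integral once both sides are
    tested by [phi]. *)
Lemma resolvent_comm B r x : bounded_real_linear B ->
  (forall t y, 0 <= t -> B (T t y) = T t (B y)) -> 0 < r ->
  B (Res r x) = Res r (B x).
Proof.
move=> bB BT r0; apply: functional_ext => phi rphi.
rewrite -[phi (B _)]/((phi \o B) _) !functional_resolvent//; last first.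
  exact: functional_comp.
by apply: eq_Rintegral => s /set_mem/D0 s0 /=; rewrite BT.
Qed.

Lemma rnorm_resolvent M r x :
  (forall t, 0 <= t -> forall x, rnorm (T t x) <= M * rnorm x) -> 0 < r ->
  rnorm (Res r x) <= M / r * rnorm x.
Proof.
move=> TM r0; have [phi [rphi phi1 <-]] := norming_functional (Res r x).
rewrite functional_resolvent//.
apply: (@le_trans _ _
    (\int[leb]_(s in `[0, +oo[) (expR (- (r * s)) * (M * rnorm x)))).
  apply: le_Rintegral => //.
  - exact: integrable_resolvent.
  - have := integrableZr mD (M * rnorm x) (integrable_expRNM 0 r0).
    by apply: eq_integrable => // t _ /=; rewrite EFinM.
  - move=> s /D0 s0; rewrite ler_wpM2l ?expR_ge0//.
    by rewrite (le_trans (ler_norm _))// (le_trans (phi1 _))// TM.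
rewrite RintegralZr//; last exact: integrable_expRNM.
by rewrite Rintegral_expRNM// mulr0 oppr0 expR0 mulr1 mulrCA mulrA.
Qed.

Lemma resolvent_bounded r : 0 < r -> bounded_real_linear (Res r).
Proof.
move=> r0; split=> [x y|a x|].
- apply: functional_ext => phi rphi; have [phiD _ _] := rphi.
  rewrite phiD !functional_resolvent// -RintegralD//; try exact: integrable_resolvent.
  by apply: eq_Rintegral => s _; rewrite linearD phiD mulrDr.
- apply: functional_ext => phi rphi; have [_ phiZ _] := rphi.
  rewrite phiZ !functional_resolvent// -RintegralZl//; last exact: integrable_resolvent.
  by apply: eq_Rintegral => s _; rewrite [T s _]linearZ phiZ mulrCA.
- have [M M0 TM] := semigroup_bound hT.
  by exists (M / r) => x; exact: rnorm_resolvent.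
Qed.

Lemma semigroup_bounded_op t : 0 <= t -> bounded_real_linear (T t).
Proof.
move=> t0; split=> [x y|a x|]; rewrite ?linearD ?linearZZ//.
by have [M M0 TM] := semigroup_bound hT; exists M => x; exact: TM.
Qed.

Lemma semigroup_comm s t x : 0 <= s -> 0 <= t -> T s (T t x) = T t (T s x).
Proof. by move=> s0 t0; rewrite -!(semigroupD hT)// addrC. Qed.

Lemma semigroup_resolvent t r x : 0 <= t -> 0 < r ->
  T t (Res r x) = Res r (T t x).
Proof.
move=> t0 r0; apply: resolvent_comm => //; first exact: semigroup_bounded_op.
by move=> s y s0; exact: semigroup_comm.
Qed.

(** [T h] turns the resolvent integral into a rescaled tail of itself; increments in [h] then
    involve only the integral over [[0, h]]. *)
Lemma resolvent_shift phi r h x : real_functional phi -> 0 < r -> 0 <= h ->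
  phi (T h (Res r x)) =
  expR (r * h) * \int[leb]_(s in `[h, +oo[) (expR (- (r * s)) * phi (T s x)).
Proof.
move=> rphi r0 h0; rewrite semigroup_resolvent// functional_resolvent//.
pose g s := expR (- (r * s)) * phi (T (Num.max s 0) x).
have cg : continuous g.
  move=> s; apply: cvgM; first exact: continuous_expRNM.
  by apply: functional_cvg => //; exact: orbit_continuous.
have gE s : 0 <= s -> expR (- (r * s)) * phi (T s x) = g s.
  by move=> s0; rewrite /g max_l.
have -> : \int[leb]_(s in `[h, +oo[) (expR (- (r * s)) * phi (T s x)) =
    \int[leb]_(s in `[0, +oo[) g (s + h).
  rewrite /Rintegral integral_shift//; congr fine; apply: eq_integral => s.
  by rewrite inE/= in_itv/= andbT => hs; rewrite gE// (le_trans h0).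
rewrite -RintegralZl//.
  apply: eq_Rintegral => s /set_mem/D0 s0; rewrite -gE ?addr_ge0//.
  by rewrite mulrA -expRD (semigroupD hT)// mulrDr opprD addrCA subrr addr0.
have := integrableZl mD (expR (- (r * h))) (integrable_resolvent (T h x) rphi r0).
apply: eq_integrable => // s /set_mem/D0 s0 /=.
rewrite -gE ?addr_ge0// -EFinM; congr EFin.
by rewrite mulrA -expRD (semigroupD hT)// mulrDr opprD addrC.
Qed.

End Resolvent.

(** * Resolvents and the generator *)

Section Generator.
Context (R : realType) (X : completeNormedModType R[i]).
Local Notation leb := (@lebesgue_measure R).
Context (T : R -> {linear X -> X}) (hT : bounded_C0_semigroup T).
Implicit Types (r c h : R) (x w v : X) (phi : X -> R).
Local Notation Res := (resolvent T).

(* [c] is the integral of [exp (r s)] over [[0, h]]. *)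
Lemma resolvent_increment r h e c x : 0 < r -> 0 < h ->
  c = (expR (r * h) - 1) / r ->
  (forall s, 0 <= s <= h -> rnorm (T s x - x) <= e) ->
  rnorm (T h (Res r x) - Res r x - c%:C%C *: (r%:C%C *: Res r x - x)) <= e * c.
Proof.
move=> r0 h0 c_def Te; set V := _ - c%:C%C *: _.
have [phi [rphi phi1 <-]] := norming_functional V.
have [phiD phiZ _] := rphi.
pose u s := expR (- (r * s)) * phi (T s x).
have iu : leb.-integrable `[0, +oo[ (EFin \o u) by exact: integrable_resolvent.
have ie := integrable_expRNM 0 r0.
have I2E : \int[leb]_(s in `[0, +oo[) u s - \int[leb]_(s in `[0, h]) u s =
           \int[leb]_(s in `[h, +oo[) u s.
  rewrite Rintegral_itvB ?bnd_simp ?ltW//; apply: Rintegral_itv_obnd_cbnd.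
  apply: integrableS iu => //; apply: subset_itv; rewrite ?bnd_simp//.
  exact: ltW.
have JE : \int[leb]_(s in `[0, h]) expR (- (r * s)) = r^-1 * (1 - expR (- (r * h))).
  have : \int[leb]_(s in `[0, +oo[) expR (- (r * s)) -
         \int[leb]_(s in `[0, h]) expR (- (r * s)) =
         \int[leb]_(s in `[h, +oo[) expR (- (r * s)).
    rewrite Rintegral_itvB ?bnd_simp ?ltW//; apply: Rintegral_itv_obnd_cbnd.
    apply: integrableS ie => //; apply: subset_itv; rewrite ?bnd_simp//.
    exact: ltW.
  rewrite !Rintegral_expRNM// mulr0 oppr0 expR0; lra.
have I2_ge : (phi x - e) * (r^-1 * (1 - expR (- (r * h)))) <=
    \int[leb]_(s in `[0, h]) u s.
  have sub : `[0, h]%classic `<=` `[0, +oo[%classic.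
    by apply: subset_itv; rewrite ?bnd_simp.
  have ie' : leb.-integrable `[0, h] (fun s => (expR (- (r * s)))%:E).
    by apply: integrableS ie.
  rewrite -JE mulrC -RintegralZr//; apply: le_Rintegral => //.
  - have := integrableZr _ (phi x - e) ie'; move/(_ (measurable_itv _)).
    by apply: eq_integrable => // t _ /=; rewrite EFinM.
  - exact: integrableS iu.
  - move=> s; rewrite /= in_itv/= => /Te h1; rewrite /u ler_wpM2l ?expR_ge0//.
    have := le_trans (phi1 _) h1; rewrite functionalB// ler_norml => /andP[]; lra.
(* The terms in [Res r x] cancel, since [c r = exp (r h) - 1]. *)
have -> : phi V = c * phi x - expR (r * h) * \int[leb]_(s in `[0, h]) u s.
  rewrite /V !functionalB// phiZ functionalB// phiZ (resolvent_shift hT)// ?ltW//.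
  rewrite -I2E (functional_resolvent hT)// -/u c_def.
  by field; rewrite gt_eqF.
have E0 : 0 < expR (r * h) by exact: expR_gt0.
have EE : expR (r * h) * expR (- (r * h)) = 1 by rewrite -expRD subrr expR0.
have cE : c = expR (r * h) * (r^-1 * (1 - expR (- (r * h)))).
  by rewrite mulrCA mulrBr EE mulr1 mulrC c_def.
move: I2_ge; rewrite -(ler_pM2l E0) mulrCA -cE; lra.
Qed.

Definition has_generator x v : Prop :=
  (h^-1)%:C%C *: (T h x - x) @[h --> (0 : R)^'+] --> v.

Lemma has_generator_resolvent r x : 0 < r ->
  has_generator (Res r x) (r%:C%C *: Res r x - x).
Proof.
move=> r0; set v := r%:C%C *: _ - _.
apply/cvg_rnorm/cvgrPdist_le => e e0.
pose e1 := e / 4; have e10 : 0 < e1 by rewrite divr_gt0.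
have /cvg_rnorm/cvgrPdist_le/(_ e1 e10)[/= d d0 Hd] := semigroup_cvg hT (x := x).
(* The three bounds on [h] keep the orbit increments up to time [h] below [e1], give [r h < 1 / 2]
   and hence [1 <= c / h <= 1 + 2 r h], and give [4 r h (rnorm v + 1) < e]. Each of the two error
   terms is then at most [e / 2]. *)
pose d1 := Num.min (d / 2) (Num.min (1 / (2 * r)) (e / (4 * r * (rnorm v + 1)))).
have v0 : 0 < rnorm v + 1 by rewrite ltr_wpDl// rnorm_ge0.
have d10 : 0 < d1.
  by rewrite /d1 !lt_min !divr_gt0 ?mulr_gt0.
exists d1 => //= h /= hd h0.
have : h < d1 by move: hd; rewrite sub0r normrN gtr0_norm.
rewrite /d1 !lt_min => /and3P[{}hd h1 h2].
rewrite sub0r normrN ger0_norm ?rnorm_ge0//.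
have Te s : 0 <= s <= h -> rnorm (T s x - x) <= e1.
  move=> /andP[]; rewrite le_eqVlt => /predU1P[<- _|s0 sh].
    by rewrite (semigroup0 hT) subrr rnorm0 ltW.
  have := Hd s; rewrite /= sub0r normrN gtr0_norm// sub0r normrN ger0_norm ?rnorm_ge0//.
  by apply=> //; lra.
pose c := (expR (r * h) - 1) / r.
have := resolvent_increment r0 h0 (erefl c) Te; rewrite -/v => H.
have hn0 : h != 0 by rewrite gt_eqF.
have cE : (h^-1)%:C%C *: (T h (Res r x) - Res r x) - v =
   (h^-1)%:C%C *: (T h (Res r x) - Res r x - c%:C%C *: v) + (c / h - 1)%:C%C *: v.
  rewrite [in RHS]scalerBr scalerA -rmorphM rmorphB rmorph1 scalerBl scale1r.
  by rewrite [h^-1 * c]mulrC addrA subrK.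
rewrite cE (le_trans (rnormD _ _))// !rnormZ.
have rh0 : 0 < r * h by rewrite mulr_gt0.
have rh : r * h < 1 / 2.
  by move: h1; rewrite ltr_pdivlMr ?mulr_gt0//; lra.
have c1 : 1 <= c / h.
  by rewrite /c -mulrA -invfM ler_pdivlMr// mul1r; have := expR_ge1Dx (r * h); lra.
have c2 : c / h <= 1 + 2 * (r * h).
  rewrite /c -mulrA -invfM ler_pdivrMr// lerBlDr.
  have E0 := expR_gt0 (r * h).
  have EE : expR (r * h) * expR (- (r * h)) = 1 by rewrite -expRD subrr expR0.
  (* From [exp (- r h) >= 1 - r h]; then [1 / (1 - u) <= 1 + u + 2 u^2] for [0 <= u <= 1 / 2]. *)
  have : expR (r * h) * (1 - r * h) <= 1.
    rewrite -[leRHS]EE ler_pM2l//; exact: expR_ge1Dx.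
  nra.
have h3 : 4 * (r * h) * (rnorm v + 1) < e.
  by move: h2; rewrite ltr_pdivlMr ?mulr_gt0//; lra.
have p1 : `|h^-1| * rnorm (T h (Res r x) - Res r x - c%:C%C *: v) <= 2 * e1.
  rewrite gtr0_norm ?invr_gt0// mulrC ler_pdivrMr// (le_trans H)//.
  have : c <= 2 * h by rewrite -ler_pdivrMr//; lra.
  nra.
have p2 : `|c / h - 1| * rnorm v <= 2 * (r * h) * (rnorm v + 1).
  rewrite ger0_norm ?subr_ge0//; have := rnorm_ge0 v; nra.
rewrite /e1 in p1; lra.
Qed.

(** [Res r] commutes with the difference quotients of [w]. Their images have two limits: [Res r v]
    because [Res r] is bounded, and the value of the generator at [Res r w]. *)
Lemma generator_resolvent r w v : 0 < r -> has_generator w v ->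
  Res r v = r%:C%C *: Res r w - w.
Proof.
move=> r0 wv; apply: functional_ext => phi rphi.
have bR := resolvent_bounded hT r0; have [RD RZ _] := bR.
have rphiR := functional_comp bR rphi.
have C1 : (phi \o Res r) ((h^-1)%:C%C *: (T h w - w)) @[h --> (0 : R)^'+] -->
    (phi \o Res r) v by exact: functional_cvg.
have C2 : phi ((h^-1)%:C%C *: (T h (Res r w) - Res r w)) @[h --> (0 : R)^'+] -->
    phi (r%:C%C *: Res r w - w).
  by apply: functional_cvg => //; exact: has_generator_resolvent.
rewrite -(cvg_lim (@Rhausdorff R) C2); apply/esym/cvg_lim => //.
apply: cvg_trans C1; apply: near_eq_cvg; near=> h.
rewrite /= RZ (blinB _ _ bR) (semigroup_resolvent hT)//.
Unshelve. all: by end_near. Qed.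

(** [generator_resolvent] for [c] at the vector [Res r x], where the generator takes the value
    [r Res r x - x]. *)
Lemma resolvent_identity r c x : 0 < r -> 0 < c ->
  Res r x - Res c x = (c - r)%:C%C *: Res c (Res r x).
Proof.
move=> r0 c0; have bR := resolvent_bounded hT c0; have [_ RZ _] := bR.
have := generator_resolvent c0 (has_generator_resolvent (x := x) r0).
rewrite (blinB _ _ bR) RZ => E.
have -> : Res c x = r%:C%C *: Res c (Res r x) - (c%:C%C *: Res c (Res r x) - Res r x).
  by rewrite -E subKr.
by rewrite rmorphB scalerBl opprB addrA [Res r x + _]addrC subrK.
Qed.

End Generator.

(** * Fubini's theorem on a triangle *)

Section TriangleFubini.
Context (R : realType).
Local Notation leb := (@lebesgue_measure R).

Lemma EFin_Rintegral (d : measure_display) (T : measurableType d)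
    (mu : {measure set T -> \bar R}) (D : set T) (f : T -> R) :
  measurable D -> mu.-integrable D (EFin \o f) ->
  (\int[mu]_(t in D) (f t)%:E = (\int[mu]_(t in D) f t)%:E)%E.
Proof. by move=> mD fi; rewrite /Rintegral fineK//; exact: integrable_fin_num. Qed.

Lemma mitv (i : interval R) : measurable ([set` i] : set (measurableTypeR R)).
Proof. exact: measurable_itv. Qed.

Lemma lebesgue_itv_lty (a : R) : (leb `[0%R, a] < +oo)%E.
Proof. by rewrite lebesgue_measure_itv/=; case: ifP => // _; rewrite -EFinB ltry. Qed.

Context (k v : R -> R) (r C B : R).
Hypotheses (r0 : 0 < r) (mk : measurable_fun setT k) (mv : measurable_fun setT v).
Hypothesis kC : forall a, 0 <= a -> `|k a| <= C * expR (- (r * a)).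
Hypothesis vB : forall s, 0 <= s -> `|v s| <= B.

Let triangle : set (measurableTypeR R * measurableTypeR R) :=
  [set z | 0 <= z.1 /\ z.1 <= z.2].

Let measurable_triangle : measurable triangle.
Proof.
have m1 : measurable_fun setT (fun z : measurableTypeR R * measurableTypeR R => 0 <= z.1).
  exact: measurable_fun_ler.
have m2 : measurable_fun setT
    (fun z : measurableTypeR R * measurableTypeR R => z.1 <= z.2).
  exact: measurable_fun_ler.
have := measurableI _ _ (m1 measurableT [set true] I) (m2 measurableT [set true] I).
by rewrite !setTI.
Qed.

Let f (z : measurableTypeR R * measurableTypeR R) : R :=
  \1_triangle z * (k z.2 * v z.1).

Let mf : measurable_fun setT (EFin \o f).
Proof.
apply/measurable_EFinP; apply: measurable_funM.
  exact: measurable_indic.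
apply: measurable_funM.
  exact: measurableT_comp.
exact: measurableT_comp.
Qed.

Let int_k s : 0 <= s -> leb.-integrable `[s, +oo[ (EFin \o k).
Proof.
move=> s0; have h := integrableZl (mitv _) C (integrable_expRNM s r0).
apply: le_integrable h => //.
  by apply/measurable_EFinP; exact: measurable_funTS.
move=> a; rewrite /= in_itv/= andbT => sa.
rewrite lee_fin (le_trans (kC (le_trans s0 sa)))//.
exact: ler_norm.
Qed.

Let int_v a : leb.-integrable `[0, a] (EFin \o v).
Proof.
apply: measurable_bounded_integrable => //.
- exact: lebesgue_itv_lty.
- exact: measurable_funTS.
- exists B; split; first exact: num_real.
  move=> b Bb s; rewrite /= in_itv/= => /andP[s0 _].
  by rewrite (le_trans (vB s0))// ltW.
Qed.

Let FE s : (\int[leb]_a (f (s, a))%:E)%E =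
  (((fun s => v s * \int[leb]_(a in `[s, +oo[) k a) \_ `[0, +oo[) s)%:E.
Proof.
rewrite patchE mem_setE in_itv/= andbT; case: ifPn => s0; last first.
  apply: integral0_eq => a _; rewrite /f indicE memNset ?mul0r// => -[/= h _].
  by rewrite h in s0.
have -> : (\int[leb]_a (f (s, a))%:E = \int[leb]_(a in `[s, +oo[) (v s * k a)%:E)%E.
  rewrite [RHS]integral_mkcond; apply: eq_integral => a _.
  rewrite patchE mem_setE in_itv/= andbT /f indicE.
  case: ifPn => sa; first by rewrite mem_set// mul1r mulrC.
  by rewrite memNset ?mul0r// => -[_ /= h]; rewrite h in sa.
under eq_integral do rewrite EFinM.
by rewrite integralZl ?EFin_Rintegral//; exact: int_k.
Qed.

Let GE a : (\int[leb]_s (f (s, a))%:E)%E =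
  (((fun a => k a * \int[leb]_(s in `[0, a]) v s) \_ `[0, +oo[) a)%:E.
Proof.
have -> : (\int[leb]_s (f (s, a))%:E = \int[leb]_(s in `[0%R, a]) (k a * v s)%:E)%E.
  rewrite [RHS]integral_mkcond; apply: eq_integral => s _.
  rewrite patchE mem_setE in_itv/= /f indicE.
  case: ifPn => sa; first by rewrite mem_set ?mul1r//; exact/andP.
  by rewrite memNset ?mul0r// => /= /andP h; rewrite h in sa.
rewrite patchE mem_setE in_itv/= andbT; case: ifPn => a0; last first.
  by rewrite set_itv_ge ?integral_set0// bnd_simp.
under eq_integral do rewrite EFinM.
by rewrite integralZl ?EFin_Rintegral//; exact: int_v.
Qed.

Let B0 : 0 <= B. Proof. exact: le_trans (vB (lexx 0)). Qed.

Let C0 : 0 <= C.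
Proof.
by have := le_trans (normr_ge0 _) (kC (lexx 0)); rewrite mulr0 oppr0 expR0 mulr1.
Qed.

Let intf : (leb \x leb)%E.-integrable setT (EFin \o f).
Proof.
apply/integrable12ltyP => //.
(* The bounds on [k] and [v], integrated over [a >= s], leave [(B C / r) exp (- r s)]. *)
apply: (@le_lt_trans _ _
  (\int[leb]_(s in `[0%R, +oo[) ((B * C / r) * expR (- (r * s)))%:E)%E); last first.
  have := integrableZl (mitv _) (B * C / r) (integrable_expRNM 0 r0).
  move=> /(integrable_fin_num (mitv _)).
  by rewrite fin_numElt => /andP[_]; under eq_integral do rewrite -EFinM.
rewrite [leRHS]integral_mkcond; apply: ge0_le_integral => //.
- by move=> s _; exact: integral_ge0.
- apply: (measurable_fun_fubini_tonelli_F (abse \o (EFin \o f))) => //=.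
  exact: measurableT_comp.
- apply: (measurable_restrictT _ _).1; first exact: mitv.
  apply/measurable_EFinP/measurable_funM => //; apply: measurable_funTS.
  by apply: continuous_measurable_fun; exact: continuous_expRNM.
move=> s _; rewrite patchE mem_setE in_itv/= andbT; case: ifPn => s0; last first.
  rewrite integral0_eq// => a _; rewrite /f indicE memNset ?mul0r ?normr0//.
  by move=> [/= h _]; rewrite h in s0.
apply: (@le_trans _ _
    (\int[leb]_(a in `[s, +oo[) ((B * C)%:E * (expR (- (r * a)))%:E))%E); last first.
  rewrite ge0_integralZl//; last 2 first.
  - apply/measurable_EFinP; apply: measurable_funTS.
    by apply: continuous_measurable_fun; exact: continuous_expRNM.
  - by rewrite lee_fin mulr_ge0.
  by rewrite integral_expRNM// -EFinM mulrA.
rewrite [leRHS]integral_mkcond; apply: ge0_le_integral => //.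
- do 2!apply: measurableT_comp => //.
  exact: (measurable_fun_pair2 s (iffLR (measurable_EFinP _ _) mf)).
- apply: (measurable_restrictT _ _).1; first exact: mitv.
  apply: emeasurable_funM => //; apply/measurable_EFinP; apply: measurable_funTS.
  by apply: continuous_measurable_fun; exact: continuous_expRNM.
- move=> a _; rewrite patchE mem_setE in_itv/= andbT /f indicE.
  case: ifPn => sa; last first.
    by rewrite memNset ?mul0r ?normr0// => -[_ /= h]; rewrite h in sa.
  rewrite mem_set// mul1r normrM -EFinM lee_fin mulrC -mulrA.
  by rewrite ler_pM// ?vB// kC// (le_trans s0).
Qed.

(** Both sides integrate the product over the triangle [0 <= s <= a]. With an exponential [k] this
    is integration by parts for resolvents; with [v = 1] it produces the factor [s] of the kernel at
    the double pole [r = 1]. *)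
Lemma integral_triangle :
  (\int[leb]_(a in `[0%R, +oo[) (k a * \int[leb]_(s in `[0, a]) v s)%:E =
   \int[leb]_(s in `[0%R, +oo[) (v s * \int[leb]_(a in `[s, +oo[) k a)%:E)%E.
Proof.
rewrite [LHS]integral_mkcond [RHS]integral_mkcond !restrict_EFin.
under eq_integral do rewrite /= -GE.
under [RHS]eq_integral do rewrite /= -FE.
exact/esym/(Fubini intf).
Qed.

End TriangleFubini.

(** * The Hille-Phillips calculus of the regularized Stieltjes function *)

Section FiniteMeasures.
Context (R : realType) (X : completeNormedModType R[i]).
Local Notation leb := (@lebesgue_measure R).
Local Notation RT := (measurableTypeR R).
Context (T : R -> {linear X -> X}) (hT : bounded_C0_semigroup T).
Implicit Types (r c h : R) (x w v : X) (phi : X -> R).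
Local Notation Res := (resolvent T).

Let D0 t : [set` `[(0 : R), +oo[] t -> 0 <= t.
Proof. by rewrite /= in_itv/= andbT. Qed.

Section OneMeasure.
Context (mu : {finite_measure set RT -> \bar R}).

Let fw : (\int[mu]_(t in `[0%R, +oo[) `|(1 : R)|%:E < +oo)%E.
Proof.
rewrite integral_cst; last exact: mitv.
rewrite normr1 mul1e -ge0_fin_numE//; apply: fin_num_measure; exact: mitv.
Qed.

Let c1 : continuous (cst (1 : R) : R -> R).
Proof. by move=> t; exact: cvg_cst. Qed.

Lemma functional_bochner_finite phi x : real_functional phi ->
  phi (bochner mu `[0, +oo[ (fun s => T s x)) = \int[mu]_(s in `[0, +oo[) phi (T s x).
Proof.
move=> rphi.
have := functional_bochner_orbit hT (mitv _) D0 c1 fw x rphi.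
have -> : (fun s => (cst 1 s)%:C%C *: T s x) = (fun s => T s x).
  by apply/funext => s; rewrite /= rmorph1 scale1r.
by move=> ->; apply: eq_Rintegral => s _; rewrite mul1r.
Qed.

Lemma integrable_finite phi x : real_functional phi ->
  mu.-integrable `[0, +oo[ (fun s => (phi (T s x))%:E).
Proof.
move=> rphi.
have := integrable_orbit hT (mitv _) D0 c1 fw x rphi.
by apply: (eq_integrable (mitv _)) => s _; rewrite mul1r.
Qed.

End OneMeasure.

Lemma bochner_dirac x : bochner (dirac (0 : RT)) `[0, +oo[ (fun s => T s x) = x.
Proof.
apply: functional_ext => phi rphi.
rewrite (functional_bochner_finite (dirac (0 : RT)))// /Rintegral.
rewrite integral_dirac; last 2 first.
- exact: mitv.
- exact: (measurable_int _ (integrable_finite (dirac (0 : RT)) x rphi)).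
rewrite diracE mem_set; last by rewrite /= in_itv/= lexx.
by rewrite /= mul1r (semigroup0 hT).
Qed.

Lemma bochner_mzero x : bochner (mzero : {finite_measure set RT -> \bar R})
  `[0, +oo[ (fun s => T s x) = 0.
Proof.
apply: functional_ext => phi rphi.
rewrite (functional_bochner_finite mzero)// /Rintegral integral_measure_zero.
by rewrite functional0.
Qed.

End FiniteMeasures.

(** * Averages of densities over a finite measure *)

Section Mixture.
Context (R : realType).
Local Notation leb := (@lebesgue_measure R).
Local Notation RT := (measurableTypeR R).
Context (m : {finite_measure set RT -> \bar R}) (K : RT * RT -> R) (B : R).
Hypothesis mK : measurable_fun setT K.
Hypothesis K0 : forall r s, 0 <= s -> 0 <= K (r, s).
Hypothesis KB : forall r, (\int[leb]_(s in `[0%R, +oo[) (K (r, s))%:E <= B%:E)%E.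

Let K' (z : RT * RT) : R := \1_(`[0, +oo[ : set RT) z.2 * K z.

Let mK' : measurable_fun setT K'.
Proof.
by apply: measurable_funM => //; apply: measurableT_comp.
Qed.

Let K'_ge0 z : 0 <= K' z.
Proof.
rewrite /K' indicE; case: (boolP (_ \in _)) => [|_]; last by rewrite mul0r.
by rewrite inE/= in_itv/= andbT mul1r => s0; case: z s0 => r s /= s0; exact: K0.
Qed.

Definition mixed_density (s : RT) : \bar R := (\int[m]_r (K' (r, s))%:E)%E.

Lemma measurable_mixed_density : measurable_fun setT mixed_density.
Proof.
apply: (measurable_fun_fubini_tonelli_G (EFin \o K')) => //=.
exact/measurable_EFinP.
Qed.

Lemma mixed_density_ge0 s : (0 <= mixed_density s)%E.
Proof. by apply: integral_ge0 => r _; rewrite lee_fin. Qed.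

Let inner r : (\int[leb]_s (K' (r, s))%:E =
  \int[leb]_(s in `[0%R, +oo[) (K (r, s))%:E)%E.
Proof.
rewrite [RHS]integral_mkcond; apply: eq_integral => s _.
rewrite patchE /K' /= indicE; case: ifPn => _; first by rewrite mul1r.
by rewrite mul0r.
Qed.

Let Kfin : (\int[m]_r \int[leb]_s (K' (r, s))%:E < +oo)%E.
Proof.
apply: (@le_lt_trans _ _ (\int[m]_r B%:E)%E).
  apply: ge0_le_integral => //.
  - by move=> r _; apply: integral_ge0 => s _; rewrite lee_fin.
  - apply: (measurable_fun_fubini_tonelli_F (EFin \o K')) => //=.
    exact/measurable_EFinP.
  - by move=> r _; rewrite inner.
have B0 : 0 <= B.
  rewrite -lee_fin; apply: le_trans (KB 0); apply: integral_ge0 => s.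
  by rewrite /= in_itv/= andbT => s0; rewrite lee_fin K0.
rewrite integral_cst// lte_mul_pinfty// ?lee_fin//.
by rewrite -ge0_fin_numE//; exact: fin_num_measure.
Qed.

Lemma mixed_density_lty : (\int[leb]_s mixed_density s < +oo)%E.
Proof.
rewrite -(fubini_tonelli (EFin \o K'))/=.
- exact: Kfin.
- exact/measurable_EFinP.
- by move=> z; rewrite lee_fin.
Qed.

(** Its Laplace transform is the [m]-average of those of the densities [K (r, _)] on the half-line;
    the uniform bound [B] on their masses makes it finite. *)
Definition mixture : {finite_measure set RT -> \bar R} :=
  fin_mdensity measurable_mixed_density mixed_density_ge0 mixed_density_lty.

Context (X : completeNormedModType R[i]).
Context (T : R -> {linear X -> X}) (hT : bounded_C0_semigroup T).

Lemma functional_mixture phi x (G : R -> R) : real_functional phi ->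
  (forall r, \int[leb]_(s in `[0%R, +oo[) (K (r, s) * phi (T s x))%:E = (G r)%:E)%E ->
  phi (bochner mixture `[0, +oo[ (fun s => T s x)) = \int[m]_r G r.
Proof.
move=> rphi KG.
have [M M0 TM] := semigroup_bound hT.
have [C C0 phiC] := functional_bound rphi.
pose u s := phi (T (Num.max s 0) x).
have cu : continuous u.
  by move=> s; apply: functional_cvg => //; exact: orbit_continuous.
have mu_ : measurable_fun setT (u : RT -> R) by exact: continuous_measurable_fun.
pose b := C * (M * rnorm x).
have uB s : `|u s| <= b.
  rewrite (le_trans (phiC _))// ler_pM2l// TM//.
  by rewrite le_max lexx orbT.
have uE (s : RT) : s \in (`[0, +oo[%classic : set RT) -> phi (T s x) = u s.
  by rewrite inE/= in_itv/= andbT => s0; rewrite /u max_l.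
rewrite (functional_bochner_finite hT mixture)//.
under eq_Rintegral => s sD do rewrite uE//.
rewrite /Rintegral.
have -> : (\int[mixture]_(s in `[0%R, +oo[) (u s)%:E =
    \int[leb]_(s in `[0%R, +oo[) ((u s)%:E * mixed_density s))%E.
  apply: integral_density; first exact: mitv.
  exact: measurable_funTS.
congr fine.
pose f (z : RT * RT) := (K' z * u z.2)%:E.
have mf : measurable_fun setT f.
  apply/measurable_EFinP; apply: measurable_funM => //.
  exact: measurableT_comp.
have intf : (m \x leb)%E.-integrable setT f.
  apply/integrable12ltyP => //.
  apply: (@le_lt_trans _ _ (\int[m]_r (b%:E * \int[leb]_s (K' (r, s))%:E))%E).
    apply: ge0_le_integral => //.
    - by move=> r _; exact: integral_ge0.
    - apply: (measurable_fun_fubini_tonelli_F (abse \o f)) => //=.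
      exact: measurableT_comp.
    - apply: emeasurable_funM => //.
      apply: (measurable_fun_fubini_tonelli_F (EFin \o K')) => //=.
      exact/measurable_EFinP.
    - move=> r _; rewrite -ge0_integralZl//; last 3 first.
      + by apply/measurable_EFinP; exact: measurable_fun_pair2.
      + by move=> s _; rewrite lee_fin.
      + by rewrite lee_fin (le_trans _ (uB 0)).
      apply: ge0_le_integral => //.
      + by apply: measurableT_comp => //; exact: (measurable_fun_pair2 r mf).
      + apply: emeasurable_funM => //; apply/measurable_EFinP.
        exact: measurable_fun_pair2.
      + move=> s _; rewrite /f /= -EFinM lee_fin normrM ger0_norm//.
        by rewrite mulrC ler_wpM2r.
  rewrite ge0_integralZl//; last 3 first.
  - apply: (measurable_fun_fubini_tonelli_F (EFin \o K')) => //=.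
    exact/measurable_EFinP.
  - by move=> r _; apply: integral_ge0 => s _; rewrite lee_fin.
  - by rewrite lee_fin (le_trans _ (uB 0)).
  by rewrite lte_mul_pinfty ?lee_fin ?(le_trans _ (uB 0))//.
transitivity (\int[leb]_s \int[m]_r f (r, s))%E.
  rewrite [LHS]integral_mkcond; apply: eq_integral => s _.
  rewrite patchE; case: ifPn => sD; last first.
    apply/esym/integral0_eq => r _.
    by rewrite /f /K'/= indicE (negbTE sD) !mul0r.
  have mKs : measurable_fun setT (fun r => (K' (r, s))%:E).
    by apply/measurable_EFinP; exact: measurable_fun_pair1.
  rewrite /mixed_density.
  (* [mixed_density s] may be infinite, so the factor [u s] is moved under the integral by
     nonnegativity, according to its sign. *)
  have [us|us] := leP 0 (u s).
    rewrite -ge0_integralZl//; last by move=> r _; rewrite lee_fin.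
    by apply: eq_integral => r _; rewrite /f /= mulrC EFinM.
  have -> : (u s)%:E = (- (- u s)%:E)%E by rewrite EFinN oppeK.
  rewrite mulNe -ge0_integralZl//; last 2 first.
  - by move=> r _; rewrite lee_fin.
  - by rewrite lee_fin oppr_ge0 ltW.
  rewrite -integral_ge0N; last first.
    by move=> r _; rewrite mule_ge0// lee_fin// oppr_ge0 ltW.
  by apply: eq_integral => r _; rewrite /f -EFinM -EFinN mulNr opprK mulrC.
rewrite -(Fubini intf); apply: eq_integral => r _.
rewrite -KG [RHS]integral_mkcond; apply: eq_integral => s _.
rewrite patchE /f /K' /= indicE; case: ifPn => sD; last by rewrite !mul0r.
by rewrite mul1r uE.
Qed.

End Mixture.

Section ResolventContinuity.
Context (R : realType) (X : completeNormedModType R[i]).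
Context (T : R -> {linear X -> X}) (hT : bounded_C0_semigroup T).
Local Notation Res := (resolvent T).

(** By the resolvent identity the difference is [(r - s) Res r (Res s x)], and the double resolvent
    is bounded by a constant [L] as long as [s > r / 2]. *)
Lemma resolvent_continuous (r : R) x : 0 < r -> Res s x @[s --> r] --> Res r x.
Proof.
move=> r0; have [M M0 TM] := semigroup_bound hT.
apply/cvg_rnorm/cvgrPdist_le => e e0.
pose L := M / r * (M / (r / 2) * rnorm x) + 1.
have L0 : 0 < L.
  by rewrite ltr_wpDl// !mulr_ge0 ?invr_ge0 ?rnorm_ge0 ?mulr_ge0 ?invr_ge0 ?ltW.
have d0 : 0 < Num.min (r / 2) (e / L) by rewrite lt_min !divr_gt0.
exists (Num.min (r / 2) (e / L)) => //= s /=; rewrite lt_min => /andP[s1 s2].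
have sr : r / 2 < s by move: s1; rewrite ltr_norml => /andP[_]; lra.
have s0 : 0 < s by rewrite (lt_trans _ sr)// divr_gt0.
rewrite sub0r normrN ger0_norm ?rnorm_ge0//.
rewrite (resolvent_identity hT)// rnormZ.
have h1 := rnorm_resolvent hT (Res s x) TM r0.
have h2 := rnorm_resolvent hT x TM s0.
have h3 : M / s * rnorm x <= M / (r / 2) * rnorm x.
  rewrite ler_wpM2r ?rnorm_ge0// ler_pM2l// lef_pV2 ?posrE ?divr_gt0//.
  exact: ltW.
have h4 : rnorm (Res r (Res s x)) <= L.
  rewrite /L (le_trans h1)// ler_wpDr// ler_pM2l ?divr_gt0//.
  exact: le_trans h2 h3.
apply: (@le_trans _ _ (`|r - s| * L)); first by rewrite ler_wpM2l.
by rewrite -ler_pdivlMr// ltW.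
Qed.

End ResolventContinuity.

(** * Kernels of the regularized Stieltjes function *)

Section Kernels.
Context (R : realType).
Local Notation leb := (@lebesgue_measure R).
Local Notation RT := (measurableTypeR R).
Implicit Types (r s : R).

Lemma Rintegral_lebesgue_itv0 (a : R) : 0 <= a ->
  \int[leb]_(s in `[0, a]) cst 1 s = a.
Proof.
move=> a0; rewrite Rintegral_cst ?mul1r; last exact: mitv.
have -> // : fine (leb `[0, a]%classic) = a.
rewrite lebesgue_measure_itv/= lte_fin; move: a0; rewrite le_eqVlt.
by move=> /predU1P[<-|->]/=; rewrite ?ltxx// oppr0 addr0.
Qed.

(* [s |-> qker (r, s)] is the convolution of [exp (- r s)] and [exp (- s)], with
   Laplace transform [1 / ((z + 1) (z + r))]. *)
Definition qker (z : RT * RT) : R :=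
  if z.1 == 1 then z.2 * expR (- z.2)
  else (expR (- (z.1 * z.2)) - expR (- z.2)) / (1 - z.1).

(* [mu] may be infinite, but [mu / wgt] is finite on ]0, +oo[: the kernels absorb
   the weight. *)
Definition wgt r : R := 1 + Num.max r 0.
Definition clip r : R := Num.min (Num.max r 0) 1.

(* For [r > 0], [z / ((z + 1) (z + r)) =
   1 / (z + max r 1) - min r 1 / ((z + 1) (z + r))]. *)
Definition ker_pos (z : RT * RT) : R := wgt z.1 * expR (- (Num.max z.1 1 * z.2)).
Definition ker_neg (z : RT * RT) : R := wgt z.1 * clip z.1 * qker z.

Lemma wgt_ge1 r : 1 <= wgt r.
Proof. by rewrite /wgt lerDl le_max lexx orbT. Qed.

Lemma clip_ge0 r : 0 <= clip r.
Proof. by rewrite /clip le_min ler01 andbT le_max lexx orbT. Qed.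

Lemma measurable_wgt : measurable_fun setT (wgt : RT -> R).
Proof.
apply: measurable_funD => //.
exact: (measurable_maxr (@measurable_id _ RT setT) (measurable_cst (0 : R))).
Qed.

Lemma measurable_clip : measurable_fun setT (clip : RT -> R).
Proof.
apply: (measurable_minr _ (measurable_cst (1 : R))).
exact: (measurable_maxr (@measurable_id _ RT setT) (measurable_cst (0 : R))).
Qed.

Lemma measurable_invr : measurable_fun setT (fun r : RT => r^-1).
Proof.
(* Inversion is discontinuous only at 0, where its value is 0; this point is split off. *)
have -> : (fun r : R => r^-1) = (fun r => if r == 0 then 0 else r^-1).
  by apply/funext => r; case: eqP => // ->; rewrite invr0.
have m0 : measurable_fun setT (fun r : RT => r == 0 :> R).
  by apply: measurable_fun_eqr.
apply: (measurable_fun_if _ m0) => //.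
have -> : [set: RT] `&` (fun r : RT => r == 0 :> R) @^-1` [set false] =
    [set r : R | r != 0].
  by rewrite setTI; apply/seteqP; split => r /= => [->//|/negbTE].
apply: (@open_continuous_measurable_fun R [set r | r != 0]).
  exact: open_neq.
by move=> r; rewrite inE/= => r0; exact: inv_continuous.
Qed.

Lemma measurable_ker_pos : measurable_fun setT ker_pos.
Proof.
apply: measurable_funM.
  by apply: measurableT_comp; [exact: measurable_wgt|exact: measurable_fst].
apply: measurableT_comp => //; apply: measurableT_comp => //.
apply: measurable_funM => //.
exact: (measurable_maxr measurable_fst (measurable_cst (1 : R))).
Qed.

Lemma measurable_qker : measurable_fun setT qker.
Proof.
apply: measurable_fun_if => //.
- by apply: measurable_fun_eqr.
- apply: measurable_funTS; apply: measurable_funM => //.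
  by apply: measurableT_comp => //; apply: measurableT_comp.
- apply: measurable_funTS; apply: measurable_funM.
    apply: measurable_funB; last first.
      by apply: measurableT_comp => //; apply: measurableT_comp.
    apply: measurableT_comp => //; apply: measurableT_comp => //.
    exact: measurable_funM.
  apply: (measurableT_comp measurable_invr).
  exact: measurable_funB.
Qed.

Lemma measurable_ker_neg : measurable_fun setT ker_neg.
Proof.
apply: measurable_funM; last exact: measurable_qker.
apply: measurable_funM.
  by apply: measurableT_comp; [exact: measurable_wgt|exact: measurable_fst].
by apply: measurableT_comp; [exact: measurable_clip|exact: measurable_fst].
Qed.

Lemma ker_pos_ge0 r s : 0 <= s -> 0 <= ker_pos (r, s).
Proof.
by move=> s0; rewrite /ker_pos mulr_ge0 ?expR_ge0// (le_trans _ (wgt_ge1 _)).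
Qed.

Lemma qker_ge0 r s : 0 <= s -> 0 <= qker (r, s).
Proof.
move=> s0; rewrite /qker/=; case: ifPn => [_|r1].
  by rewrite mulr_ge0// expR_ge0.
have [rlt1|] := ltP r 1.
  by rewrite divr_ge0// subr_ge0 ?ler_expR ?lerN2 ?ler_piMl// ltW.
rewrite le_eqVlt eq_sym (negbTE r1)/= => r1'.
rewrite -mulrNN -invrN divr_ge0// oppr_ge0 subr_le0 ?ler_expR ?lerN2 ?ler_peMl//.
  exact: ltW.
exact: ltW.
Qed.

Lemma ker_neg_ge0 r s : 0 <= s -> 0 <= ker_neg (r, s).
Proof.
move=> s0; rewrite /ker_neg !mulr_ge0 ?qker_ge0 ?clip_ge0//.
by rewrite (le_trans _ (wgt_ge1 _)).
Qed.

(* Fubini's theorem replaces the partial fraction decomposition at [r = 1]. *)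
Lemma integral_qker (u : R -> R) (B r : R) :
  measurable_fun setT u -> (forall s, 0 <= s -> `|u s| <= B) -> 0 < r ->
  let L t c := \int[leb]_(s in `[t, +oo[) (expR (- (c * s)) * u s) in
  let I := if r == 1 then \int[leb]_(t in `[0, +oo[) L t 1
           else (L 0 r - L 0 1) / (1 - r) in
  (r == 1 -> leb.-integrable `[0, +oo[ (fun t => (L t 1)%:E)) ->
  (\int[leb]_(s in `[0%R, +oo[) (qker (r, s) * u s)%:E = I%:E)%E.
Proof.
move=> mu_ uB r0 L I Li.
have B0 : 0 <= B := le_trans (normr_ge0 _) (uB 0 (lexx 0)).
have iL c : 0 < c -> leb.-integrable `[0, +oo[ (fun s => (expR (- (c * s)) * u s)%:E).
  move=> c0; have h := integrableZl (mitv _) B (integrable_expRNM 0 c0).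
  apply: le_integrable h; first exact: mitv.
    apply/measurable_EFinP; apply: measurable_funTS; apply: measurable_funM => //.
    by apply: continuous_measurable_fun; exact: continuous_expRNM.
  move=> s; rewrite /= in_itv/= andbT => s0.
  rewrite lee_fin !normrM !(ger0_norm (expR_ge0 _)) (ger0_norm B0) mulrC.
  by rewrite ler_wpM2r ?expR_ge0// uB.
rewrite {}/I /qker/=; case: ifPn Li => [/eqP r1 /(_ isT) Li|r1 _].
  (* At the double pole the kernel is [s exp (- s)], with [s] read as the integral of 1 over
     [[0, s]]. *)
  have /= := @integral_triangle R (fun a => expR (- (1 * a)) * u a) (cst 1) 1 B 1
    ltr01 _ (measurable_cst _).
  have -> : \int[leb]_(t in `[0, +oo[) L t 1 =
     \int[leb]_(t in `[0, +oo[) (cst 1 t * L t 1).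
    by apply: eq_Rintegral => t _; rewrite mul1r.
  rewrite -EFin_Rintegral; [|exact: mitv|]; last first.
    by apply: (eq_integrable (mitv _)) Li => t _; rewrite /= mul1r.
  move=> <-.
  - apply: eq_integral => s; rewrite inE/= in_itv/= andbT => s0; congr EFin.
    by rewrite Rintegral_lebesgue_itv0// mul1r [RHS]mulrC mulrA.
  - apply: measurable_funM => //.
    by apply: continuous_measurable_fun; exact: continuous_expRNM.
  - move=> a a0; rewrite normrM (ger0_norm (expR_ge0 _)) mulrC.
    by rewrite ler_wpM2r ?expR_ge0// uB.
  - by move=> s _ /=; rewrite normr1.
rewrite -RintegralB; [|exact: mitv|exact: iL|exact: iL].
have iD : leb.-integrable `[0, +oo[
    (EFin \o (fun s => expR (- (r * s)) * u s - expR (- (1 * s)) * u s)).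
  by apply: (eq_integrable (mitv _)) (integrableB (mitv _) (iL r r0) (iL 1 ltr01)).
rewrite -RintegralZr; [|exact: mitv|exact: iD].
rewrite -EFin_Rintegral; [|exact: mitv|].
  apply: eq_integral => s _; congr EFin; rewrite mul1r -mulrBl; ring.
by apply: (eq_integrable (mitv _)) (integrableZr (mitv _) (1 - r)^-1 iD).
Qed.

End Kernels.

Section StieltjesMeasure.
Context (R : realType).
Local Notation RT := (measurableTypeR R).
Context (mu : {measure set RT -> \bar R}).
Hypothesis hmu : (\int[mu]_(s in `]0%R, +oo[) ((1 + s)^-1)%:E < +oo)%E.

Lemma integrable_inv1D : mu.-integrable `]0, +oo[ (fun r => ((1 + r)^-1)%:E).
Proof.
apply/integrableP; split.
  apply/measurable_EFinP; apply: measurable_funTS.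
  by apply: (measurableT_comp (@measurable_invr R)); exact: measurable_funD.
have ra (r : RT) : r \in (`]0, +oo[%classic : set RT) ->
    (`|((1 + r)^-1)%:E| = ((1 + r)^-1)%:E)%E.
  move=> rD; rewrite gee0_abs// lee_fin; move: rD.
  by rewrite inE/= in_itv/= andbT => r0; rewrite invr_ge0 addr_ge0// ltW.
by under eq_integral => r rD do rewrite ra//.
Qed.

(** Comparison: [1 / (t + r) <= (1 + 1 / t) / (1 + r)]. *)
Lemma integrable_stieltjes_kernel t : 0 < t ->
  mu.-integrable `]0, +oo[ (fun r => ((t + r)^-1)%:E).
Proof.
move=> t0; have h := integrableZl (mitv _) (1 + t^-1) integrable_inv1D.
apply: le_integrable h; first exact: mitv.
  apply/measurable_EFinP; apply: measurable_funTS.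
  by apply: (measurableT_comp (@measurable_invr R)); exact: measurable_funD.
move=> r; rewrite /= in_itv/= andbT => r0.
have r0' := ltW r0; have t0' := ltW t0.
rewrite lee_fin !ger0_norm ?mulr_ge0 ?invr_ge0 ?addr_ge0 ?invr_ge0//.
rewrite -[leLHS]mul1r ler_pdivrMr ?addr_gt0// mulrAC ler_pdivlMr ?addr_gt0// mul1r.
have -> : (1 + t^-1) * (t + r) = 1 + t + r + r / t.
  by field; rewrite gt_eqF.
have : 0 <= r / t by rewrite divr_ge0.
lra.
Qed.

End StieltjesMeasure.

(** * Measures representing [e] and [e g] *)

Section Regularizer.
Context (R : realType).
Local Notation leb := (@lebesgue_measure R).
Local Notation RT := (measurableTypeR R).
Implicit Types (r s : R).

Definition exp_ker (z : RT * RT) : R := expR (- (1 * z.2)).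

Lemma measurable_exp_ker : measurable_fun setT exp_ker.
Proof.
apply: measurableT_comp => //; apply: measurableT_comp => //.
exact: measurable_funM.
Qed.

Lemma exp_ker_ge0 (r s : RT) : 0 <= s -> 0 <= exp_ker (r, s).
Proof. by move=> _; exact: expR_ge0. Qed.

Lemma exp_ker_bound (r : RT) :
  (\int[leb]_(s in `[0%R, +oo[) (exp_ker (r, s))%:E <= 1%:E)%E.
Proof. by rewrite integral_expRNM// invr1 mul1r mulr0 oppr0 expR0. Qed.

(** The density [exp (- s)] is written as a mixture over a point mass, so that [functional_mixture]
    also covers it. *)
Definition exp_measure : {finite_measure set RT -> \bar R} :=
  mixture (dirac (0 : RT)) measurable_exp_ker exp_ker_ge0 exp_ker_bound.

(* The regularizer [z / (z + 1) = 1 - 1 / (z + 1)]. *)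
Definition reg_measure : cmeasure R :=
  CMeasure (dirac (0 : RT)) exp_measure mzero mzero.

(** Without the weight the mass is [1 / max(r, 1)], and [1 + max(r, 0)] is at most twice
    [max(r, 1)]. *)
Lemma ker_pos_bound (r : RT) :
  (\int[leb]_(s in `[0%R, +oo[) (ker_pos (r, s))%:E <= 2%:E)%E.
Proof.
have m0 : 0 < Num.max r 1 :> R by rewrite lt_max ltr01 orbT.
have w0 : 0 <= wgt r by rewrite (le_trans _ (wgt_ge1 r)).
rewrite /ker_pos/=; under eq_integral do rewrite EFinM.
rewrite ge0_integralZl; last 4 first.
- exact: mitv.
- apply/measurable_EFinP; apply: measurable_funTS.
  by apply: continuous_measurable_fun; exact: continuous_expRNM.
- by move=> s _; rewrite lee_fin expR_ge0.
- by rewrite lee_fin.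
rewrite integral_expRNM// mulr0 oppr0 expR0 mulr1 -EFinM lee_fin.
rewrite ler_pdivrMr// /wgt !maxEle; case: ifP; case: ifP; lra.
Qed.

Lemma integral_qker1 (r : R) : 0 < r ->
  (\int[leb]_(s in `[0%R, +oo[) (qker (r, s))%:E = (r^-1)%:E)%E.
Proof.
move=> r0.
have L c t : 0 < c -> \int[leb]_(s in `[t, +oo[) (expR (- (c * s)) * cst 1 s) =
    c^-1 * expR (- (c * t)).
  move=> c_gt0; rewrite -Rintegral_expRNM//.
  by apply: eq_Rintegral => s _; rewrite mulr1.
have := @integral_qker R (cst 1) 1 r (measurable_cst _) _ r0.
move=> /(_ _)/=; under eq_integral do rewrite mulr1.
move=> -> //; last 2 first.
- by move=> s _; rewrite normr1.
- move=> _; have := integrable_expRNM 0 (@ltr01 R).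
  by apply: (eq_integrable (mitv _)) => t _; rewrite L// invr1 mul1r.
have -> : (if r == 1 then
     \int[leb]_(t in `[0, +oo[) \int[leb]_(s in `[t, +oo[) (expR (- (1 * s)) * 1)
   else (\int[leb]_(s in `[0, +oo[) (expR (- (r * s)) * 1) -
         \int[leb]_(s in `[0, +oo[) (expR (- (1 * s)) * 1)) / (1 - r)) = r^-1.
  rewrite !L// !mulr0 oppr0 expR0 invr1 !mulr1; case: eqP => [->|/eqP r1].
    under eq_Rintegral do rewrite L// invr1 mul1r.
    by rewrite Rintegral_expRNM// invr1 mulr0 oppr0 expR0 mulr1.
  have r10 : 1 - r != 0 :> R by rewrite subr_eq0 eq_sym; exact: r1.
  have r_neq0 : r != 0 :> R by rewrite gt_eqF.
  by field; apply/andP; split.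
by [].
Qed.

(** For [r > 0] the mass is [(1 + r) min(r, 1) / r]: the factor [clip r] compensates for the mass
    [1 / r] of [qker]. For [r <= 0] it makes the kernel vanish. *)
Lemma ker_neg_bound (r : RT) :
  (\int[leb]_(s in `[0%R, +oo[) (ker_neg (r, s))%:E <= 2%:E)%E.
Proof.
have w0 : 0 <= wgt r by rewrite (le_trans _ (wgt_ge1 r)).
have c0 := clip_ge0 r.
have [r0|r0] := leP r 0.
  have -> : (\int[leb]_(s in `[0%R, +oo[) (ker_neg (r, s))%:E = 0)%E.
    apply: integral0_eq => s _.
    by rewrite /ker_neg /= /clip max_r// min_l ?ler01// mulr0 mul0r.
  by rewrite lee_fin.
have mq : measurable_fun setT (fun s : RT => qker (r, s)).
  exact: (measurable_fun_pair2 (f := @qker R) r (@measurable_qker R)).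
rewrite /ker_neg/=; under eq_integral do rewrite EFinM.
rewrite ge0_integralZl; last 4 first.
- exact: mitv.
- by apply/measurable_EFinP; apply: measurable_funTS.
- by move=> s; rewrite /= in_itv/= andbT => s0; rewrite lee_fin qker_ge0.
- by rewrite lee_fin mulr_ge0.
rewrite integral_qker1//.
rewrite -EFinM lee_fin ler_pdivrMr// /wgt /clip (max_l (ltW r0)).
rewrite minEle; case: ifP; nra.
Qed.

Context (mu : {measure set RT -> \bar R}).
Hypothesis hmu : (\int[mu]_(s in `]0%R, +oo[) ((1 + s)^-1)%:E < +oo)%E.

Definition weight (r : RT) : \bar R := ((\1_(`]0, +oo[ : set RT) r) / wgt r)%:E.

Lemma measurable_weight : measurable_fun setT weight.
Proof.
apply/measurable_EFinP; apply: measurable_funM.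
  by apply: measurable_indic; exact: mitv.
by apply: (measurableT_comp (@measurable_invr R)); exact: measurable_wgt.
Qed.

Lemma weight_ge0 r : (0 <= weight r)%E.
Proof. by rewrite lee_fin divr_ge0// (le_trans _ (wgt_ge1 r)). Qed.

Lemma weight_lty : (\int[mu]_r weight r < +oo)%E.
Proof.
have -> // : (\int[mu]_r weight r = \int[mu]_(s in `]0%R, +oo[) ((1 + s)^-1)%:E)%E.
rewrite [RHS]integral_mkcond; apply: eq_integral => r _.
rewrite patchE /weight indicE; case: ifPn => [|_]; last by rewrite mul0r.
by rewrite inE/= in_itv/= andbT => r0; rewrite mul1r /wgt max_l// ltW.
Qed.

Definition weighted : {finite_measure set RT -> \bar R} :=
  fin_mdensity measurable_weight weight_ge0 weight_lty.

Lemma Rintegral_weighted (G : R -> R) : measurable_fun setT (G : RT -> R) ->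
  \int[weighted]_r (wgt r * G r) = \int[mu]_(r in `]0, +oo[) G r.
Proof.
move=> mG; rewrite /Rintegral.
have -> : (\int[weighted]_r (wgt r * G r)%:E =
    \int[mu]_r ((wgt r * G r)%:E * weight r))%E.
  apply: integral_density => //; apply: measurable_funM => //.
  exact: measurable_wgt.
congr fine; rewrite [RHS]integral_mkcond; apply: eq_integral => r _.
have w0 : wgt r != 0 by rewrite gt_eqF// (lt_le_trans _ (wgt_ge1 r)).
rewrite patchE /weight indicE -EFinM; case: ifPn => _; last by rewrite mul0r mulr0.
by rewrite mul1r mulrAC divff// mul1r.
Qed.

Definition pos_measure : {finite_measure set RT -> \bar R} :=
  mixture weighted (@measurable_ker_pos R) (@ker_pos_ge0 R) ker_pos_bound.

Definition neg_measure : {finite_measure set RT -> \bar R} :=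
  mixture weighted (@measurable_ker_neg R) (@ker_neg_ge0 R) ker_neg_bound.

Definition reg_stieltjes : cmeasure R :=
  CMeasure pos_measure neg_measure mzero mzero.

End Regularizer.

(** * The operator identity [e(A) y = (e g)(A) x] *)

Section MainIdentity.
Local Opaque resolvent.
Context (R : realType).
Local Notation leb := (@lebesgue_measure R).
Local Notation RT := (measurableTypeR R).
Context (X : completeNormedModType R[i]).
Context (T : R -> {linear X -> X}) (hT : bounded_C0_semigroup T).
Local Notation Res := (resolvent T).
Implicit Types (r s : R) (x : X) (phi : X -> R).

Lemma hp_op_real (p n : {finite_measure set RT -> \bar R}) x :
  hp_op T (CMeasure p n mzero mzero) x =
  bochner p `[0, +oo[ (fun s => T s x) - bochner n `[0, +oo[ (fun s => T s x).
Proof. by rewrite /hp_op/= bochner_mzero// subrr scaler0 addr0. Qed.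

Lemma hp_op_reg x : hp_op T (reg_measure R) x = x - Res 1 x.
Proof.
rewrite /reg_measure hp_op_real bochner_dirac//; congr (_ - _).
apply: functional_ext => phi rphi.
rewrite (functional_mixture _ _ _ _ hT (G := cst (phi (Res 1 x))))//.
  rewrite Rintegral_cst// -[RHS]mulr1; congr (_ * _).
  by rewrite -[X in fine X]/(dirac (0 : RT) [set: RT]) diracT.
move=> r; rewrite /= (functional_resolvent hT)// -EFin_Rintegral; [by []|exact: mitv|].
exact: (integrable_resolvent hT).
Qed.

(** For [r] other than 1 this is the resolvent identity divided by [1 - r]. At [r = 1] the tail
    integrals are [exp (- t) T t (Res 1 x)], and their integral over [t] is a second resolvent. *)
Lemma functional_qker phi r x : real_functional phi -> 0 < r ->
  (\int[leb]_(s in `[0%R, +oo[) (qker (r, s) * phi (T s x))%:E =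
   (phi (Res 1 (Res r x)))%:E)%E.
Proof.
move=> rphi r0.
have [M M0 TM] := semigroup_bound hT.
have [C C0 phiC] := functional_bound rphi.
pose u s := phi (T (Num.max s 0) x).
have cu : continuous u.
  by move=> s; apply: functional_cvg => //; exact: orbit_continuous.
have mu_ : measurable_fun setT (u : RT -> R) by exact: continuous_measurable_fun.
have uB s : 0 <= s -> `|u s| <= C * (M * rnorm x).
  move=> s0; rewrite (le_trans (phiC _))// ler_pM2l// TM//.
  by rewrite le_max lexx orbT.
have uE s : 0 <= s -> phi (T s x) = u s by move=> s0; rewrite /u max_l.
have uEt t c s : 0 <= t -> s \in (`[t, +oo[%classic : set RT) ->
    expR (- (c * s)) * u s = expR (- (c * s)) * phi (T s x).
  by rewrite inE/= in_itv/= andbT => t0 ts; rewrite uE// (le_trans t0).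
have -> : (\int[leb]_(s in `[0%R, +oo[) (qker (r, s) * phi (T s x))%:E =
    \int[leb]_(s in `[0%R, +oo[) (qker (r, s) * u s)%:E)%E.
  by apply: eq_integral => s; rewrite inE/= in_itv/= andbT => s0; rewrite uE.
have L1 t : 0 <= t -> \int[leb]_(s in `[t, +oo[) (expR (- (1 * s)) * u s) =
    expR (- (1 * t)) * phi (T t (Res 1 x)).
  move=> t0; rewrite (resolvent_shift hT)// mulrA -expRD addNr expR0 mul1r.
  by apply: eq_Rintegral => s st; rewrite (uEt t).
have L0 c : 0 < c -> \int[leb]_(s in `[0, +oo[) (expR (- (c * s)) * u s) =
    phi (Res c x).
  move=> c0; rewrite (functional_resolvent hT)//.
  by apply: eq_Rintegral => s st; rewrite (uEt 0).
rewrite (integral_qker mu_ uB r0); last first.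
  move=> _; have := integrable_resolvent hT (Res 1 x) rphi ltr01.
  apply: (eq_integrable (mitv _)) => t; rewrite inE/= in_itv/= andbT => t0.
  by rewrite L1.
congr EFin; case: ifPn => [/eqP r1|r1].
  transitivity (\int[leb]_(t in `[0, +oo[) (expR (- (1 * t)) * phi (T t (Res 1 x)))).
    by apply: eq_Rintegral => t; rewrite inE/= in_itv/= andbT => t0; rewrite L1.
  by rewrite r1; exact/esym/(functional_resolvent hT (Res 1 x) rphi ltr01).
have r10 : 1 - r != 0 by rewrite subr_eq0 eq_sym.
rewrite !L0// -(functionalB _ _ rphi) (resolvent_identity hT)//.
by have [_ -> _] := rphi; rewrite mulrC mulKf.
Qed.

Lemma integrable_qker_orbit phi r x : real_functional phi -> 0 < r ->
  leb.-integrable `[0, +oo[ (fun s => (qker (r, s) * phi (T s x))%:E).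
Proof.
move=> rphi r0.
have [M M0 TM] := semigroup_bound hT.
have [C C0 phiC] := functional_bound rphi.
have mq : measurable_fun (`[0, +oo[%classic : set RT) (fun s : RT => qker (r, s)).
  apply: measurable_funTS.
  exact: (measurable_fun_pair2 (f := @qker R) r (@measurable_qker R)).
have iq : leb.-integrable `[0, +oo[ (fun s => (qker (r, s))%:E).
  apply/integrableP; split; first exact/measurable_EFinP.
  have qa (s : RT) : s \in (`[0, +oo[%classic : set RT) ->
      (`|(qker (r, s))%:E| = (qker (r, s))%:E)%E.
    move=> sD; rewrite gee0_abs// lee_fin; move: sD.
    by rewrite inE/= in_itv/= andbT; exact: qker_ge0.
  under eq_integral => s sD do rewrite qa//.
  by rewrite integral_qker1// ltry.
have h := integrableZl (mitv _) (C * (M * rnorm x)) iq.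
apply: le_integrable h; first exact: mitv.
  apply/measurable_EFinP; apply: measurable_funM => //.
  (* The orbit function is recovered, as a measurable function, from the resolvent integrand at 1
     multiplied by [exp s]. *)
  have := measurable_int _ (integrable_resolvent hT x rphi ltr01).
  move=> /measurable_EFinP me.
  apply: (eq_measurable_fun (fun s => expR (1 * s) * (expR (- (1 * s)) * phi (T s x)))).
    by move=> s _; rewrite mulrA -expRD subrr expR0 mul1r.
  apply: measurable_funM => //; apply: measurable_funTS.
  by apply: measurableT_comp => //; exact: measurable_funM.
move=> s; rewrite /= in_itv/= andbT => s0.
rewrite lee_fin !normrM (ger0_norm (qker_ge0 _ s0)) mulrC ler_wpM2r ?qker_ge0//.
rewrite -!normrM (le_trans (phiC _))// (le_trans _ (ler_norm _))//.
by rewrite ler_pM2l// TM.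
Qed.

Lemma measurable_functional_resolvent phi c x : real_functional phi -> 0 < c ->
  measurable_fun setT ((fun r => phi (Res (Num.max r c) x)) : RT -> R).
Proof.
move=> rphi c0; apply: continuous_measurable_fun => r.
have m0 : 0 < Num.max r c by rewrite lt_max c0 orbT.
apply: functional_cvg => //.
apply: (continuous_comp (f := fun r => Num.max r c) (g := fun r => Res r x)).
  by apply: (@continuous_max _ _ id (cst c)); [exact: cvg_id|exact: cvg_cst].
exact: resolvent_continuous.
Qed.

Context (mu : {measure set RT -> \bar R}).
Hypothesis hmu : (\int[mu]_(s in `]0%R, +oo[) ((1 + s)^-1)%:E < +oo)%E.
Context (x : X).
Hypothesis hx : (\int[mu]_(r in `]0%R, +oo[) (rnorm (Res r x))%:E < +oo)%E.

Definition stieltjes_op : X := bochner mu `]0, +oo[ (Res^~ x).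

Let cR (t : R) : [set` `]0, +oo[] t -> Res s x @[s --> t] --> Res t x.
Proof. by rewrite /= in_itv/= andbT => t0; exact: resolvent_continuous. Qed.

Lemma functional_stieltjes_op phi : real_functional phi ->
  phi stieltjes_op = \int[mu]_(r in `]0, +oo[) phi (Res r x).
Proof. exact: (functional_bochner_line (mitv _) (fun _ _ => erefl) cR hx). Qed.

Let int_phi phi : real_functional phi ->
  mu.-integrable `]0, +oo[ (EFin \o (fun r => phi (Res r x))).
Proof. exact: (integrable_functional_line (mitv _) (fun _ _ => erefl) cR hx). Qed.

Lemma hp_op_stieltjes :
  hp_op T (reg_measure R) stieltjes_op = hp_op T (reg_stieltjes hmu) x.
Proof.
rewrite hp_op_reg hp_op_real; apply: functional_ext => phi rphi.
have [_ phiZ _] := rphi.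
have bR := resolvent_bounded hT (@ltr01 R).
have rphi1 := functional_comp bR rphi.
have i1 := int_phi rphi.
have i2 := int_phi rphi1.
have [M M0 TM] := semigroup_bound hT.
have [C C0 phiC] := functional_bound rphi.
pose F r := phi (Res (Num.max r 1) x).
have mF : measurable_fun setT (F : RT -> R).
  exact: measurable_functional_resolvent.
(* [Res (max r 1)] has norm at most [M / max(r, 1)], and [1 / max(r, 1) <= 2 / (1 + r)]. *)
have i3 : mu.-integrable `]0, +oo[ (EFin \o F).
  have h := integrableZl (mitv _) (2 * (C * (M * rnorm x))) (integrable_inv1D hmu).
  apply: le_integrable h; first exact: mitv.
    by apply/measurable_EFinP; exact: measurable_funTS.
  move=> r; rewrite /= in_itv/= andbT => r0.
  have m0 : 0 < Num.max r 1 by rewrite lt_max ltr01 orbT.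
  have nx := rnorm_ge0 x.
  rewrite lee_fin [leRHS]ger0_norm//; last first.
    by rewrite !mulr_ge0 ?invr_ge0 ?addr_ge0// ltW.
  rewrite (le_trans (phiC _))//.
  have := rnorm_resolvent hT x TM m0; rewrite -(ler_pM2l C0) => /le_trans; apply.
  have -> : C * (M / Num.max r 1 * rnorm x) = C * (M * rnorm x) / Num.max r 1 by ring.
  have K0 : 0 <= C * (M * rnorm x) by rewrite !mulr_ge0// ltW.
  have h1 : 1 <= 2 * (1 + r)^-1 * Num.max r 1.
    rewrite mulrAC ler_pdivlMr ?addr_gt0// mul1r maxEle; case: ifP; lra.
  have := ler_peMr K0 h1; rewrite ler_pdivrMr//.
  by congr (_ <= _); ring.
pose G r := clip r * phi (Res 1 (Res r x)).
(* For [r <= 1] this is the resolvent identity between [r] and 1; for [r > 1] both sides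
   coincide. *)
have FG0 (r : R) : 0 < r -> phi (Res r x) - phi (Res 1 (Res r x)) = F r - G r.
  move=> r0; rewrite /F /G /clip (max_l (ltW r0)).
  have [r1|r1] := leP r 1.
    have E : phi (Res r x) - phi (Res 1 x) = (1 - r) * phi (Res 1 (Res r x)).
      rewrite -phiZ -(resolvent_identity hT x r0 ltr01).
      exact/esym/(functionalB (Res r x) (Res 1 x) rphi).
    have alg (a b c : R) : a - b = (1 - r) * c -> a - c = b - r * c.
      by move=> /eqP; rewrite subr_eq => /eqP ->; ring.
    exact: alg E.
  by rewrite mul1r.
have FG (r : RT) : r \in (`]0, +oo[%classic : set RT) ->
    phi (Res r x) - phi (Res 1 (Res r x)) = F r - G r.
  by rewrite inE/= in_itv/= andbT; exact: FG0.
(* No separate bound on [G]: by [FG] it is a combination of three functions already known to be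
   integrable. *)
have i4 : mu.-integrable `]0, +oo[ (EFin \o G).
  have h := integrableB (mitv _) i3 (integrableB (mitv _) i1 i2).
  apply: (eq_integrable (mitv _)) h => r r0 /=.
  have alg (a b c : R) : a = b - c -> b - a = c.
    by move=> ->; rewrite opprB addrC subrK.
  by congr EFin; exact: alg (FG r r0).
have EL : phi (stieltjes_op - Res 1 stieltjes_op) =
    \int[mu]_(r in `]0, +oo[) (phi (Res r x) - phi (Res 1 (Res r x))).
  transitivity (\int[mu]_(r in `]0, +oo[) phi (Res r x) -
      \int[mu]_(r in `]0, +oo[) phi (Res 1 (Res r x))).
    rewrite (functionalB _ _ rphi); congr (_ - _).
      exact: functional_stieltjes_op.
    exact: (functional_stieltjes_op rphi1).
  exact/esym/(RintegralB (mitv _) i1 i2).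
have EP : phi (bochner (pos_measure hmu) `[0, +oo[ (fun s => T s x)) =
    \int[mu]_(r in `]0, +oo[) F r.
  rewrite -(Rintegral_weighted hmu mF); apply: functional_mixture => // r.
  have m0 : 0 < Num.max r 1 :> R by rewrite lt_max ltr01 orbT.
  have ir := integrable_resolvent hT x rphi m0.
  rewrite /F (functional_resolvent hT x rphi m0) EFinM.
  rewrite -(EFin_Rintegral (mitv _) ir) -(integralZl (mitv _) ir).
  by apply: eq_integral => s _; rewrite /ker_pos/= -EFinM mulrA.
have mG : measurable_fun setT (G : RT -> R).
  (* [clip] vanishes for [r <= 0], so [G] equals its restriction to []0, +oo[], where integrability
     contains measurability. *)
  have -> : G = G \_ `]0, +oo[.
    apply/funext => r; rewrite patchE; case: ifPn => //.
    rewrite mem_setE in_itv/= andbT -leNgt => r0.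
    by rewrite /G /clip max_r// min_l ?ler01// mul0r.
  apply: (measurable_restrictT _ _).1; first exact: mitv.
  by apply/measurable_EFinP; exact: (measurable_int _ i4).
have EN : phi (bochner (neg_measure hmu) `[0, +oo[ (fun s => T s x)) =
    \int[mu]_(r in `]0, +oo[) G r.
  rewrite -(Rintegral_weighted hmu mG); apply: functional_mixture => // r.
  have [r0|r0] := leP r 0.
    have c0 : clip r = 0 by rewrite /clip max_r// min_l ?ler01.
    rewrite /G c0 mul0r mulr0; apply: integral0_eq => s _.
    by rewrite /ker_neg/= c0 mulr0 !mul0r.
  rewrite /G mulrA EFinM -(functional_qker x rphi r0).
  rewrite -(integralZl (mitv _) (integrable_qker_orbit x rphi r0)).
  by apply: eq_integral => s _; rewrite /ker_neg/= -EFinM mulrA.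
apply: (etrans EL); apply/esym/(etrans (functionalB _ _ rphi)).
apply: (etrans (congr2 (fun a b => a - b) EP EN)).
apply: (etrans (esym (RintegralB (mitv _) i3 i4))); apply: eq_Rintegral => r r0.
exact/esym/FG.
Qed.

End MainIdentity.

(** * Injectivity of the regularizer *)

Section Injectivity.
Context (R : realType) (X : completeNormedModType R[i]).
Context (T : R -> {linear X -> X}) (hT : bounded_C0_semigroup T).
Local Notation Res := (resolvent T).
Implicit Types (r : R) (x : X).
Local Opaque resolvent.

Lemma resolvent_fixed_eq0 (domA : set X) (A : X -> X) x :
  is_generator T domA (fun y => - A y) -> closure (A @` domA) = [set: X] ->
  Res 1 x = x -> x = 0.
Proof.
move=> [_ genA] ranA fx.
have [M M0 TM] := semigroup_bound hT.
have fr r : 0 < r -> r%:C%C *: Res r x = x.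
  (* With [Res 1 x = x] the resolvent identity reads [x - Res r x = (r - 1) Res r x]. *)
  move=> r0; have := resolvent_identity hT x ltr01 r0.
  rewrite fx rmorphB rmorph1 scalerBl scale1r => /eqP.
  by rewrite (inj_eq (@addIr _ _)) => /eqP.
apply/rnorm_eq0/eqP; rewrite eq_le rnorm_ge0 andbT leNgt; apply/negP => x0.
(* For [w] with [rnorm (x - A w) < e], write [x = r Res r (x - A w) + r Res r (A w)]. The choices of
   [e] and, below, of [r] make each term at most [rnorm x / 4]; the second one uses
   [Res r (A w) = w - r Res r w]. *)
pose e := rnorm x / (4 * M).
have e0 : 0 < e by rewrite divr_gt0// mulr_gt0.
have : closure (A @` domA) x by rewrite ranA.
have e0' : 0 < e%:C%C by rewrite ltcR.
move=> /(_ _ (nbhsx_ballx x _ e0'))[_ [[w domw <-]]].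
rewrite -ball_normE /ball_/= normCE ltcR => xw.
pose K := (1 + M) * (rnorm w + 1).
have K0 : 0 < K by rewrite mulr_gt0 ?(addr_gt0 ltr01 M0)// ltr_wpDl// rnorm_ge0.
pose r := rnorm x / (4 * K).
have r0 : 0 < r by rewrite divr_gt0// mulr_gt0.
have bR := resolvent_bounded hT r0.
have gw := generator_resolvent hT r0 (genA w domw).
have h1 : rnorm (r%:C%C *: Res r (x - A w)) <= M * e.
  rewrite rnormZ gtr0_norm//.
  have := rnorm_resolvent hT (x - A w) TM r0.
  rewrite -(ler_pM2l r0) => /le_trans; apply.
  have -> : r * (M / r * rnorm (x - A w)) = M * rnorm (x - A w).
    by field; rewrite gt_eqF.
  by rewrite ler_pM2l// ltW.
have h2 : rnorm (r%:C%C *: Res r (A w)) <= r * K.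
  rewrite rnormZ gtr0_norm// ler_pM2l//.
  have -> : Res r (A w) = w - r%:C%C *: Res r w.
    have := blinB 0 (- A w) bR; rewrite sub0r opprK gw => ->.
    have -> : Res r 0 = 0 by have := blinB 0 0 bR; rewrite !subr0 subrr.
    by rewrite sub0r opprB.
  rewrite (le_trans (rnormB _ _))// rnormZ gtr0_norm//.
  have := rnorm_resolvent hT w TM r0; rewrite -(ler_pM2l r0).
  have -> : r * (M / r * rnorm w) = M * rnorm w by field; rewrite gt_eqF.
  have := rnorm_ge0 w; rewrite /K; nra.
have : rnorm x <= M * e + r * K.
  rewrite -{1}(fr r r0) -{1}(subrK (A w) x).
  have [-> _ _] := bR; rewrite scalerDr (le_trans (rnormD _ _))//.
  exact: lerD.
have -> : M * e = rnorm x / 4 by rewrite /e; field; rewrite gt_eqF.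
have -> : r * K = rnorm x / 4 by rewrite /r; field; rewrite gt_eqF.
by lra.
Qed.

Lemma hp_op_reg_inj (domA : set X) (A : X -> X) :
  is_generator T domA (fun y => - A y) -> closure (A @` domA) = [set: X] ->
  injective (hp_op T (reg_measure R)).
Proof.
move=> genA ranA x y; rewrite !(hp_op_reg hT) => xy.
apply/eqP; rewrite -subr_eq0; apply/eqP.
apply: (resolvent_fixed_eq0 genA ranA).
have alg (a b c d : X) : a - b = c - d -> b - d = a - c.
  move=> h; have -> : a = c - d + b by rewrite -h subrK.
  by rewrite addrAC [c - d]addrC addrK addrC.
exact: etrans (blinB x y (resolvent_bounded hT ltr01)) (alg _ _ _ _ xy).
Qed.

End Injectivity.

(** * From Cesàro means to resolvents *)

Section Monotone.
Context (d : measure_display) (T : measurableType d) (R : realType).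
Context (mu : {measure set T -> \bar R}).
Local Open Scope ereal_scope.

(** Obtained from the definition of the integral as a supremum over simple functions. Measurability
    does not enter, so integrands such as the one built from the Cesàro means can be compared
    directly. *)
Lemma ge0_le_integral_sup (D : set T) (f g : T -> \bar R) :
  (forall x, D x -> 0 <= f x) -> (forall x, D x -> f x <= g x) ->
  \int[mu]_(x in D) f x <= \int[mu]_(x in D) g x.
Proof.
move=> f0 fg; have g0 x : D x -> 0 <= g x.
  by move=> Dx; rewrite (le_trans (f0 x Dx)) ?fg.
rewrite !ge0_integralE//; apply: le_ereal_sup => _ [h hf <-]; exists h => //= x.
apply: le_trans (hf x) _; rewrite !patchE; case: ifPn => // /set_mem; exact: fg.
Qed.

End Monotone.

Section Cesaro.
Context (R : realType) (X : completeNormedModType R[i]).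
Context (T : R -> {linear X -> X}) (hT : bounded_C0_semigroup T).
Local Notation leb := (@lebesgue_measure R).
Local Notation RT := (measurableTypeR R).
Local Notation Res := (resolvent T).
Implicit Types (r t : R) (x : X) (phi : X -> R).
Local Opaque resolvent.

Definition orbit_integral x t : X := bochner leb `[0, t] (fun s => T s x).
Local Notation S := orbit_integral.

Let c1 : continuous (cst (1 : R) : R -> R).
Proof. by move=> t; exact: cvg_cst. Qed.

Let D0 t s : [set` `[(0 : R), t]] s -> 0 <= s.
Proof. by rewrite /= in_itv/= => /andP[]. Qed.

Let fw t : (\int[leb]_(s in `[0%R, t]) `|(1 : R)|%:E < +oo)%E.
Proof.
rewrite integral_cst; last exact: mitv.
by rewrite normr1 mul1e; exact: lebesgue_itv_lty.
Qed.

Lemma functional_orbit_integral phi x t : real_functional phi ->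
  phi (S x t) = \int[leb]_(s in `[0, t]) phi (T s x).
Proof.
move=> rphi; rewrite /orbit_integral.
have := functional_bochner_orbit hT (mitv _) (@D0 t) c1 (@fw t) x rphi.
have -> : (fun s => (cst 1 s)%:C%C *: T s x) = (fun s => T s x).
  by apply/funext => s; rewrite /= rmorph1 scale1r.
by move=> ->; apply: eq_Rintegral => s _; rewrite mul1r.
Qed.

Let int_orbit phi x t : real_functional phi ->
  leb.-integrable `[0, t] (EFin \o (fun s => phi (T s x))).
Proof.
move=> rphi; have := integrable_orbit hT (mitv _) (@D0 t) c1 (@fw t) x rphi.
by apply: (eq_integrable (mitv _)) => s _ /=; rewrite mul1r.
Qed.

Lemma orbit_integral_lipschitz M x a b :
  (forall t, 0 <= t -> forall x, rnorm (T t x) <= M * rnorm x) ->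
  0 <= a -> a <= b -> rnorm (S x b - S x a) <= M * rnorm x * (b - a).
Proof.
move=> TM a0 ab; have [phi [rphi phi1 <-]] := norming_functional (S x b - S x a).
rewrite (functionalB _ _ rphi) !functional_orbit_integral//.
have ib := int_orbit x b rphi.
rewrite (Rintegral_itvB ib) ?bnd_simp//.
have sub : [set` `]a, b]] `<=` [set` `[0, b]].
  by apply: subset_itv; rewrite bnd_simp.
have iab := integrableS (mitv _) (mitv _) sub ib.
have ic : leb.-integrable `]a, b] (EFin \o cst (M * rnorm x)).
  have h := integrableS (mitv _) (mitv _) sub (integrableZl (mitv _) (M * rnorm x) _).
  apply: (eq_integrable (mitv _)) (h leb (EFin \o cst 1) _) => [s _|].
    by rewrite /= mule1.
  apply/integrableP; split; first by apply/measurable_EFinP; exact: measurable_cst.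
  exact: fw.
apply: (@le_trans _ _ (\int[leb]_(s in `]a, b]) cst (M * rnorm x) s)).
  apply: le_Rintegral; [exact: mitv|exact: iab|exact: ic|].
  move=> s /sub/D0 s0; rewrite (le_trans (ler_norm _))// (le_trans (phi1 _))//.
  exact: TM.
rewrite Rintegral_cst; last exact: mitv.
have -> // : fine (leb `]a, b]%classic) = b - a.
rewrite lebesgue_measure_itv/= lte_fin; move: ab; rewrite le_eqVlt.
by move=> /predU1P[<-|->]/=; rewrite ?ltxx ?subrr.
Qed.

Lemma orbit_integral0 x : S x 0 = 0.
Proof.
apply: functional_ext => phi rphi.
rewrite functional_orbit_integral// functional0// set_itv1 Rintegral_set1//.
Qed.

Lemma rnorm_orbit_integral M x t :
  (forall t, 0 <= t -> forall x, rnorm (T t x) <= M * rnorm x) ->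
  0 <= t -> rnorm (S x t) <= M * rnorm x * t.
Proof.
move=> TM t0; have := orbit_integral_lipschitz x TM (lexx 0) t0.
by rewrite orbit_integral0 !subr0.
Qed.

Lemma orbit_integral_continuous x t :
  S x (Num.max s 0) @[s --> t] --> S x (Num.max t 0).
Proof.
have [M M0 TM] := semigroup_bound hT.
have lip (a b : R) : 0 <= a -> 0 <= b ->
    rnorm (S x a - S x b) <= M * rnorm x * `|a - b|.
  wlog ab : a b / a <= b => [hw a0 b0|a0 b0].
    have [ab|/ltW ba] := leP a b; first exact: hw.
    by rewrite rnorm_distC distrC; exact: hw.
  rewrite rnorm_distC distrC ger0_norm ?subr_ge0//.
  exact: orbit_integral_lipschitz.
apply/cvg_rnorm/cvgrPdist_lt => e e0.
pose L := M * rnorm x + 1.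
have L0 : 0 < L by rewrite ltr_wpDl// mulr_ge0 ?rnorm_ge0 ?ltW.
exists (e / L) => /=; first by rewrite divr_gt0.
move=> s /= ts; rewrite sub0r normrN ger0_norm ?rnorm_ge0//.
have m0 (u : R) : 0 <= Num.max u 0 by rewrite le_max lexx orbT.
apply: le_lt_trans (lip _ _ (m0 s) (m0 t)) _.
have mm := dist_maxr0_le s t.
apply: (@le_lt_trans _ _ (L * `|t - s|)).
  apply: ler_pM => //; first by rewrite mulr_ge0 ?rnorm_ge0 ?ltW.
  by rewrite /L lerDl.
by rewrite mulrC -ltr_pdivlMr.
Qed.

Lemma continuous_rnorm_orbit_integral x :
  continuous (fun t : R => rnorm (S x (Num.max t 0))).
Proof.
move=> t; have /cvg_rnorm h := @orbit_integral_continuous x t.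
apply/cvgrPdist_le => e e0; have /cvgrPdist_le/(_ e e0) := h.
apply: filterS => s; rewrite sub0r normrN ger0_norm ?rnorm_ge0// => hs.
by apply: le_trans hs; rewrite rnorm_distC; exact: rnorm_dist_le.
Qed.

(* Integration by parts: [Res r x = r int_0^oo exp (- r t) S x t dt]. *)
Lemma rnorm_resolvent_le r x : 0 < r ->
  ((rnorm (Res r x))%:E <=
   \int[leb]_(t in `[0%R, +oo[) (r * expR (- (r * t)) * rnorm (S x t))%:E)%E.
Proof.
move=> r0; have [phi [rphi phi1 <-]] := norming_functional (Res r x).
have [M M0 TM] := semigroup_bound hT.
pose k a := r * expR (- (r * a)).
pose u s := phi (T (Num.max s 0) x).
have cu : continuous u.
  by move=> s; apply: functional_cvg => //; exact: orbit_continuous.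
have mu_ : measurable_fun setT (u : RT -> R) by exact: continuous_measurable_fun.
have mk : measurable_fun setT (k : RT -> R).
  apply: measurable_funM => //; apply: continuous_measurable_fun.
  exact: continuous_expRNM.
have uB s : 0 <= s -> `|u s| <= M * rnorm x.
  by move=> s0; rewrite (le_trans (phi1 _))// TM// le_max lexx orbT.
have kB a : 0 <= a -> `|k a| <= r * expR (- (r * a)).
  by move=> _; rewrite ger0_norm// mulr_ge0 ?expR_ge0 ?ltW.
have uE s : 0 <= s -> phi (T s x) = u s by move=> s0; rewrite /u max_l.
have E1 : (phi (Res r x))%:E =
    (\int[leb]_(a in `[0%R, +oo[) (k a * phi (S x a))%:E)%E.
  transitivity (\int[leb]_(a in `[0%R, +oo[) (k a * \int[leb]_(s in `[0, a]) u s)%:E)%E;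
    last first.
    apply: eq_integral => a _; congr (_ * _)%:E.
    rewrite functional_orbit_integral//; apply: eq_Rintegral => s /set_mem/D0 s0.
    by rewrite uE.
  (* After the exchange the inner integral of [k] over [[s, +oo[] is [exp (- r s)]. *)
  rewrite (integral_triangle r0 mk mu_ kB uB).
  rewrite (functional_resolvent hT x rphi r0).
  rewrite -(EFin_Rintegral (mitv _) (integrable_resolvent hT x rphi r0)).
  apply: eq_integral => s; rewrite inE/= in_itv/= andbT => s0; congr EFin.
  rewrite uE// mulrC; congr (_ * _).
  rewrite /k RintegralZl; [|exact: mitv|exact: integrable_expRNM].
  by rewrite Rintegral_expRNM// mulrA divff ?gt_eqF// mul1r.
rewrite E1; apply: le_trans (lee_abs _) _.
apply: le_trans (le_abse_integral _ (mitv _) _) _.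
  apply/measurable_EFinP; apply: measurable_funM; first exact: measurable_funTS.
  apply: (eq_measurable_fun (fun a : RT => phi (S x (Num.max (a : R) 0)))) => [a|].
    by move=> /set_mem; rewrite /= in_itv/= andbT => a0; rewrite max_l.
  apply: measurable_funTS; apply: continuous_measurable_fun => a.
  by apply: functional_cvg => //; exact: orbit_integral_continuous.
apply: ge0_le_integral_sup => [a _|a]; first exact: abse_ge0.
rewrite /= in_itv/= andbT => a0; rewrite lee_fin normrM.
by rewrite ler_pM// kB.
Qed.

End Cesaro.

(** * Absolute convergence of the integral of resolvents *)

Section Finiteness.
Context (R : realType) (X : completeNormedModType R[i]).
Context (T : R -> {linear X -> X}) (hT : bounded_C0_semigroup T).
Local Notation leb := (@lebesgue_measure R).
Local Notation RT := (measurableTypeR R).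
Local Notation Res := (resolvent T).
Implicit Types (r t : R) (x : X).
Local Opaque resolvent.
Context (mu : {measure set RT -> \bar R}).
Hypothesis hmu : (\int[mu]_(s in `]0%R, +oo[) ((1 + s)^-1)%:E < +oo)%E.

Lemma ge0_integral_weighted (H : RT -> \bar R) : measurable_fun setT H ->
  (forall r, 0 <= H r)%E ->
  (\int[weighted hmu]_r ((wgt r)%:E * H r) = \int[mu]_(r in `]0%R, +oo[) H r)%E.
Proof.
move=> mH H0.
have w_ge0 (r : R) : 0 <= wgt r by rewrite (le_trans _ (wgt_ge1 r)).
have -> : (\int[weighted hmu]_r ((wgt r)%:E * H r) =
    \int[mu]_r (((wgt r)%:E * H r) * weight r))%E.
  apply: ge0_integral_density => //.
  - apply: emeasurable_funM => //; apply/measurable_EFinP; exact: measurable_wgt.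
  - by move=> r; rewrite mule_ge0// lee_fin.
rewrite [RHS]integral_mkcond; apply: eq_integral => r _.
have w0 : wgt r != 0 by rewrite gt_eqF// (lt_le_trans _ (wgt_ge1 r)).
rewrite patchE /weight indicE; case: ifPn => _; last by rewrite mul0r mule0.
by rewrite mul1r muleAC -EFinM divff// mul1e.
Qed.

(** [exp u] is the square of [exp (u / 2) >= 1 + u / 2], and
    [4 (1 + u / 2)^2 = (2 + u)^2 >= u (1 + u)]. *)
Lemma expR_quad (u : R) : 0 <= u -> u * expR (- u) <= 4 / (1 + u).
Proof.
move=> u0; have u1 : 0 < 1 + u by rewrite ltr_wpDr.
rewrite expRN ler_pdivlMr// mulrAC ler_pdivrMr ?expR_gt0//.
have h := expR_ge1Dx (u / 2).
have -> : expR u = expR (u / 2) * expR (u / 2) by rewrite -expRD; congr expR; lra.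
nra.
Qed.

(** Isolates the times [t >= 1]. For [r >= 1] the bound [M rnorm x / r] already suffices. For
    [r < 1] the integrand on [[0, 1[] is at most [M rnorm x], as [r exp (- r t) <= 1]; and
    [1 <= 2 / (1 + r)]. *)
Lemma rnorm_resolvent_split M r x :
  (forall t, 0 <= t -> forall x, rnorm (T t x) <= M * rnorm x) -> 0 < M -> 0 < r ->
  ((rnorm (Res r x))%:E <= (2 * M * rnorm x * (1 + r)^-1)%:E +
   \int[leb]_(t in `[1%R, +oo[)
     (r * expR (- (r * t)) * rnorm (orbit_integral T x t))%:E)%E.
Proof.
move=> TM M0 r0.
have i0 : (0 <= \int[leb]_(t in `[1%R, +oo[)
    (r * expR (- (r * t)) * rnorm (orbit_integral T x t))%:E)%E.
  apply: integral_ge0 => t _.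
  by rewrite lee_fin !mulr_ge0 ?expR_ge0 ?rnorm_ge0// ltW.
have n0 := rnorm_ge0 x.
have [r1|r1] := leP 1 r.
  apply: le_trans (leeDl _ i0); rewrite lee_fin.
  apply: le_trans (rnorm_resolvent hT x TM r0) _.
  rewrite ler_pdivlMr ?addr_gt0//.
  have -> : M / r * rnorm x * (1 + r) = M * rnorm x * (r^-1 + 1).
    by field; rewrite gt_eqF.
  have -> : 2 * M * rnorm x = M * rnorm x * 2 by ring.
  rewrite ler_wpM2l ?(mulr_ge0 (ltW M0) n0)//.
  have : r^-1 <= 1 by rewrite invf_le1.
  lra.
apply: le_trans (rnorm_resolvent_le hT x r0) _.
have mf : measurable_fun (`[0, +oo[%classic : set RT) (fun t =>
    (r * expR (- (r * t)) * rnorm (orbit_integral T x t))%:E).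
  apply/measurable_EFinP; apply: measurable_funM.
    apply: measurable_funM => //; apply: measurable_funTS.
    by apply: continuous_measurable_fun; exact: continuous_expRNM.
  apply: (eq_measurable_fun (fun a : RT =>
      rnorm (orbit_integral T x (Num.max (a : R) 0)))) => [a|].
    by move=> /set_mem; rewrite /= in_itv/= andbT => a0; rewrite max_l.
  apply: measurable_funTS; apply: continuous_measurable_fun.
  exact: continuous_rnorm_orbit_integral.
have U : `[(0 : R), +oo[%classic = `[(0 : R), 1[%classic `|` `[(1 : R), +oo[%classic.
  by rewrite -itv_bndbnd_setU ?bnd_simp//.
rewrite U ge0_integral_setU; last 5 first.
- exact: mitv.
- exact: mitv.
- by rewrite -U.
- by move=> t _; rewrite lee_fin !mulr_ge0 ?expR_ge0 ?rnorm_ge0// ltW.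
- apply: lt_disjoint => a b; rewrite !in_itv/= andbT => /andP[_ a1] b1.
  exact: lt_le_trans b1.
apply: leeD => //.
apply: (@le_trans _ _ (\int[leb]_(t in `[0%R, 1%R[) (M * rnorm x)%:E)%E).
  apply: ge0_le_integral_sup => t /=; rewrite in_itv/= => /andP[t0 t1].
    by rewrite lee_fin !mulr_ge0 ?expR_ge0 ?rnorm_ge0// ltW.
  rewrite lee_fin.
  have h1 := rnorm_orbit_integral hT x TM t0.
  have h2 : M * rnorm x * t <= M * rnorm x.
    by rewrite ler_piMr ?(mulr_ge0 (ltW M0) n0)// ltW.
  rewrite (le_trans _ (le_trans h1 h2))// ler_piMl ?rnorm_ge0//.
  have e1 : expR (- (r * t)) <= 1.
    by rewrite -[leRHS]expR0 ler_expR oppr_le0 mulr_ge0// ltW.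
  by rewrite mulr_ile1 ?expR_ge0// ltW.
rewrite integral_cst; last exact: mitv.
have l1 : (leb `[0%R, 1%R[%classic = 1)%E.
  by rewrite lebesgue_measure_itv/= lte_fin ltr01 oppr0 adde0.
apply: (@le_trans _ _ ((M * rnorm x)%:E * 1)%E); first by rewrite -l1.
rewrite mule1 lee_fin ler_pdivlMr ?addr_gt0//.
have : 0 <= M * rnorm x by rewrite mulr_ge0// ltW.
nra.
Qed.

Lemma stieltjes_op_integrable x :
  (\int[leb]_(t in `[1%R, +oo[)
     (stieltjes mu t^-1 * rnorm (cesaro_mean T t x) / t)%:E < +oo)%E ->
  (\int[mu]_(r in `]0%R, +oo[) (rnorm (Res r x))%:E < +oo)%E.
Proof.
move=> hC; have [M M0 TM] := semigroup_bound hT.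
pose N t := rnorm (orbit_integral T x (Num.max t 0)).
have mN : measurable_fun setT (N : RT -> R).
  by apply: continuous_measurable_fun; exact: continuous_rnorm_orbit_integral.
pose D1 : set RT := `[1, +oo[%classic.
(* With the factor [1 / 4] inside [f], the bound of [expR_quad] yields exactly the integrand of the
   hypothesis. Clamping [r] and [t] at 0 keeps [f] nonnegative and measurable on the whole plane. *)
pose f (z : RT * RT) : R :=
  4^-1 * (Num.max (z.1 : R) 0 * expR (- (z.1 * z.2)) * N z.2) * \1_D1 z.2.
have f0 z : 0 <= f z.
  rewrite /f !mulr_ge0 ?expR_ge0 ?rnorm_ge0 ?invr_ge0//.
  by rewrite le_max lexx orbT.
have mf : measurable_fun setT f.
  apply: measurable_funM; last first.
    apply: measurableT_comp => //; apply: measurable_indic; exact: mitv.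
  apply: measurable_funM => //; apply: measurable_funM; last exact: measurableT_comp.
  apply: measurable_funM.
    exact: (measurable_maxr measurable_fst (measurable_cst (0 : R))).
  apply: measurableT_comp => //; apply: measurableT_comp => //.
  exact: measurable_funM.
pose H (r : RT) : \bar R := (\int[leb]_t (f (r, t))%:E)%E.
have mH : measurable_fun setT H.
  apply: (measurable_fun_fubini_tonelli_F (EFin \o f)) => //=.
  exact/measurable_EFinP.
have H0 r : (0 <= H r)%E by apply: integral_ge0 => t _; rewrite lee_fin.
have HE (r : R) : 0 < r -> (4%:E * H r = \int[leb]_(t in `[1%R, +oo[)
    (r * expR (- (r * t)) * rnorm (orbit_integral T x t))%:E)%E.
  move=> r0; rewrite -ge0_integralZl//; last 2 first.
  - apply/measurable_EFinP; exact: (measurable_fun_pair2 (f := f) r mf).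
  - by move=> t _; rewrite lee_fin.
  rewrite [RHS]integral_mkcond; apply: eq_integral => t _.
  rewrite patchE /f /= indicE; case: ifPn => [|_]; last by rewrite mulr0 mule0.
  rewrite inE/= in_itv/= andbT => t1.
  have t0 : 0 <= t by exact: le_trans t1.
  rewrite -EFinM mulr1 mulrA divff// mul1r (max_l (ltW r0)) /N max_l//.
have FT : (\int[mu]_(r in `]0%R, +oo[) H r < +oo)%E.
  apply: le_lt_trans hC.
  (* Tonelli's theorem is applied with the finite measure [weighted]; for each fixed [t] the inner
     integral is then converted back to [mu]. *)
  rewrite -ge0_integral_weighted//.
  pose g (z : RT * RT) : \bar R := (wgt z.1 * f z)%:E.
  have mg : measurable_fun setT g.
    apply/measurable_EFinP; apply: measurable_funM => //.
    by apply: measurableT_comp; [exact: measurable_wgt|exact: measurable_fst].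
  have w_ge0 (r : R) : 0 <= wgt r by rewrite (le_trans _ (wgt_ge1 r)).
  have g0 z : (0 <= g z)%E by rewrite lee_fin mulr_ge0.
  have -> : (\int[weighted hmu]_r ((wgt r)%:E * H r) =
      \int[weighted hmu]_r \int[leb]_t g (r, t))%E.
    apply: eq_integral => r _.
    under [RHS]eq_integral do rewrite /g /= EFinM.
    rewrite ge0_integralZl//.
    - apply/measurable_EFinP; exact: (measurable_fun_pair2 (f := f) r mf).
    - by move=> t _; rewrite lee_fin.
    - by rewrite lee_fin.
  rewrite (fubini_tonelli g mg g0) [leRHS]integral_mkcond.
  apply: ge0_le_integral_sup => [t _|t _]; first exact: integral_ge0.
  have -> : (\int[weighted hmu]_r g (r, t) = \int[mu]_(r in `]0%R, +oo[) (f (r, t))%:E)%E.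
    rewrite -(@ge0_integral_weighted (fun r => (f (r, t))%:E)); last 2 first.
    - by apply/measurable_EFinP; exact: (measurable_fun_pair1 (f := f) t mf).
    - by move=> r; rewrite lee_fin.
    by apply: eq_integral => r _; rewrite /g /= EFinM.
  rewrite patchE; case: ifPn => tD; last first.
    by rewrite integral0_eq// => r _; rewrite /f /= indicE (negbTE tD) mulr0.
  have t1 : 1 <= t by move: tD; rewrite inE/= in_itv/= andbT.
  have t0 : 0 < t by exact: lt_le_trans t1.
  pose c := rnorm (cesaro_mean T t x) / t.
  have c0 : 0 <= c by rewrite divr_ge0 ?rnorm_ge0// ltW.
  (* The orbit integral is [t] times the Cesàro mean, and [c] contains one more factor [1 / t]. *)
  have Nt : N t = t * t * c.
    rewrite /c /cesaro_mean rnormZ /N max_l ?(ltW t0)// gtr0_norm ?invr_gt0//.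
    by rewrite /orbit_integral; field; rewrite gt_eqF.
  have tV : 0 < t^-1 by rewrite invr_gt0.
  have ik := integrable_stieltjes_kernel hmu tV.
  apply: (@le_trans _ _ (\int[mu]_(r in `]0%R, +oo[) (((t^-1 + r)^-1)%:E * c%:E))%E).
    apply: ge0_le_integral_sup => r; first by rewrite lee_fin.
    rewrite /= in_itv/= andbT => r0.
    rewrite -EFinM lee_fin /f/= indicE tD mulr1 (max_l (ltW r0)) Nt.
    have u0 : 0 <= r * t by rewrite mulr_ge0 ?ltW.
    have tc0 : 0 <= 4^-1 * (t * c) by rewrite mulr_ge0 ?invr_ge0 ?(mulr_ge0 (ltW t0) c0).
    (* Here [u = r t]; [t / (1 + r t) = 1 / (1 / t + r)] is the Stieltjes kernel at [1 / t]. *)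
    have := ler_wpM2l tc0 (expR_quad u0).
    have -> : 4^-1 * (t * c) * (4 / (1 + r * t)) = (t^-1 + r)^-1 * c.
      have rt0 : 1 + r * t != 0 by rewrite gt_eqF// ltr_wpDr.
      have rt1 : t^-1 + r != 0 by rewrite gt_eqF// addr_gt0.
      have t_neq0 : t != 0 by rewrite gt_eqF.
      have -> : t^-1 + r = (1 + r * t) / t by field.
      by field; apply/andP; split.
    have -> : 4^-1 * (t * c) * (r * t * expR (- (r * t))) =
      4^-1 * (r * expR (- (r * t)) * (t * t * c)) by ring.
    by [].
  rewrite integralZr; [|exact: mitv|exact: ik].
  rewrite (EFin_Rintegral (mitv _) ik) -EFinM lee_fin.
  by rewrite /c /stieltjes mulrA.
have i1 := integrable_inv1D hmu.
apply: (@le_lt_trans _ _ (\int[mu]_(r in `]0%R, +oo[)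
    ((2 * M * rnorm x)%:E * ((1 + r)^-1)%:E + 4%:E * H r))%E).
  apply: ge0_le_integral_sup => r; first by rewrite lee_fin rnorm_ge0.
  rewrite /= in_itv/= andbT => r0; rewrite HE// -EFinM.
  exact: rnorm_resolvent_split.
have MM0 : (0 <= (2 * M * rnorm x)%:E)%E by rewrite lee_fin !mulr_ge0 ?rnorm_ge0// ltW.
have m1 := measurable_int _ i1.
have i1_ge0 (r : RT) : [set` `](0 : R), +oo[] r -> (0 <= ((1 + r)^-1)%:E)%E.
  rewrite /= in_itv/= andbT => r0.
  by rewrite lee_fin invr_ge0 addr_ge0// ltW.
rewrite ge0_integralD; last 5 first.
- exact: mitv.
- by move=> r r0; rewrite mule_ge0// i1_ge0.
- exact: emeasurable_funM.
- by move=> r _; rewrite mule_ge0.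
- apply: emeasurable_funM; first exact: measurable_cst.
  by apply: (measurable_funS measurableT) => //; exact: mH.
rewrite lte_add_pinfty//.
  rewrite ge0_integralZl; [|exact: mitv|exact: m1|exact: i1_ge0|exact: MM0].
  by rewrite lte_mul_pinfty.
rewrite ge0_integralZl; last 4 first.
- exact: mitv.
- by apply: (measurable_funS measurableT) => //; exact: mH.
- by move=> r _.
- by rewrite lee_fin.
by rewrite lte_mul_pinfty.
Qed.

End Finiteness.

(** * The scalar semigroups *)

Section ComplexNorm.
Context (R : realType).
Implicit Types (z w : R[i]).

Lemma Re_le_rnorm (z : R[i]^o) : `|complex.Re z| <= rnorm z.
Proof. by rewrite -lecR -normCE; exact: normc_ge_Re. Qed.

Lemma rnormM (z w : R[i]^o) : rnorm (z * w) = rnorm z * rnorm w.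
Proof. by rewrite /rnorm normrM !normCE -rmorphM. Qed.

Lemma Im_le_rnorm (z : R[i]^o) : `|complex.Im z| <= rnorm z.
Proof.
have i1 : rnorm ('i%C : R[i]^o) = 1.
  by rewrite /rnorm normc_def/= expr0n expr1n add0r sqrtr1.
rewrite -[leRHS]mulr1 -i1 -rnormM -normrN -ReiNIm; exact: Re_le_rnorm.
Qed.

Lemma rnorm_real (a : R) : rnorm (a%:C%C : R[i]^o) = `|a|.
Proof. by rewrite /rnorm normcR. Qed.

Lemma rnorm_le_ReIm (z : R[i]^o) : rnorm z <= `|complex.Re z| + `|complex.Im z|.
Proof.
have i1 : rnorm ('i%C : R[i]^o) = 1.
  by rewrite /rnorm normc_def/= expr0n expr1n add0r sqrtr1.
rewrite [in leLHS](complexE z) (le_trans (rnormD _ _))//.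
by rewrite rnormM i1 mul1r !rnorm_real.
Qed.

Lemma cvg_complex {I : Type} (F : set_system I) {FF : Filter F} (f : I -> R[i]^o)
    (l : R[i]^o) :
  complex.Re (f t) @[t --> F] --> complex.Re l ->
  complex.Im (f t) @[t --> F] --> complex.Im l -> f t @[t --> F] --> l.
Proof.
move=> fR fI; apply/cvg_rnorm/cvgrPdist_lt => e e0.
have e20 : 0 < e / 2 by rewrite divr_gt0.
have /cvgrPdist_lt/(_ _ e20) hR := fR; have /cvgrPdist_lt/(_ _ e20) hI := fI.
apply: filterS2 hR hI => t hR hI.
rewrite sub0r normrN ger0_norm ?rnorm_ge0// rnorm_distC.
rewrite (le_lt_trans (rnorm_le_ReIm _))// !raddfB/=; lra.
Qed.

Lemma complex_complete (F : set_system R[i]^o) : ProperFilter F -> cauchy F -> cvg F.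
Proof.
move=> FF /cauchyP Fc.
have cR (p : R[i]^o -> R) : (forall z w : R[i]^o, `|p z - p w| <= rnorm (z - w)) ->
    cvg (p @ F).
  move=> pn; apply: (@R_complete R); apply: cauchy_exP => e e0.
  have [|z Fz] := Fc e%:C%C; first by rewrite ltcR.
  exists (p z); suff : F (p @^-1` ball (p z) e) by [].
  apply: filterS Fz => w.
  have -> : ball z e%:C%C w = (`|(z : R[i]^o) - w| < e%:C%C) by [].
  rewrite (@normCE R R[i]^o) ltcR /ball/=; exact: le_lt_trans.
have /cvg_ex[a Fa] : cvg ((fun z : R[i]^o => complex.Re z) @ F).
  by apply: cR => z w; rewrite -raddfB; exact: Re_le_rnorm.
have /cvg_ex[b Fb] : cvg ((fun z : R[i]^o => complex.Im z) @ F).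
  by apply: cR => z w; rewrite -raddfB; exact: Im_le_rnorm.
apply/cvg_ex; exists (Complex a b).
exact: (@cvg_complex _ F _ id (Complex a b)).
Qed.

Lemma addr_real_neq0 (z : R[i]) (s : R) :
  0 < complex.Re z -> 0 <= s -> z + s%:C%C != 0.
Proof.
move=> z0 s0; apply/eqP => /(congr1 (fun w => complex.Re w)).
by rewrite raddfD/= => h; have := ltr_wpDr s0 z0; rewrite h ltxx.
Qed.

End ComplexNorm.

(* An alias of [R[i]^o], on which the instance of completeness can be declared
   without clashing with the one on [R^o] for [R : realType]. *)
Definition cplx (R : realType) : Type := R[i]^o.

HB.instance Definition _ (R : realType) := NormedModule.copy (cplx R) R[i]^o.
HB.instance Definition _ (R : realType) :=
  Uniform_isComplete.Build (cplx R) (@complex_complete R).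

Section ComplexFunctionals.
Context (R : realType).
Local Notation C := (cplx R).

Lemma real_functional_Re : real_functional (fun z : C => complex.Re z).
Proof.
split=> [u v|a u|]; first exact: raddfD.
  by case: u => c d; rewrite /GRing.scale/= mul0r subr0.
by exists 1 => u; rewrite mul1r; exact: Re_le_rnorm.
Qed.

Lemma real_functional_Im : real_functional (fun z : C => complex.Im z).
Proof.
split=> [u v|a u|]; first exact: raddfD.
  by case: u => c d; rewrite /GRing.scale/= mul0r addr0.
by exists 1 => u; rewrite mul1r; exact: Im_le_rnorm.
Qed.

Lemma mul_bounded (c : R[i]) : bounded_real_linear (fun w : C => c * (w : R[i]) : C).
Proof.
split=> [u v|x u|]; first exact: mulrDr.
  exact: mulrCA.
by exists (rnorm (c : R[i]^o)) => u; rewrite (rnormM c u).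
Qed.

(** Real and imaginary parts are themselves real functionals on [cplx R]. *)
Lemma bochner_cintegral (mu : {measure set (measurableTypeR R) -> \bar R})
    (D : set R) (f : R -> C) :
  (forall phi : C -> R, real_functional phi ->
    phi (bochner mu D f) = \int[mu]_(t in D) phi (f t)) ->
  bochner mu D f = cintegral mu D f.
Proof.
move=> H; have HR := H _ real_functional_Re; have HI := H _ real_functional_Im.
by apply/eqP; rewrite eq_complex/= HR HI !eqxx.
Qed.

Lemma cexpD (z w : R[i]) : cexp (z + w) = cexp z * cexp w.
Proof.
case: z w => [a b] [c d]; rewrite /cexp/= expRD cosD sinD.
by congr Complex; ring.
Qed.

Lemma cexp0 : cexp (0 : R[i]) = 1.
Proof. by rewrite /cexp/= expR0 cos0 sin0 mulr1 mulr0. Qed.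

Lemma rnorm_cexp (z : R[i]) : rnorm (cexp z : C) = expR (complex.Re z).
Proof.
rewrite /rnorm normc_def /cexp/= !exprMn -mulrDr cos2Dsin2 mulr1.
by rewrite sqrtr_sqr ger0_norm ?expR_ge0.
Qed.

Definition exp_semigroup (z : R[i]) (s : R) : {linear C -> C} :=
  [the {linear C -> C} of *:%R (cexp (- s%:C%C * z))].

End ComplexFunctionals.

Section ExpSemigroup.
Context (R : realType).
Local Notation C := (cplx R).
Local Notation RT := (measurableTypeR R).
Local Notation leb := (@lebesgue_measure R).
Implicit Types (r s t : R).
Local Opaque resolvent.

Lemma is_derive_cvg_right (f : R -> R) (l : R) : is_derive (0 : R) (1 : R) f l ->
  (h^-1 * (f h - f 0) : R) @[h --> (0 : R)^'+] --> (l : R).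
Proof.
move=> df; apply: cvg_dnbhs_at_right.
have [/cvg_ex[l' /= cl'] <-] := df.
have -> : 'D_1 f (0 : R) = l' by apply: cvg_lim => //; exact: cl'.
apply: cvg_trans cl'; apply: near_eq_cvg; near=> h => /=.
by rewrite addr0 -[h *: 1]/(h * 1) mulr1.
Unshelve. all: by end_near. Qed.

Context (z : R[i]) (z0 : 0 < complex.Re z).
Local Notation a := (complex.Re z).
Local Notation b := (complex.Im z).
Local Notation T := (exp_semigroup z).

Lemma exp_semigroupE s (w : C) : T s w = (cexp (- s%:C%C * z) : R[i]) * (w : R[i]).
Proof. by []. Qed.

Lemma cexp_real s : cexp (- s%:C%C * z) =
  Complex (expR (- (s * a)) * cos (s * b)) (- (expR (- (s * a)) * sin (s * b))).
Proof.
rewrite /cexp.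
have -> : complex.Re (- s%:C%C * z) = - (s * a).
  by case: z => c d /=; ring.
have -> : complex.Im (- s%:C%C * z) = - (s * b).
  by case: z => c d /=; ring.
by rewrite cosN sinN mulrN.
Qed.

(** Reduces to the derivatives at [h = 0] of the two components of [exp (- h z)], which are [- a]
    and [- b]. *)
Lemma has_generator_exp (w : C) : has_generator T w (- (z * (w : R[i])) : C).
Proof.
have g1 : (h^-1)%:C%C * (cexp (- h%:C%C * z) - 1) @[h --> (0 : R)^'+] --> (- z : R[i]^o).
  have E h : (h^-1)%:C%C * (cexp (- h%:C%C * z) - 1) =
    Complex (h^-1 * (expR (- (h * a)) * cos (h * b) - 1))
            (h^-1 * (- (expR (- (h * a)) * sin (h * b)) - 0)).
    rewrite cexp_real; apply/eqP; rewrite eq_complex/=.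
    by apply/andP; split; apply/eqP; ring.
  under eq_fun do rewrite E.
  apply: cvg_complex => /=.
  - have d1 : is_derive (0 : R) (1 : R)
        (fun h : R => expR (- (h * a)) * cos (h * b)) (- a).
      apply: is_derive_eq.
      rewrite /GRing.scale/= !mul0r oppr0 expR0 cos0 sin0; ring.
    have := is_derive_cvg_right d1.
    rewrite !mul0r oppr0 expR0 cos0 mulr1.
    have -> : complex.Re (- z) = - a by exact: raddfN.
    move=> H; apply: cvg_trans H; apply: near_eq_cvg; near=> h.
    reflexivity.
  - have d1 : is_derive (0 : R) (1 : R)
        (fun h : R => - (expR (- (h * a)) * sin (h * b))) (- b).
      apply: is_derive_eq.
      rewrite /GRing.scale/= !mul0r oppr0 expR0 cos0 sin0; ring.
    have := is_derive_cvg_right d1.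
    rewrite !mul0r oppr0 expR0 sin0 mulr0 oppr0.
    have -> : complex.Im (- z) = - b by exact: raddfN.
    move=> H; apply: cvg_trans H; apply: near_eq_cvg; near=> h.
    by rewrite oppr0.
have h1 := (@cvg_rnorm _ R[i]^o _ _ _ _ _).1 g1.
have h2 : rnorm (w : R[i]^o) *
      rnorm ((h^-1)%:C%C * (cexp (- h%:C%C * z) - 1) - - z : R[i]^o)
    @[h --> (0 : R)^'+] --> rnorm (w : R[i]^o) * 0.
  by apply: cvgM; [exact: cvg_cst|exact: h1].
rewrite mulr0 in h2.
apply/(@cvg_rnorm _ C); apply: cvg_trans h2; apply: near_eq_cvg; near=> h.
rewrite -rnormM; congr rnorm; rewrite exp_semigroupE.
rewrite -[_ *: (_ - _)]/((h^-1)%:C%C * (cexp (- h%:C%C * z) * (w : R[i]) - (w : R[i]))).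
ring.
Unshelve. all: by end_near. Qed.

Lemma exp_semigroup_bounded : bounded_C0_semigroup T.
Proof.
split.
- move=> w; rewrite exp_semigroupE rmorph0 oppr0 mul0r cexp0; exact: mul1r.
- move=> s t s0 t0 w; rewrite !exp_semigroupE rmorphD opprD mulrDl cexpD.
  exact/esym/mulrA.
- move=> w; apply/(@cvg_rnorm _ C).
  (* Strong continuity at 0 is deduced from differentiability there:
     [rnorm (T h w - w) <= h (rnorm v + 1)] for small [h]. *)
  have gw : (h^-1)%:C%C *: (T h w - w) @[h --> (0 : R)^'+] --> (- (z * (w : R[i])) : C).
    exact: has_generator_exp.
  pose v : C := - (z * (w : R[i])); pose K := rnorm v + 1.
  have K0 : 0 < K by rewrite ltr_wpDl// rnorm_ge0.
  apply/cvgrPdist_lt => e e0.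
  have /cvg_rnorm/cvgrPdist_lt/(_ 1 ltr01)[d /= d0 Hd] := gw.
  exists (Num.min d (e / K)) => /=.
    by rewrite lt_min d0 divr_gt0.
  move=> h /=; rewrite lt_min => /andP[hd he] h0.
  have := Hd h hd h0; rewrite !sub0r !normrN !ger0_norm ?rnorm_ge0// => H.
  move: he; rewrite sub0r normrN gtr0_norm// ltr_pdivlMr// => he.
  apply: le_lt_trans he.
  rewrite -ler_pdivrMl// -[h^-1](gtr0_norm (x := h^-1)) ?invr_gt0//.
  rewrite -rnormZ.
  have := rnormD ((h^-1)%:C%C *: (T h w - w) - v) v; rewrite subrK => H2.
  by rewrite /K (le_trans H2)// addrC lerD2l ltW.
- exists 1 => t t0 w; rewrite mul1r exp_semigroupE -[rnorm _]/(rnorm (_ * _ : R[i]^o)).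
  rewrite rnormM ler_piMl ?rnorm_ge0// [rnorm _]rnorm_cexp.
  rewrite -[leRHS]expR0 ler_expR.
  have -> : complex.Re (- t%:C%C * z) = - (t * a).
    by case: z => c d /=; ring.
  by rewrite oppr_le0 mulr_ge0// ltW.
Qed.

Let mul_comm (c : R[i]) t (w : C) : 0 <= t ->
  (c * (T t w : R[i]) : C) = T t (c * (w : R[i]) : C).
Proof. by move=> _; rewrite !exp_semigroupE; exact: mulrCA. Qed.

Lemma resolvent_exp_mul (c : R[i]) r (w : C) : 0 < r ->
  (c * (resolvent T r w : R[i]) : C) = resolvent T r (c * (w : R[i]) : C).
Proof.
move=> r0.
exact: (resolvent_comm exp_semigroup_bounded w (mul_bounded c) (@mul_comm c) r0).
Qed.

(** No complex integral is computed: [generator_resolvent] at the vector 1 gives [- z u = r u - 1]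
    for the resolvent [u], because the resolvent commutes with multiplication by [- z]. *)
Lemma resolvent_exp r : 0 < r -> @resolvent R C T r (1 : R[i]) = (z + r%:C%C)^-1.
Proof.
move=> r0; pose u : R[i] := @resolvent R C T r (1 : R[i]).
have E : - z * u = r%:C%C * u - 1.
  apply: etrans (resolvent_exp_mul (- z) (1 : R[i]) r0) _; rewrite mulNr.
  exact: (generator_resolvent exp_semigroup_bounded r0 (@has_generator_exp (1 : R[i]))).
have zr := addr_real_neq0 z0 (ltW r0).
apply: (mulfI zr); rewrite divff// -/u.
have -> : (z + r%:C%C) * u = r%:C%C * u - (- z * u) by ring.
by rewrite E; ring.
Qed.

End ExpSemigroup.

(** * The identity of Laplace transforms *)

Section ScalarIdentity.
Context (R : realType).
Local Notation C := (cplx R).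
Local Notation RT := (measurableTypeR R).
Local Notation leb := (@lebesgue_measure R).
Implicit Types (r s t : R) (w z : R[i]).
Local Opaque resolvent.

Lemma rnorm_inv_shift w s : 0 < complex.Re w -> 0 <= s ->
  rnorm ((w + s%:C%C)^-1 : C) <= (complex.Re w + s)^-1.
Proof.
move=> w0 s0; have ws : 0 < complex.Re w + s by rewrite ltr_wpDr.
have h : complex.Re w + s <= rnorm (w + s%:C%C : R[i]^o).
  by have := Re_le_rnorm (w + s%:C%C); rewrite raddfD/= ger0_norm// ltW.
have n0 : 0 < rnorm (w + s%:C%C : R[i]^o) by exact: lt_le_trans h.
have -> : rnorm ((w + s%:C%C)^-1 : C) = (rnorm (w + s%:C%C : R[i]^o))^-1.
  have w_neq0 := addr_real_neq0 w0 s0.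
  have : rnorm ((w + s%:C%C) * (w + s%:C%C)^-1 : R[i]^o) = 1.
    by rewrite divff// -[1]/((1 : R)%:C%C) rnorm_real normr1.
  rewrite rnormM => E; apply: (mulfI (lt0r_neq0 n0)); rewrite divff ?lt0r_neq0//.
by rewrite lef_pV2.
Qed.

(** Evaluation at the vector 1 turns an operator of the calculus into its symbol; operator
    identities thus become identities between functions of [z]. *)
Lemma hp_op_laplace z (nu : cmeasure R) : 0 < complex.Re z ->
  hp_op (exp_semigroup z) nu (1 : R[i]) = laplace nu z.
Proof.
move=> z0; have hT := exp_semigroup_bounded z0.
have E (m : {finite_measure set RT -> \bar R}) :
    bochner m `[0, +oo[ (fun s => exp_semigroup z s (1 : R[i])) =
    cintegral m `[0, +oo[ (fun s => cexp (- s%:C%C * z)).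
  have -> : (fun s => cexp (- s%:C%C * z)) = (fun s => exp_semigroup z s (1 : R[i])).
    by apply/funext => s; rewrite exp_semigroupE mulr1.
  apply: bochner_cintegral => phi rphi.
  exact: (functional_bochner_finite hT).
by rewrite /hp_op /laplace !E.
Qed.

Context (mu : {measure set RT -> \bar R}).
Hypothesis hmu : (\int[mu]_(s in `]0%R, +oo[) ((1 + s)^-1)%:E < +oo)%E.

Lemma rnorm_inv_shift_lty w : 0 < complex.Re w ->
  (\int[mu]_(s in `]0%R, +oo[) (rnorm ((w + s%:C%C)^-1 : C))%:E < +oo)%E.
Proof.
move=> w0; apply: (@le_lt_trans _ _
    (\int[mu]_(s in `]0%R, +oo[) ((complex.Re w + s)^-1)%:E)%E).
  apply: ge0_le_integral_sup => s; first by rewrite lee_fin rnorm_ge0.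
  by rewrite /= in_itv/= andbT => s0; rewrite lee_fin rnorm_inv_shift// ltW.
have := integrable_fin_num (mitv _) (integrable_stieltjes_kernel hmu w0).
by rewrite fin_numElt => /andP[].
Qed.

Lemma resolvent_exp_lty z : 0 < complex.Re z ->
  (\int[mu]_(r in `]0%R, +oo[)
     (rnorm (@resolvent R C (exp_semigroup z) r (1 : R[i])))%:E < +oo)%E.
Proof.
move=> z0; apply: le_lt_trans (rnorm_inv_shift_lty z0).
apply: ge0_le_integral_sup => r; first by rewrite lee_fin rnorm_ge0.
by rewrite /= in_itv/= andbT => r0; rewrite (resolvent_exp z0 r0).
Qed.

Lemma stieltjes_op_exp z : 0 < complex.Re z ->
  @stieltjes_op R C (exp_semigroup z) mu (1 : R[i]) = stieltjesC mu z.
Proof.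
move=> z0; have hT := exp_semigroup_bounded z0.
transitivity (cintegral mu `]0, +oo[
    (fun r => @resolvent R C (exp_semigroup z) r (1 : R[i]))).
  apply: bochner_cintegral => phi rphi.
  exact: (functional_stieltjes_op hT (resolvent_exp_lty z0)).
rewrite /stieltjesC /cintegral; congr Complex; apply: eq_Rintegral => r;
  by rewrite inE/= in_itv/= andbT => r0; rewrite (resolvent_exp z0 r0).
Qed.

Lemma laplace_stieltjes z : 0 < complex.Re z ->
  laplace (reg_measure R) z * stieltjesC mu z = laplace (reg_stieltjes hmu) z.
Proof.
move=> z0; have hT := exp_semigroup_bounded z0.
rewrite -!hp_op_laplace// -(stieltjes_op_exp z0).
rewrite -(hp_op_stieltjes hT hmu (resolvent_exp_lty z0)) !(hp_op_reg hT).
pose y : R[i] := @stieltjes_op R C (exp_semigroup z) mu (1 : R[i]).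
pose u : R[i] := @resolvent R C (exp_semigroup z) 1 (1 : R[i]).
(* Commutation with multiplication by [y] turns the operator [1 - Res 1] at [y] into the factor
   [1 - u]. *)
have E : y * u = @resolvent R C (exp_semigroup z) 1 y.
  apply: etrans (resolvent_exp_mul z0 y (1 : R[i]) ltr01) _.
  by congr resolvent; exact: mulr1.
suff : (1 - u) * y = y - y * u by rewrite E.
ring.
Qed.

End ScalarIdentity.

(** * Holomorphy of Stieltjes functions on the right half-plane *)

Section Holomorphy.
Context (R : realType).
Local Notation C := (cplx R).
Local Notation RT := (measurableTypeR R).
Implicit Types (s t c K : R) (w z h : R[i]).
Context (mu : {measure set RT -> \bar R}).
Hypothesis hmu : (\int[mu]_(s in `]0%R, +oo[) ((1 + s)^-1)%:E < +oo)%E.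

Let g w s : R[i] := (w + s%:C%C)^-1.

Let g_continuous w s : 0 < complex.Re w -> 0 < s ->
  (g w t : R[i]^o) @[t --> s] --> (g w s : R[i]^o).
Proof.
move=> w0 s0; apply: cvgV; first exact: addr_real_neq0 w0 (ltW s0).
apply: cvgD; first exact: cvg_cst.
by apply: cvg_real_complex; exact: cvg_id.
Qed.

Section Functional.
Context (G : R -> C) (K c : R).
Hypothesis c0 : 0 < c.
Hypothesis cG : forall s, 0 < s -> (G t : R[i]^o) @[t --> s] --> (G s : R[i]^o).
Hypothesis GK : forall s, 0 < s -> rnorm (G s) <= K / (c + s).

Let cG' s : [set` `]0, +oo[] s -> G t @[t --> s] --> G s.
Proof. by rewrite /= in_itv/= andbT; exact: cG. Qed.

Let bound_lty : (\int[mu]_(s in `]0%R, +oo[) (rnorm (G s))%:E <=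
  (K * \int[mu]_(s in `]0, +oo[) (c + s)^-1)%:E)%E.
Proof.
have ik := integrable_stieltjes_kernel hmu c0.
rewrite EFinM -(EFin_Rintegral (mitv _) ik) -(integralZl (mitv _) ik K).
apply: ge0_le_integral_sup => s; first by rewrite lee_fin rnorm_ge0.
by rewrite /= in_itv/= andbT => s0; rewrite -EFinM lee_fin GK.
Qed.

Let fin : (\int[mu]_(s in `]0%R, +oo[) (rnorm (G s))%:E < +oo)%E.
Proof. exact: le_lt_trans bound_lty (ltry _). Qed.

Lemma integrable_functional_kernel phi : real_functional phi ->
  mu.-integrable `]0, +oo[ (EFin \o (phi \o G)).
Proof. exact: (integrable_functional_line (mitv _) (fun _ _ => erefl) cG' fin). Qed.

Lemma functional_cintegral (phi : C -> R) : real_functional phi ->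
  phi (cintegral mu `]0, +oo[ G) = \int[mu]_(s in `]0, +oo[) phi (G s).
Proof.
move=> rphi; rewrite -(bochner_cintegral (f := G)).
  exact: (functional_bochner_line (mitv _) (fun _ _ => erefl) cG' fin).
exact: (functional_bochner_line (mitv _) (fun _ _ => erefl) cG' fin).
Qed.

Lemma rnorm_cintegral :
  rnorm (cintegral mu `]0, +oo[ G : C) <= K * \int[mu]_(s in `]0, +oo[) (c + s)^-1.
Proof.
have [phi [rphi phi1 <-]] := norming_functional (cintegral mu `]0, +oo[ G : C).
rewrite functional_cintegral//.
have ik := integrable_stieltjes_kernel hmu c0.
rewrite -(RintegralZl _ (mitv _) ik).
apply: le_Rintegral; first exact: mitv.
- exact: integrable_functional_kernel.
- exact: (integrableZl (mitv _) K ik).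
move=> s; rewrite /= in_itv/= andbT => s0.
by rewrite (le_trans (ler_norm _))// (le_trans (phi1 _))// GK.
Qed.

End Functional.

Let g_bound w c s : 0 < c -> c <= complex.Re w -> 0 < s ->
  rnorm (g w s : C) <= (c + s)^-1.
Proof.
move=> c0 cw s0; rewrite (le_trans (rnorm_inv_shift (lt_le_trans c0 cw) (ltW s0)))//.
have cs : 0 < c + s by exact: addr_gt0.
have ws : 0 < complex.Re w + s by rewrite addr_gt0// (lt_le_trans c0).
by rewrite lef_pV2 ?lerD2r.
Qed.

Let g_bound_cst w c s : 0 < c -> c <= complex.Re w -> 0 < s ->
  rnorm (g w s : C) <= c^-1.
Proof.
move=> c0 cw s0; rewrite (le_trans (g_bound c0 cw s0))//.
have cs : 0 < c + s by exact: addr_gt0.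
by rewrite lef_pV2// lerDl ltW.
Qed.

Let Re_shift z h : rnorm (h : C) <= complex.Re z / 2 ->
  complex.Re z / 2 <= complex.Re (z + h).
Proof.
move=> hz; have := le_trans (Re_le_rnorm h) hz.
by rewrite ler_norml raddfD/=; lra.
Qed.

Let g2 z s : R[i] := g z s * g z s.
Let g3 z h s : R[i] := g (z + h) s * g2 z s.

Let g2_continuous z s : 0 < complex.Re z -> 0 < s ->
  (g2 z t : R[i]^o) @[t --> s] --> (g2 z s : R[i]^o).
Proof. by move=> z0 s0; apply: cvgM; exact: g_continuous. Qed.

Section Increment.
Context (z h : R[i]).
Hypotheses (z0 : 0 < complex.Re z) (hz : rnorm (h : C) <= complex.Re z / 2).
Local Notation c := (complex.Re z / 2).

Let c0 : 0 < c. Proof. by rewrite divr_gt0. Qed.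
Let cz : c <= complex.Re z. Proof. by have := z0; lra. Qed.
Let czh : c <= complex.Re (z + h). Proof. exact: Re_shift. Qed.
Let zh0 : 0 < complex.Re (z + h). Proof. exact: lt_le_trans czh. Qed.

Let bound1 w s : c <= complex.Re w -> 0 < s -> rnorm (g w s : C) <= 1 / (c + s).
Proof. by move=> cw s0; rewrite div1r g_bound. Qed.

Let bound2 s : 0 < s -> rnorm (g2 z s : C) <= c^-1 / (c + s).
Proof.
move=> s0; rewrite rnormM.
by apply: ler_pM; rewrite ?rnorm_ge0//; [exact: g_bound_cst|exact: g_bound].
Qed.

Let bound3 s : 0 < s -> rnorm (g3 z h s : C) <= c^-1 * c^-1 / (c + s).
Proof.
move=> s0; rewrite rnormM -mulrA.
by apply: ler_pM; rewrite ?rnorm_ge0//; [exact: g_bound_cst|exact: bound2].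
Qed.

Let g3_continuous s : 0 < s -> (g3 z h t : R[i]^o) @[t --> s] --> (g3 z h s : R[i]^o).
Proof.
by move=> s0; apply: cvgM; [exact: g_continuous|exact: g2_continuous].
Qed.

Let I (f : R -> R[i]) : C := cintegral mu `]0, +oo[ f.

(** Integrated second-order expansion of [1 / (z + s)]. As [h] is at most half the real part of [z],
    both [z] and [z + h] have real part at least [c], which bounds all the kernels by multiples of
    [1 / (c + s)]. *)
Lemma stieltjesC_increment :
  stieltjesC mu (z + h) - stieltjesC mu z =
  h ^+ 2 * I (g3 z h) - h * I (g2 z).
Proof.
apply: (@functional_ext _ C) => phi rphi.
have r1 := functional_comp (mul_bounded h) rphi.
have r2 := functional_comp (mul_bounded (h ^+ 2)) rphi.
have c1 w := fun (w0 : 0 < complex.Re w) s => @g_continuous w s w0.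
have c2 := fun s => @g2_continuous z s z0.
have F1 w (cw : c <= complex.Re w) := functional_cintegral c0
  (@c1 w (lt_le_trans c0 cw)) (fun s => @bound1 w s cw) rphi.
have J1 w (cw : c <= complex.Re w) := integrable_functional_kernel c0
  (@c1 w (lt_le_trans c0 cw)) (fun s => @bound1 w s cw) rphi.
have J2 := integrable_functional_kernel c0 c2 bound2 r1.
have J3 := integrable_functional_kernel c0 g3_continuous bound3 r2.
have F2 : phi (h * I (g2 z)) = _ := functional_cintegral c0 c2 bound2 r1.
have F3 : phi (h ^+ 2 * I (g3 z h)) = _ :=
  functional_cintegral c0 g3_continuous bound3 r2.
apply: etrans (functionalB _ _ rphi) _; apply: etrans; last first.
  exact/esym/(functionalB _ _ rphi).
rewrite F2 F3; apply: etrans (congr2 (fun a b => a - b) (F1 _ czh) (F1 _ cz)) _.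
rewrite -(RintegralB (mitv _) (J1 _ czh) (J1 _ cz)) -(RintegralB (mitv _) J3 J2).
apply: eq_Rintegral => s; rewrite inE/= in_itv/= andbT => s0.
apply: etrans (esym (functionalB _ _ rphi)) _.
apply: etrans; last exact: (functionalB _ _ rphi).
congr phi; rewrite /g3 /g2 /g.
have n1 := addr_real_neq0 z0 (ltW s0); have n2 := addr_real_neq0 zh0 (ltW s0).
suff : (z + h + s%:C%C)^-1 - (z + s%:C%C)^-1 =
  h ^+ 2 * ((z + h + s%:C%C)^-1 * ((z + s%:C%C)^-1 * (z + s%:C%C)^-1)) -
  h * ((z + s%:C%C)^-1 * (z + s%:C%C)^-1) by [].
by field; rewrite n1 n2.
Qed.

Lemma rnorm_stieltjesC_increment :
  rnorm (stieltjesC mu (z + h) - stieltjesC mu z + h * I (g2 z) : C) <=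
  rnorm (h : C) ^+ 2 * (c^-1 * c^-1 * stieltjes mu c).
Proof.
rewrite stieltjesC_increment subrK rnormM ler_pM ?rnorm_ge0//.
  by rewrite expr2 rnormM.
exact: (rnorm_cintegral c0 g3_continuous bound3).
Qed.

End Increment.

(** The derivative is minus the integral of [(z + s)^-2]; the remainder is at most [K rnorm h ^ 2],
    with [K] independent of [h]. *)
Lemma holomorphic_stieltjesC : holomorphic_Cplus (stieltjesC mu).
Proof.
move=> z z0; pose l : R[i]^o := - cintegral mu `]0, +oo[ (g2 z).
apply/cvg_ex; exists l; apply/cvg_rnorm.
set c := complex.Re z / 2; have c0 : 0 < c by rewrite divr_gt0.
pose K := c^-1 * c^-1 * stieltjes mu c.
apply/cvgrPdist_le => e e0.
(* The bound [c] keeps [z + h] in the half-plane of the estimate; [|K| + 1] avoids a zero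
   denominator. *)
have d0 : 0 < Num.min c (e / (`|K| + 1)).
  by rewrite lt_min c0 divr_gt0// ltr_wpDl.
near=> h.
have h0 : h != 0 by near: h; exact: nbhs_dnbhs_neq.
have : `|h| < (Num.min c (e / (`|K| + 1)))%:C%C.
  near: h; apply: dnbhs0_lt; rewrite ltcR//.
rewrite (@normCE R R[i]^o) ltcR lt_min => /andP[hc].
rewrite ltr_pdivlMr ?ltr_wpDl// => hK.
rewrite sub0r normrN ger0_norm ?rnorm_ge0//.
have n0 : 0 < rnorm (h : C).
  by rewrite lt_neqAle rnorm_ge0 andbT eq_sym; apply: contraNneq h0 => /rnorm_eq0 ->.
apply: (@le_trans _ _ (rnorm (h : C) * K)); last first.
  apply: le_trans (ltW hK); rewrite ler_wpM2l ?rnorm_ge0//.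
  by rewrite (le_trans (ler_norm K))// lerDl.
rewrite -(ler_pM2l n0) mulrA -expr2.
apply: le_trans (rnorm_stieltjesC_increment z0 (ltW hc)).
rewrite -rnormM le_eqVlt; apply/orP; left; apply/eqP/congr1.
have hz : shift z (h *: (1 : R[i]^o)) = z + h.
  by rewrite /shift/= addrC -[h *: _]/(h * 1) mulr1.
rewrite -[(_ \o _) _]/(stieltjesC mu (shift z (h *: (1 : R[i]^o)))) hz.
rewrite -[_ *: _]/(h^-1 * (stieltjesC mu (z + h) - stieltjesC mu z)) /l opprK.
by rewrite mulrDr mulrA divff// mul1r.
Unshelve. all: by end_near.
Qed.

End Holomorphy.

Theorem corollary3p6 (R : realType) (X : completeNormedModType R[i])
    (T : R -> {linear X -> X}) (domA : set X) (A : X -> X)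
    (mu : {measure set (measurableTypeR R) -> \bar R}) (x : X) :
  bounded_C0_semigroup T ->
  is_generator T domA (fun y => - A y) ->
  closure (A @` domA) = [set: X] ->
  stieltjes_measure mu ->
  stieltjes mu s @[s --> 0^'+] --> +oo ->
  (\int[@lebesgue_measure R]_(t in `[1%R, +oo[)
     (stieltjes mu t^-1 * rnorm (cesaro_mean T t x) / t)%:E < +oo)%E ->
  hp_dom T (stieltjesC mu) x.
Proof.
move=> hT genA ranA [_ hmu] _ hC.
have hx := stieltjes_op_integrable hT hmu hC.
exists (stieltjes_op T mu x); split; first exact: holomorphic_stieltjesC.
exists (reg_measure R), (reg_stieltjes hmu); split; last exact: hp_op_stieltjes.
split; first exact: laplace_stieltjes.
exact: (@hp_op_reg_inj _ _ _ hT _ _ genA ranA).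
Qed.
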